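(* Let $k\in(1,+\infty]$, let $E$ be a complex Banach space such that $E'$ is separable, and let $(\mathcal{P}_\Theta({}^{m}E))_{m=0}^\infty$ be a $\pi_1$-holomorphy type from $E$ to $\mathbb{C}$. Then every nontrivial convolution operator on $Exp_{\Theta,0}^{k}(E)$ is mixing, and thus in particular hypercyclic.
   Context: $E$ is a complex Banach space, $E'$ its topological dual, $\mathbb{N}_0=\mathbb{N}\cup\{0\}$. $\mathcal{P}({}^jE)$ is the Banach space of continuous $j$-homogeneous polynomials $E\to\mathbb{C}$ with the sup norm on the unit ball; $\check P$ is the symmetric $j$-linear form associated to $P\in\mathcal P({}^jE)$; $\mathcal{P}_f({}^jE)$ is the subspace of finite type polynomials, i.e. the span of $\{\phi^j:\phi\in E'\}$; $\mathcal H(E)$ is the space of entire functions on $E$. If $f(x)=\sum_m P_m(x-a)$ is the Taylor expansion of $f$ at $a$, then $\hat d^m f(a)=m!P_m$. In particular, for $P\in\mathcal P({}^jE)$, $\hat d^kP(a)(x)=\frac{j!}{(j-k)!}\check P(x,\dots,x,a,\dots,a)$ ($x$ taken $k$ times). A holomorphy type $\Theta$ from $E$ to $\mathbb C$ is a sequence of Banach spaces $(\mathcal P_\Theta({}^jE))_{j=0}^\infty$, with norms denoted $\|\cdot\|_\Theta$, such that: (1) each $\mathcal P_\Theta({}^jE)$ is a vector subspace of $\mathcal P({}^jE)$, and $\mathcal P_\Theta({}^0E)=\mathbb C$ as a normed space; (2) there is $\sigma\ge 1$ such that for all $k\le j$ in $\mathbb N_0$, $a\in E$ and $P\in\mathcal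 P_\Theta({}^jE)$, one has $\hat d^kP(a)\in\mathcal P_\Theta({}^kE)$ and $\|\frac1{k!}\hat d^kP(a)\|_\Theta\le\sigma^j\|P\|_\Theta\|a\|^{j-k}$. $\Theta$ is a $\pi_1$-holomorphy type if moreover: (i) $\mathcal P_f({}^jE)\subset\mathcal P_\Theta({}^jE)$ and there is $K>0$ such that $\|b\,\phi^j\|_\Theta\le K^j\|\phi\|^j|b|$ for all $\phi\in E'$, $b\in\mathbb C$, $j\in\mathbb N_0$; (ii) $\mathcal P_f({}^jE)$ is dense in $(\mathcal P_\Theta({}^jE),\|\cdot\|_\Theta)$ for every $j$. For $k\in[1,+\infty)$, $Exp_{\Theta,0}^k(E)$ is the space of all $f\in\mathcal H(E)$ with $\hat d^jf(0)\in\mathcal P_\Theta({}^jE)$ for all $j\in\mathbb N_0$ and $\|f\|_{\Theta,k,\rho}=\sum_{j=0}^\infty\rho^{-j}\left(\frac{j}{ke}\right)^{j/k}\left\|\frac1{j!}\hat d^jf(0)\right\|_\Theta<\infty$ for all $\rho>0$ (the weight being $1$ for $j=0$), with the topology given by the norms $\|\cdot\|_{\Theta,k,\rho}$, $\rho>0$. For $k=+\infty$, $Exp_{\Theta,0}^\infty(E)$ is the space of all $f\in\mathcal H(E)$ with $\hat d^jf(0)\in\mathcal P_\Theta({}^jE)$ for all $j$ and $\lim_{j\to\infty}\|\frac1{j!}\hat d^jf(0)\|_\Theta^{1/j}=0$, with the topology given by the norms $p^\infty_{\Theta,\rho}(f)=\sum_j\rho^{-j}\|\frac1{j!}\hat d^jf(0)\|_\Theta$,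 $\rho>0$. These are Fréchet spaces. A convolution operator on $Exp_{\Theta,0}^k(E)$ is a continuous linear map $L:Exp_{\Theta,0}^k(E)\to Exp_{\Theta,0}^k(E)$ such that $d(Lf)(\cdot)a=L(df(\cdot)a)$ for all $a\in E$ and $f\in Exp_{\Theta,0}^k(E)$, where $df(\cdot)a$ is the function $x\mapsto\hat d^1f(x)(a)$ (which belongs to $Exp_{\Theta,0}^k(E)$). It is nontrivial if it is not a scalar multiple of the identity. A continuous linear operator $T:X\to X$ on a topological vector space is mixing if for any non-empty open sets $U,V\subset X$ there is $n_0\in\mathbb N$ with $T^n(U)\cap V\ne\emptyset$ for all $n\ge n_0$; it is hypercyclic if $\{x,T(x),T^2(x),\dots\}$ is dense in $X$ for some $x\in X$. *)

(* Defs.v *)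
From HB Require Import structures.
From mathcomp Require Import all_boot all_order all_algebra all_fingroup.
From mathcomp Require Import all_classical all_reals all_analysis.
From mathcomp Require Import complex ring lra.

Set Implicit Arguments.
Unset Strict Implicit.
Unset Printing Implicit Defensive.

Import Order.TTheory GRing.Theory Num.Theory.
Import numFieldNormedType.Exports.

Local Open Scope classical_set_scope.
Local Open Scope ring_scope.

(* MathComp-Analysis norms on a complex normed space take their values in
   [R[i]]; [rnorm x] is the same number seen as an element of [R]. *)
Definition rnorm (R : realType) (V : normedModType R[i]) (x : V) : R :=
  complex.Re `|x|.

Section Dual.
Variables (R : realType) (E : completeNormedModType R[i]).

Definition top_dual : set (E -> R[i]^o) := [set phi : E -> R[i]^o | linear phi /\ continuous phi].

Definition dual_norm (phi : E -> R[i]^o) : R :=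
  sup [set rnorm (phi x) | x in [set x : E | rnorm x <= 1]].

Definition separable_dual : Prop :=
  exists D : set (E -> R[i]^o),
    [/\ countable D, D `<=` top_dual &
        forall phi, top_dual phi -> forall e : R, 0 < e ->
          exists2 psi, D psi & dual_norm (phi - psi) < e].

End Dual.

Section HomogeneousPolynomials.
Variables (R : realType) (E : completeNormedModType R[i]).

Definition multilinear j (A : ('I_j -> E) -> R[i]^o) : Prop :=
  forall (i : 'I_j) (x : 'I_j -> E),
    linear (fun y : E => A (fun i' => if i' == i then y else x i') : R[i]^o).

Definition hpoly j : set (E -> R[i]^o) :=
  [set P | continuous P /\
           exists2 A : ('I_j -> E) -> R[i]^o,
             multilinear A & forall x, P x = A (fun=> x)].

Definition finite_type_poly j : set (E -> R[i]^o) :=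
  [set P | exists n (c : 'I_n -> R[i]) (phi : 'I_n -> E -> R[i]^o),
     (forall i, top_dual (phi i)) /\
     P = (fun x => \sum_(i < n) c i * phi i x ^+ j)].

Definition taylor_at (f : E -> R[i]^o) (a : E) (P : nat -> E -> R[i]^o) : Prop :=
  (forall m, hpoly m (P m)) /\
  exists2 r : R[i], 0 < r &
    {uniform ball a r,
      (fun n x => \sum_(m < n) P m (x - a) : R[i]^o) @ \oo --> f}.

Definition entire (f : E -> R[i]^o) : Prop :=
  forall a, exists P, taylor_at f a P.

(* The Taylor coefficients at a point are unique ([taylor_unique] below). *)
Definition taylor (f : E -> R[i]^o) (a : E) : nat -> E -> R[i]^o :=
  xget (fun=> 0) [set P | taylor_at f a P].

(* [dhat m f a] is the m-homogeneous polynomial \hat d^m f(a). *)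
Definition dhat (m : nat) (f : E -> R[i]^o) (a : E) : E -> R[i]^o :=
  (m`!%:R : R[i]) *: taylor f a m.

End HomogeneousPolynomials.

Record banach_subspace (R : realType) (V : lmodType R[i])
    (S : set V) (N : V -> R) : Prop := BanachSubspace {
  bs_zero : S 0;
  bs_lin : forall (c : R[i]) u v, S u -> S v -> S (c *: u + v);
  bs_norm_ge0 : forall u, S u -> 0 <= N u;
  bs_norm_eq0 : forall u, S u -> N u = 0 -> u = 0;
  bs_normZ : forall (c : R[i]) u, S u -> N (c *: u) = rnorm (c : R[i]^o) * N u;
  bs_normD : forall u v, S u -> S v -> N (u + v) <= N u + N v;
  bs_complete : forall u : nat -> V, (forall n, S (u n)) ->
    (forall e : R, 0 < e -> exists n0 : nat, forall m n : nat,
       (n0 <= m)%N -> (n0 <= n)%N -> N (u m - u n) < e) ->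
    exists2 l, S l & (fun n => N (u n - l)) @ \oo --> (0 : R)
}.

(* The value of [ht_norm j] is meaningful only on [ht_space j]. *)
Record holomorphy_type (R : realType) (E : completeNormedModType R[i]) :=
  HolomorphyType {
  ht_space : nat -> set (E -> R[i]^o);
  ht_norm : nat -> (E -> R[i]^o) -> R;
  ht_banach : forall j, banach_subspace (ht_space j) (ht_norm j);
  ht_hpoly : forall j, ht_space j `<=` hpoly (E := E) j;
  ht_space0 : ht_space 0 = [set P | exists c, P = (fun=> c)];
  ht_norm0 : forall c : R[i]^o, ht_norm 0 (fun=> c) = rnorm c;
  ht_dhat : exists2 sigma : R, 1 <= sigma &
    forall (k j : nat) (a : E) (P : E -> R[i]^o), (k <= j)%N -> ht_space j P ->
      ht_space k (dhat k P a) /\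
      ht_norm k ((k`!%:R : R[i])^-1 *: dhat k P a)
        <= sigma ^+ j * ht_norm j P * rnorm a ^+ (j - k)
}.

Record pi1_holomorphy_type (R : realType) (E : completeNormedModType R[i])
    (Theta : holomorphy_type E) : Prop := Pi1HolomorphyType {
  pi1_sub : forall j, finite_type_poly (E := E) j `<=` ht_space Theta j;
  pi1_bound : exists2 K : R, 0 < K &
    forall (phi : E -> R[i]^o) (b : R[i]^o) (j : nat), top_dual phi ->
      ht_norm Theta j (fun x => b * phi x ^+ j)
        <= K ^+ j * dual_norm phi ^+ j * rnorm b;
  pi1_dense : forall j P, ht_space Theta j P -> forall e : R, 0 < e ->
    exists2 Q, finite_type_poly j Q & ht_norm Theta j (P - Q) < e
}.

Section ExpSpace.
Variables (R : realType) (E : completeNormedModType R[i]).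
Variables (Theta : holomorphy_type E) (k : \bar R).

Definition coef_norm (f : E -> R[i]^o) (j : nat) : R :=
  ht_norm Theta j ((j`!%:R : R[i])^-1 *: dhat j f 0).

(* For [j = 0] the weight is [0 `^ 0 = 1]. *)
Definition exp_weight (j : nat) : R :=
  if k == +oo%E then 1
  else (j%:R / (fine k * expR 1)) `^ (j%:R / fine k).

Definition exp_norm (rho : R) (f : E -> R[i]^o) : \bar R :=
  (\sum_(0 <= j <oo) (rho ^- j * exp_weight j * coef_norm f j)%:E)%E.

Definition exp_growth (f : E -> R[i]^o) : Prop :=
  if k == +oo%E
  then (fun j => coef_norm f j `^ (j%:R^-1)) @ \oo --> (0 : R)
  else forall rho : R, 0 < rho -> (exp_norm rho f < +oo)%E.

Definition exp_set : set (E -> R[i]^o) :=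
  [set f | [/\ entire f, forall j, ht_space Theta j (dhat j f 0) & exp_growth f]].

Definition exp_pred : {pred E -> R[i]^o} := [pred f | `[< exp_set f >]].

Record Exp := MkExp { exp_fun :> E -> R[i]^o ; _ : exp_fun \in exp_pred }.

HB.instance Definition _ := [isSub for exp_fun].
HB.instance Definition _ := [Choice of Exp by <:].

End ExpSpace.

Section Uniqueness.
Variables (R : realType) (E : completeNormedModType R[i]).
Local Notation C := R[i]^o.

Lemma rnormE (V : normedModType R[i]) (x : V) : `|x| = (rnorm x)%:C%C.
Proof. by rewrite /rnorm RRe_real // normr_real. Qed.

Lemma rnorm_ge0 (V : normedModType R[i]) (x : V) : 0 <= rnorm x.
Proof. by rewrite -ler0c -rnormE. Qed.

Lemma rnormZ (V : normedModType R[i]) (c : C) (x : V) :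
  rnorm ((c : R[i]) *: x) = rnorm c * rnorm x.
Proof. by apply: complexI; rewrite -rnormE normrZ (rnormE x) (rnormE c) rmorphM. Qed.

Lemma rnormD (V : normedModType R[i]) (x y : V) :
  rnorm (x + y) <= rnorm x + rnorm y.
Proof. by rewrite -lecR rmorphD /= -!rnormE ler_normD. Qed.

Lemma rnorm_eq0 (V : normedModType R[i]) (x : V) : rnorm x = 0 -> x = 0.
Proof. by move=> h; apply/eqP; rewrite -normr_eq0 rnormE h. Qed.

Lemma rnorm_real (x : R) : 0 <= x -> rnorm (x%:C%C : C) = x.
Proof. by move=> x0; apply: complexI; rewrite -rnormE ger0_norm // ler0c. Qed.

Lemma hpoly_hom j (P : E -> C) (c : C) x : hpoly j P ->
  P ((c : R[i]) *: x) = c ^+ j * P x.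
Proof.
move=> [_ [A mA PA]]; rewrite !PA.
suff H n : (n <= j)%N ->
    A (fun i : 'I_j => if (i < n)%N then (c : R[i]) *: x else x)
    = c ^+ n * A (fun=> x).
  rewrite -(H j (leqnn j)); congr A; apply/funext => i.
  by rewrite ltn_ord.
elim: n => [|n IH] nj; first by rewrite expr0 mul1r.
rewrite exprS -mulrA -IH; last exact: ltnW.
pose i0 := Ordinal nj.
have := mA i0 (fun i => if (i < n)%N then (c : R[i]) *: x else x).
move=> lA.
pose G (y : E) : C := A (fun i' => if i' == i0 then y else
                    if (i' < n)%N then (c : R[i]) *: x else x).
have lG : linear G by exact: lA.
have -> : A (fun i : 'I_j => if (i < n.+1)%N then (c : R[i]) *: x else x)
          = G ((c : R[i]) *: x).
  congr A; apply/funext => i; case: eqVneq => [->|ne] /=; first by rewrite ltnSn.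
  by rewrite ltnS leq_eqVlt -(inj_eq val_inj) /= in ne *; rewrite (negbTE ne).
have -> : A (fun i : 'I_j => if (i < n)%N then (c : R[i]) *: x else x) = G x.
  congr A; apply/funext => i; case: eqVneq => [->|//] /=; by rewrite ltnn.
have G0 : G 0 = 0.
  by have := lG (-1) 0 0; rewrite scaler0 addr0 => ->; rewrite scaleN1r addNr.
by have := lG c x 0; rewrite addr0 G0 addr0.
Qed.

Lemma hpoly_lin j (c : C) (P Q : E -> C) : hpoly j P -> hpoly j Q ->
  hpoly j ((c : R[i]) *: P + Q).
Proof.
move=> [cP [A mA PA]] [cQ [B mB QB]]; split.
  by move=> x; apply: cvgD; [apply: cvgZr; exact: cP|exact: cQ].
exists ((c : R[i]) *: A + B) => [i x a u v|x]; last by rewrite !fctE PA QB.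
rewrite !fctE /= (mA i x a u v) (mB i x a u v).
by rewrite !scalerDr !scalerA addrACA mulrC.
Qed.

Lemma hpoly0 j : hpoly j (0 : E -> C).
Proof.
split; first exact: cst_continuous.
exists (fun=> 0) => // i x a u v; by rewrite scaler0 add0r.
Qed.

Lemma powser_unique (c : nat -> C) (d : R) : 0 < d ->
  (forall t : C, rnorm t < d -> forall e : R, 0 < e ->
     \forall n \near \oo, rnorm (\sum_(m < n) t ^+ m * c m : C) < e) ->
  forall n, c n = 0.
Proof.
move=> d0 H n; elim/ltn_ind: n => n IH.
pose t0 : C := (d / 2)%:C%C.
have rt0 : rnorm t0 = d / 2.
  by rewrite rnorm_real // divr_ge0 // ltW.
have rM (x y : C) : rnorm (x * y) = rnorm x * rnorm y by exact: rnormZ.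
have rX (x : C) m : rnorm (x ^+ m) = rnorm x ^+ m.
  elim: m => [|m IHm]; last by rewrite !exprS rM IHm.
  by rewrite !expr0; apply: complexI; rewrite -rnormE normr1.
have rN (x : C) : rnorm (- x) = rnorm x by apply: complexI; rewrite -!rnormE normrN.
pose b m := (d / 2) ^+ m * rnorm (c m).
have b0 m : 0 <= b m by rewrite mulr_ge0 ?rnorm_ge0 // exprn_ge0 // divr_ge0 // ltW.
have [N0 HN0] : exists N0, forall m, (N0 <= m)%N -> b m <= 2.
  have lt0d : rnorm t0 < d by rewrite rt0 ltr_pdivrMr // ltr_pMr // ltr1n.
  have [N0 _ HN] := H t0 lt0d 1 ltr01.
  exists N0 => m N0m.
  have -> : b m = rnorm (t0 ^+ m * c m) by rewrite rM rX rt0.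
  have -> : t0 ^+ m * c m = (\sum_(i < m.+1) t0 ^+ i * c i) +
     - (\sum_(i < m) t0 ^+ i * c i) by rewrite big_ord_recr /= addrAC subrr add0r.
  apply: le_trans (rnormD _ _) _; rewrite rN.
  have h1 := HN m N0m; have h2 := HN m.+1 (leqW N0m).
  by rewrite -[2]/(1 + 1); apply: lerD; apply: ltW.
pose M := 2 + \sum_(i < N0) b i.
have bM m : b m <= M.
  case: (leqP N0 m) => [/HN0 h|mN]; rewrite /M.
    by rewrite (le_trans h) // lerDl sumr_ge0.
  by rewrite (bigD1 (Ordinal mN)) //= addrCA lerDl addr_ge0 // sumr_ge0.
have M0 : 0 < M by rewrite /M ltr_wpDr // sumr_ge0.
have key (s : R) : 0 < s -> s <= 1 / 2 -> b n <= 2 * M * s.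
  move=> s0 s12.
  suff : s ^+ n * b n <= s ^+ n * (2 * M * s) by rewrite ler_pM2l // exprn_gt0.
  apply/ler_addgt0Pr => e e0.
  pose t : C := (s * (d / 2))%:C%C.
  have rt : rnorm t = s * (d / 2).
    by rewrite rnorm_real // mulr_ge0 ?divr_ge0 // ltW.
  have td : rnorm t < d.
    rewrite rt (@le_lt_trans _ _ (1 / 2 * (d / 2))) //.
      by rewrite ler_pM2r // divr_gt0.
    by lra.
  have [N1 _ HN1] := H t td e e0.
  have := HN1 (n.+1 + N1)%N (leq_addl _ _).
  rewrite big_split_ord /= big_ord_recr /= big1 => [|i _]; last first.
    by rewrite IH ?mulr0 //; exact: ltn_ord.
  rewrite add0r.
  set T := \sum_(i < N1) _ => hT.
  have -> : s ^+ n * b n = rnorm (t ^+ n * c n).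
    by rewrite rM rX rt exprMn mulrA.
  have -> : t ^+ n * c n = (t ^+ n * c n + T) + - T by rewrite addrK.
  apply: le_trans (rnormD _ _) _; rewrite rN addrC lerD //; last exact: ltW.
  have rT q : rnorm (\sum_(i < q) t ^+ (n.+1 + i) * c (n.+1 + i)%N : C)
     <= s ^+ n.+1 * M * (2 - 2 * (1/2)^+q).
    elim: q => [|q IHq].
      rewrite big_ord0 expr0 mulr1 subrr mulr0.
      by rewrite /rnorm normr0.
    rewrite big_ord_recr /=; apply: le_trans (rnormD _ _) _.
    have -> : 2 - 2 * (1/2) ^+ q.+1 = (2 - 2 * (1/2)^+q) + (1/2 : R) ^+ q.
      by rewrite exprS; lra.
    rewrite mulrDr lerD //.
    rewrite rM rX rt exprMn -mulrA -/(b _) exprD -!mulrA.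
    apply: ler_wpM2l; first by rewrite exprn_ge0 // ltW.
    rewrite [leRHS]mulrC; apply: ler_pM => //; first by rewrite exprn_ge0 // ltW.
    - by rewrite mulr_ge0 ?exprn_ge0 ?divr_ge0 ?rnorm_ge0 // ltW.
    - by rewrite lerXn2r // nnegrE ltW // divr_gt0.
    - exact: bM.
  apply: le_trans (rT N1) _.
  rewrite [leRHS]mulrCA mulrC exprSr.
  have hs : 0 <= s ^+ n * s * M.
    by rewrite mulr_ge0 ?mulr_ge0 ?exprn_ge0 // ltW.
  have := ler_wpM2r hs (_ : 2 - 2 * (1 / 2) ^+ N1 <= 2 :> R).
  move=> /(_ _); rewrite lerBlDr lerDl mulr_ge0 ?exprn_ge0 // => /(_ isT).
  by move/le_trans; apply; rewrite le_eqVlt; apply/orP; left; apply/eqP; ring.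
have bn0 : b n = 0.
  apply/eqP; rewrite eq_le b0 andbT leNgt; apply/negP => bn.
  pose s := Num.min (1/2) (b n / (4 * M)).
  have s0 : 0 < s by rewrite lt_min divr_gt0 // divr_gt0 // mulr_gt0.
  have s1 : s <= 1 / 2 by rewrite ge_min lexx.
  have s2 : s <= b n / (4 * M) by rewrite ge_min lexx orbT.
  have := key s s0 s1; apply/negP; rewrite -ltNge.
  apply: (@le_lt_trans _ _ (b n / 2)); last by lra.
  have M20 : 0 <= 2 * M by rewrite mulr_ge0 // ltW.
  apply: (le_trans (ler_wpM2l M20 s2)).
  by rewrite le_eqVlt; apply/orP; left; apply/eqP; field; rewrite gt_eqF.
apply: rnorm_eq0.
move/eqP: bn0; rewrite mulf_eq0 expf_eq0 (gt_eqF (divr_gt0 d0 _)) // andbF /=.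
by move/eqP.
Qed.

Lemma uniform_rnormP (A : set E) (F : nat -> E -> C) (f : E -> C) :
  {uniform A, F @ \oo --> f} <->
  forall e : R, 0 < e ->
    \forall n \near \oo, forall x, A x -> rnorm (F n x - f x) < e.
Proof.
split=> [H e e0|H P /uniform_nbhs[U [entU subP]]].
  apply: (H [set h : E -> C | forall x, A x -> rnorm (h x - f x) < e]).
  apply/uniform_nbhs.
  exists [set xy | ball xy.1 (e%:C%C : R[i]) xy.2]; split.
    have e0' : 0 < (e%:C%C : R[i]) by rewrite ltcR.
    exact: (entourage_ball C (PosNum e0')).
  move=> h /= Hh x /Hh; rewrite -ball_normE /= rnormE ltcR.
  by rewrite /rnorm distrC.
move: entU; rewrite -entourage_ballE => -[_/posnumP[e] eU].
have er : e%:num \is Num.real by exact: gtr0_real.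
have eE : e%:num = (complex.Re e%:num)%:C%C by rewrite RRe_real.
have e0 : 0 < complex.Re e%:num by rewrite -ltcR -eE; exact: (gt0 e).
apply: filterS (H _ e0) => n Hn; apply: subP => x /Hn /= Hx.
by apply: eU; rewrite /= -ball_normE /= distrC rnormE eE ltcR.
Qed.

Lemma taylor_atP (f : E -> C) a P : taylor_at f a P <->
  (forall m, hpoly m (P m)) /\ exists2 r : R, 0 < r &
    forall e : R, 0 < e -> \forall n \near \oo, forall x, rnorm (x - a) < r ->
      rnorm (\sum_(m < n) P m (x - a) - f x : C) < e.
Proof.
have bE (r : R) x : ball a (r%:C%C : R[i]) x <-> rnorm (x - a) < r.
  by rewrite -ball_normE /= distrC rnormE ltcR.
split=> -[hP [r r0 H]]; split=> //.
  have rE : r = (complex.Re r)%:C%C by rewrite RRe_real // gtr0_real.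
  exists (complex.Re r); first by rewrite -ltcR -rE.
  move=> e e0; move/uniform_rnormP : H => /(_ e e0).
  by apply: filterS => n Hn x xr; apply: Hn; rewrite rE; apply/bE.
exists r%:C%C; first by rewrite ltcR.
apply/uniform_rnormP => e e0; apply: filterS (H e e0) => n Hn x xr.
by apply: Hn; apply/bE.
Qed.

Lemma taylor_unique (f : E -> C) a P Q :
  taylor_at f a P -> taylor_at f a Q -> P = Q.
Proof.
move=> /taylor_atP[hP [r1 r10 H1]] /taylor_atP[hQ [r2 r20 H2]].
apply/funext => m; apply/funext => y; apply/eqP; rewrite -subr_eq0; apply/eqP.
pose r := Num.min r1 r2; have r0 : 0 < r by rewrite lt_min r10.
have y1 : 0 < rnorm y + 1 by rewrite ltr_wpDl // rnorm_ge0.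
apply: (@powser_unique (fun m => P m y - Q m y) (r / (rnorm y + 1))).
  exact: divr_gt0.
move=> t td e e0.
have e2 : 0 < e / 2 by rewrite divr_gt0.
near=> n.
set x : E := a + (t : R[i]) *: y.
have xa : x - a = (t : R[i]) *: y by rewrite /x addrC addKr.
have xr : rnorm (x - a) < r.
  rewrite xa rnormZ; move: td; rewrite ltr_pdivlMr //; apply: le_lt_trans.
  by rewrite ler_wpM2l ?rnorm_ge0 // lerDl.
move: xr; rewrite lt_min => /andP[xr1 xr2].
have h1 : rnorm (\sum_(m < n) P m (x - a) - f x : C) < e / 2.
  by move: x xa xr1 xr2 => x _ xr1 _; move: x xr1; near: n; exact: H1.
have h2 : rnorm (\sum_(m < n) Q m (x - a) - f x : C) < e / 2.
  by move: x xa xr1 xr2 {h1} => x _ _ xr2; move: x xr2; near: n; exact: H2.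
have -> : \sum_(m < n) t ^+ m * (P m y - Q m y) =
   (\sum_(m < n) P m (x - a) - f x) - (\sum_(m < n) Q m (x - a) - f x) :> C.
  rewrite opprB addrA subrK -sumrB; apply: eq_bigr => i _.
  by rewrite xa !(hpoly_hom _ _ (hP _)) !(hpoly_hom _ _ (hQ _)) mulrBr.
apply: le_lt_trans (rnormD _ _) _.
have rN (z : C) : rnorm (- z) = rnorm z by apply: complexI; rewrite -!rnormE normrN.
by rewrite rN [e]splitr ltrD.
Unshelve. all: by end_near. Qed.

Lemma taylor_at_lin (c : C) (f g : E -> C) a P Q :
  taylor_at f a P -> taylor_at g a Q ->
  taylor_at ((c : R[i]) *: f + g) a (fun m => (c : R[i]) *: P m + Q m).
Proof.
move=> /taylor_atP[hP [r1 r10 H1]] /taylor_atP[hQ [r2 r20 H2]].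
apply/taylor_atP; split=> [m|]; first exact: hpoly_lin.
exists (Num.min r1 r2); first by rewrite lt_min r10.
move=> e e0.
have c1 : 0 < rnorm c + 1 by rewrite ltr_wpDl // rnorm_ge0.
have e2 : 0 < e / 2 by rewrite divr_gt0.
have e1 : 0 < e / 2 / (rnorm c + 1) by rewrite divr_gt0.
apply: filterS2 (H1 _ e1) (H2 _ e2) => n h1 h2 x.
rewrite lt_min => /andP[/h1 {}h1 /h2 {}h2].
have -> : \sum_(m < n) ((c : R[i]) *: P m + Q m) (x - a) - ((c : R[i]) *: f + g) x =
   (c : R[i]) *: ((\sum_(m < n) P m (x - a) - f x) : C) +
     (\sum_(m < n) Q m (x - a) - g x) :> C.
  rewrite big_split /= -scaler_sumr scalerBr !fctE opprD.
  by rewrite addrACA.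
apply: le_lt_trans (rnormD _ _) _; rewrite [e]splitr ler_ltD //.
rewrite rnormZ; apply: (@le_trans _ _ (rnorm c * (e / 2 / (rnorm c + 1)))).
  by rewrite ler_wpM2l ?rnorm_ge0 // ltW.
by rewrite mulrCA ler_piMr ?ltW // ltr_pdivrMr // mul1r ltrDl.
Qed.

Lemma taylor_at0 a : taylor_at (0 : E -> C) a (fun=> 0).
Proof.
apply/taylor_atP; split=> [m|]; first exact: hpoly0.
exists 1 => // e e0; apply: nearW => n x _.
by rewrite big1 // subr0 /rnorm normr0.
Qed.

Lemma taylorE (f : E -> C) a P : taylor_at f a P -> taylor f a = P.
Proof.
move=> fP; rewrite /taylor; case: xgetP => [Q _ fQ|/(_ P)//].
exact: taylor_unique fQ fP.
Qed.

Lemma dhat_lin j (c : R[i]) (f g : E -> C) a : entire f -> entire g ->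
  dhat j (c *: f + g) a = c *: dhat j f a + dhat j g a.
Proof.
move=> /(_ a)[P fP] /(_ a)[Q gQ].
rewrite /dhat (taylorE fP) (taylorE gQ) (taylorE (taylor_at_lin c fP gQ)).
by rewrite scalerDr !scalerA mulrC.
Qed.

Lemma dhat0 j a : dhat j (0 : E -> C) a = 0.
Proof. by rewrite /dhat (taylorE (taylor_at0 a)) scaler0. Qed.

End Uniqueness.

Section ExpLmodule.
Variables (R : realType) (E : completeNormedModType R[i]).
Variables (Theta : holomorphy_type E) (k : \bar R).

Lemma coef_norm_ge0 f j : ht_space Theta j (dhat j f 0) ->
  0 <= coef_norm Theta f j.
Proof.
move=> fj; have B := ht_banach Theta j.
apply: (bs_norm_ge0 B); rewrite -[_ *: _]addr0.
by apply: (bs_lin B) => //; exact: (bs_zero B).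
Qed.

Lemma coef_norm_lin (c : R[i]^o) f g j : entire f -> entire g ->
  ht_space Theta j (dhat j f 0) -> ht_space Theta j (dhat j g 0) ->
  coef_norm Theta ((c : R[i]) *: f + g) j
    <= rnorm c * coef_norm Theta f j + coef_norm Theta g j.
Proof.
move=> ef eg fj gj; have B := ht_banach Theta j.
have Z (a : R[i]) u : ht_space Theta j u -> ht_space Theta j (a *: u).
  by move=> ju; rewrite -[_ *: _]addr0; apply: (bs_lin B) => //; exact: (bs_zero B).
rewrite /coef_norm dhat_lin // scalerDr scalerA mulrC -scalerA.
apply: le_trans (bs_normD B _ _) _; [exact: Z (Z _ _ fj)|exact: Z|].
by rewrite (bs_normZ B) //; exact: Z.
Qed.

Lemma exp_weight_ge0 j : 0 <= exp_weight k j :> R.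
Proof. by rewrite /exp_weight; case: ifP => // _; exact: powR_ge0. Qed.

Lemma exp_set0 : exp_set Theta k 0.
Proof.
have c0 j : coef_norm Theta 0 j = 0.
  have B := ht_banach Theta j.
  rewrite /coef_norm dhat0 scaler0 -(scale0r (0 : E -> R[i]^o)).
  rewrite (bs_normZ B); last exact: (bs_zero B).
  by rewrite /rnorm normr0 mul0r.
split; first by move=> a; exists (fun=> 0); exact: taylor_at0.
  by move=> j; rewrite dhat0; exact: (bs_zero (ht_banach Theta j)).
rewrite /exp_growth; case: ifP => _.
  apply/cvgrPdist_lt => e e0; near=> j.
  rewrite c0 powR0 ?subrr ?normr0 // invr_neq0 // pnatr_eq0 -lt0n.
  by near: j; exact: nbhs_infty_gt.
move=> rho rho0; rewrite /exp_norm eseries0 ?ltry // => j _ _.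
by rewrite c0 mulr0.
Unshelve. all: by end_near. Qed.

Lemma exp_set_lin (c : R[i]) f g : exp_set Theta k f -> exp_set Theta k g ->
  exp_set Theta k (c *: f + g).
Proof.
move=> [ef fT fg] [eg gT gg]; split.
- move=> a; have [P fP] := ef a; have [Q gQ] := eg a.
  by eexists; exact: taylor_at_lin fP gQ.
- move=> j; rewrite dhat_lin //; exact: (bs_lin (ht_banach Theta j)).
have hT j : ht_space Theta j (dhat j (c *: f + g) 0).
  by rewrite dhat_lin //; exact: (bs_lin (ht_banach Theta j)).
have hle j := @coef_norm_lin c f g j ef eg (fT j) (gT j).
have f0 j := coef_norm_ge0 (fT j).
have g0 j := coef_norm_ge0 (gT j).
have h0 j := coef_norm_ge0 (hT j).
move: fg gg; rewrite /exp_growth; case: ifP => _ fg gg.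
  have A1 : 1 <= rnorm (c : R[i]^o) + 1 by rewrite lerDr rnorm_ge0.
  set A := _ + 1 in A1.
  have A0 : 0 < A by exact: lt_le_trans A1.
  apply/cvgrPdist_le => e e0.
  have e1 : 0 < e / (2 * A) by rewrite divr_gt0 // mulr_gt0.
  have small (u : nat -> R) : u @ \oo --> 0 -> (forall j, 0 <= u j) ->
      \forall j \near \oo, u j < e / (2 * A).
    move=> /cvgrPdist_lt /(_ _ e1) u0 up; apply: filterS u0 => j.
    by rewrite sub0r normrN ger0_norm.
  have fsmall := small _ fg (fun=> powR_ge0 _ _).
  have gsmall := small _ gg (fun=> powR_ge0 _ _).
  apply: filterS3 (nbhs_infty_gt 0) fsmall gsmall => j j0 fj gj.
  have jn0 : (j%:R : R) != 0 by rewrite pnatr_eq0 -lt0n.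
  have rootK x : 0 <= x -> x = (x `^ (j%:R^-1)) ^+ j :> R.
    by move=> x0; rewrite -powR_mulrn ?powR_ge0 // -powRrM mulVf // powRr1.
  rewrite sub0r normrN ger0_norm ?powR_ge0 //.
  have up x : 0 <= x -> x `^ (j%:R^-1) < e / (2 * A) -> x <= (e / (2 * A)) ^+ j.
    move=> x0 xe; rewrite [leLHS]rootK //.
    by rewrite lerXn2r // ?nnegrE ?powR_ge0 // ltW.
  have key : coef_norm Theta (c *: f + g) j <= e ^+ j.
    apply: le_trans (hle j) _.
    apply: (@le_trans _ _ (2 * A * (e / (2 * A)) ^+ j)).
      set x := _ ^+ j in up *; rewrite -mulrA mulr2n mulrDl mul1r; apply: lerD.
        apply: ler_pM; [exact: rnorm_ge0|exact: f0|by rewrite /A lerDl|].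
        exact: (up _ (f0 j) fj).
      apply: le_trans (up _ (g0 j) gj) _.
      by rewrite ler_peMl // /x exprn_ge0 // ltW.
    have -> : e ^+ j = (2 * A) ^+ j * (e / (2 * A)) ^+ j.
      by rewrite -exprMn; congr (_ ^+ _); field; rewrite gt_eqF.
    rewrite ler_wpM2r ?exprn_ge0 ?(ltW e1) //.
    have A2 : 1 <= 2 * A by lra.
    by rewrite ler_eXnr.
  apply: le_trans (ge0_ler_powR _ _ _ key) _.
  - by rewrite invr_ge0.
  - by rewrite nnegrE.
  - by rewrite nnegrE exprn_ge0 // ltW.
  have e0' := ltW e0; by rewrite -powR_mulrn // -powRrM mulfV // powRr1.
move=> rho rho0.
have w0 j : 0 <= rho ^- j * exp_weight k j.
  by rewrite mulr_ge0 ?exp_weight_ge0 // invr_ge0 exprn_ge0 // ltW.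
apply: (@le_lt_trans _ _
   ((rnorm (c : R[i]^o))%:E * exp_norm Theta k rho f + exp_norm Theta k rho g)%E).
  rewrite /exp_norm -nneseriesZl; last first.
    by move=> j _; rewrite lee_fin mulr_ge0.
  rewrite -nneseriesD; last 2 first.
  - by move=> j _; rewrite -EFinM lee_fin mulr_ge0 ?rnorm_ge0 // mulr_ge0.
  - by move=> j _; rewrite lee_fin mulr_ge0.
  apply: lee_nneseries => j _; first by move=> _; rewrite lee_fin mulr_ge0.
  rewrite -EFinM -EFinD lee_fin mulrCA -mulrDr; apply: ler_wpM2l => //.
rewrite lte_add_pinfty //; last exact: gg.
by rewrite lte_mul_pinfty // ?lee_fin ?rnorm_ge0 // fg.
Qed.

Lemma exp_pred_submod : GRing.submod_closed (exp_pred Theta k).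
Proof.
split; first by apply/asboolP; exact: exp_set0.
by move=> c f g /asboolP fE /asboolP gE; apply/asboolP; exact: exp_set_lin.
Qed.

HB.instance Definition _ := GRing.isSubmodClosed.Build _ _ (exp_pred Theta k)
  exp_pred_submod.
HB.instance Definition _ := [SubChoice_isSubLmodule of Exp Theta k by <:].

(* The topology generated by the norms [exp_norm rho], [0 < rho]: the open
   balls of all these norms form a subbase. *)
Definition exp_ball (f : Exp Theta k) (rho e : R) : set (Exp Theta k) :=
  [set g | (exp_norm Theta k rho (g - f)%R < e%:E)%E].

Definition exp_subbase : set (set (Exp Theta k)) :=
  [set B | exists f rho e, [/\ 0 < rho, 0 < e & B = exp_ball f rho e]].

HB.instance Definition _ := @isSubBaseTopological.Build (Exp Theta k)
  (set (Exp Theta k)) exp_subbase id.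

End ExpLmodule.

Section Convolution.
Variables (R : realType) (E : completeNormedModType R[i]).
Variables (Theta : holomorphy_type E) (k : \bar R).

(* [ddir f a] is the function df(.)a. *)
Definition ddir (f : E -> R[i]^o) (a : E) : E -> R[i]^o := fun x => dhat 1 f x a.

(* [g] ranges over [Exp Theta k] only to name df(.)a as an element of that
   space. *)
Definition convolution_operator (L : {linear Exp Theta k -> Exp Theta k}) : Prop :=
  continuous L /\
  forall (a : E) (f g : Exp Theta k),
    g = ddir f a :> (E -> R[i]^o) -> ddir (L f) a = L g.

Definition nontrivial (L : Exp Theta k -> Exp Theta k) : Prop :=
  ~ exists c : R[i], forall f, L f = c *: f.

End Convolution.

Definition mixing (X : topologicalType) (T : X -> X) : Prop :=
  forall U V : set X, open U -> open V -> U !=set0 -> V !=set0 ->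
    exists n0 : nat, forall n : nat, (n0 <= n)%N -> (iter n T @` U) `&` V !=set0.

Definition hypercyclic (X : topologicalType) (T : X -> X) : Prop :=
  exists x, dense (range (fun n => iter n T x)).

(* Main.v *)
Require Import Defs.
From mathcomp Require Import all_boot all_order all_algebra.
From mathcomp Require Import all_classical all_reals all_analysis.
From mathcomp Require Import complex ring lra.
From mathcomp Require Import separable cyclic cyclotomic.
Import Order.TTheory GRing.Theory Num.Theory.
Import numFieldNormedType.Exports.

(** The operator has many eigenvectors. For a functional phi the function
e^phi lies in the space (this is where k > 1 enters: the weights must be
dominated by j! to a power less than 1, [exp_weight_fact]), its derivative in
the direction a is phi(a) e^phi, and so L(e^phi) satisfies the same system of
first order equations. Hence L(e^phi) = s(phi) e^phi, where the symbol s(phi)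
is the value of L(e^phi) at 0 ([conv_exponential]).

On each complex line t |-> phi + t psi the symbol is the sum of a power series
that converges everywhere, because e^(phi + t psi) is the sum of the series of
t^n psi^n e^phi / n! in the space ([exp_expand]). It is not constant, because
the exponentials span a dense subspace and L is not a multiple of the identity.
Liouville's theorem for such a series and for its inverse
([liouville_bounded], [liouville_bounded_below]) shows that |s| takes values
below 1 and above 1.

The exponentials e^phi, with phi near a given phi0 along every line, still span
a dense subspace ([cs_full_at]): a closed subspace that contains them contains
the coefficients psi^n e^phi0 / n! of the expansion above, hence all
exponentials, hence all powers phi^n, hence, by density of the finite type
polynomials, everything. So the vectors f with L^p f --> 0 are dense
(|s| < 1), and so are the vectors g that are reached as g = L^p u_p from a
sequence u_p --> 0 (|s| > 1); f + u_p is then close to f and is mapped close to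
g, which is mixing ([conv_mixing]).

The space is complete and, since the dual of E is separable, it has a countable
dense set; a nested sequence of balls, the s-th of which is mapped into the
s-th element of a countable base by some power of L, shrinks to a hypercyclic
vector ([conv_hypercyclic]).

Three facts about the space carry the analysis. A continuous homogeneous
polynomial has a Taylor expansion at every point ([hpoly_expand]). Coefficients
P_j of rapidly decreasing norm are the Taylor coefficients at 0 of an entire
function, whose Taylor coefficients at any other point are the sums of those
of the P_j ([synthesis]); this gives completeness and all the elements that the
proof needs. An entire function is determined by its Taylor coefficients at 0
([entire_identity]). *)

Set Implicit Arguments.
Unset Strict Implicit.
Unset Printing Implicit Defensive.

Local Open Scope classical_set_scope.
Local Open Scope ring_scope.

(** * The modulus of complex numbers and averages over roots of unity *)

Lemma prim_root_sum (F : fieldType) N (z : F) n m :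
  N.-primitive_root z -> N%:R != 0 :> F -> (n < N)%N -> (m < N)%N ->
  \sum_(i < N) N%:R^-1 * (z ^+ (i * n))^-1 * (z ^+ i) ^+ m = (m == n)%:R.
Proof.
move=> zp nz nN mN; have zN := prim_expr_order zp.
have z0 : z != 0.
  apply/eqP => E; move: zN; rewrite E expr0n; case: N {zp nz mN} nN => // N _ /eqP.
  by rewrite eq_sym oner_eq0.
pose q := z ^+ m / z ^+ n.
have qE (i : 'I_N) : N%:R^-1 * (z ^+ (i * n))^-1 * (z ^+ i) ^+ m = N%:R^-1 * q ^+ i.
  rewrite /q expr_div_n -!exprM -mulrA; congr (_ * _).
  by rewrite mulrC [(m * i)%N]mulnC [(n * i)%N]mulnC.
under eq_bigr do rewrite qE.
rewrite -mulr_sumr /q; have [->|ne] := eqVneq m n.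
  under eq_bigr do rewrite divff ?expf_neq0 // expr1n.
  by rewrite sumr_const card_ord mulVf.
have q1 : q - 1 != 0.
  rewrite subr_eq0 /q; apply/eqP => /(congr1 ( *%R^~ (z ^+ n))).
  rewrite mul1r divfK ?expf_neq0 // => /eqP.
  by rewrite (eq_prim_root_expr zp) /= !modn_small // (negbTE ne).
have : q ^+ N - 1 = 0.
  by rewrite /q expr_div_n -!exprM mulnC [(n * N)%N]mulnC !exprM zN !expr1n divr1 subrr.
rewrite subrX1 => /eqP; rewrite mulf_eq0 (negbTE q1) /= => /eqP ->.
by rewrite mulr0.
Qed.

Section Modulus.
Variables (R : realType).
Local Notation C := R[i]^o.
Implicit Types (x y z t l : C) (c : nat -> C) (r M e : R).

Lemma rnorm0 (V : normedModType R[i]) : rnorm (0 : V) = 0.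
Proof. by rewrite /rnorm normr0. Qed.

Lemma rnormN (V : normedModType R[i]) (x : V) : rnorm (- x) = rnorm x.
Proof. by rewrite /rnorm normrN. Qed.

Lemma rnormB (V : normedModType R[i]) (x y : V) : rnorm (x - y) <= rnorm x + rnorm y.
Proof. by rewrite -[rnorm y]rnormN; exact: rnormD. Qed.

Lemma rnorm_distC (V : normedModType R[i]) (x y : V) : rnorm (x - y) = rnorm (y - x).
Proof. by rewrite -rnormN opprB. Qed.

Lemma rnormM x y : rnorm (x * y) = rnorm x * rnorm y.
Proof. exact: rnormZ. Qed.

Lemma rnorm1 : rnorm (1 : C) = 1.
Proof. by rewrite /rnorm normr1. Qed.

Lemma rnormX x n : rnorm (x ^+ n) = rnorm x ^+ n.
Proof. by elim: n => [|n IH]; rewrite ?expr0 ?rnorm1 // !exprS rnormM IH. Qed.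

Lemma rnorm_nat n : rnorm (n%:R : C) = n%:R.
Proof. by rewrite -(rmorph_nat (real_complex R)) rnorm_real ?ler0n. Qed.

Lemma rnormV x : rnorm (x^-1) = (rnorm x)^-1.
Proof.
by rewrite /rnorm normfV; case: `|x| (normr_ge0 x) => a b; rewrite lecE /= => /andP[/eqP-> _];
  rewrite expr0n addr0 expr2; case: (eqVneq a 0) => [->|a0]; rewrite ?mul0r ?invr0 //;
  field.
Qed.

Lemma rnorm_sum (V : normedModType R[i]) (I : Type) (r : seq I) (P : pred I) (F : I -> V) :
  rnorm (\sum_(i <- r | P i) F i) <= \sum_(i <- r | P i) rnorm (F i).
Proof.
elim/big_rec2: _ => [|i a b _ h]; first by rewrite rnorm0.
by apply: le_trans (rnormD _ _) _; rewrite lerD2l.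
Qed.

Lemma cvgC_lt (u : nat -> C) l : u @ \oo --> l <->
  forall e : R, 0 < e -> exists N, forall n, (N <= n)%N -> rnorm (u n - l) < e.
Proof.
split=> [/cvgrPdist_lt ul e e0|H].
  have [N _ HN] := ul (e%:C%C : R[i]) ltac:(by rewrite ltcR).
  by exists N => n /HN; rewrite rnormE ltcR rnorm_distC.
apply/cvgrPdist_lt => e e0.
have eE : e = (complex.Re e)%:C%C by rewrite RRe_real // gtr0_real.
have [|N HN] := H (complex.Re e); first by rewrite -ltcR -eE.
by exists N => // n /= /HN; rewrite eE rnormE ltcR rnorm_distC.
Qed.

Lemma rnorm_lim_le (u : nat -> C) l M : u @ \oo --> l ->
  (exists N, forall n, (N <= n)%N -> rnorm (u n) <= M) -> rnorm l <= M.
Proof.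
move=> /cvgC_lt ul [N HN]; apply/ler_addgt0Pr => e e0.
have [m Hm] := ul e e0.
have -> : l = u (maxn N m) - (u (maxn N m) - l) by rewrite subKr.
apply: le_trans (rnormB _ _) _; rewrite lerD ?HN ?leq_maxl // ltW // Hm // leq_maxr //.
Qed.

Lemma prim_root_exists N : (0 < N)%N -> exists z : R[i], N.-primitive_root z.
Proof.
move=> N0; pose p : {poly R[i]} := 'X^N - 1; have [r Dp] := closed_field_poly_normal p.
rewrite (monicP _) ?monicXnsubC // scale1r in Dp.
have rn1: all N.-unity_root r by apply/allP=> z; rewrite -root_prod_XsubC -Dp.
have sz_r: (N < (size r).+1)%N.
  by rewrite -(size_prod_XsubC r id) -Dp size_XnsubC.
have [|z] := hasP (has_prim_root N0 rn1 _ sz_r); last by exists z.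
by rewrite -separable_prod_XsubC -Dp separable_Xn_sub_1 // pnatr_eq0 -lt0n.
Qed.

Lemma rnorm_root N z : (0 < N)%N -> z ^+ N = 1 -> rnorm z = 1.
Proof.
move=> N0 zN; apply/eqP; rewrite -(@eqrXn2 _ N) ?rnorm_ge0 ?ler01 //.
by rewrite -rnormX zN rnorm1 expr1n.
Qed.

Lemma root_nodes N : (0 < N)%N -> exists (w : nat -> C) (a : nat -> nat -> C),
  [/\ forall i, rnorm (w i) = 1, forall n i, rnorm (a n i) = N%:R^-1 &
  forall n m, (n < N)%N -> (m < N)%N ->
    \sum_(i < N) a n i * w i ^+ m = (m == n)%:R].
Proof.
move=> N0; have [z zp] := prim_root_exists N0.
have zN : z ^+ N = 1 by exact: prim_expr_order.
have z1 : rnorm (z : C) = 1 by exact: rnorm_root zN.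
exists (fun i => z ^+ i), (fun n i => N%:R^-1 * (z ^+ (i * n))^-1).
split=> [i|n i|n m nN mN].
- by rewrite rnormX z1 expr1n.
- by rewrite rnormM !rnormV rnorm_nat rnormX z1 expr1n invr1 mulr1.
by apply: (prim_root_sum zp) => //; rewrite pnatr_eq0 -lt0n.
Qed.

(** The coefficients of a polynomial of degree less than N with vector
coefficients are weighted means of its values at N points of the unit circle. This is
Cauchy's formula without integrals; it yields the Cauchy estimates, the
continuity of the Taylor coefficients of a polynomial, and the polarization
bound for mixed powers of two functionals. *)
Lemma node_extract N : (0 < N)%N -> exists (w : nat -> C) (a : nat -> nat -> C),
  [/\ forall i, rnorm (w i) = 1, forall n i, rnorm (a n i) = N%:R^-1 &
  forall (V : lmodType R[i]) (c : nat -> V) n, (n < N)%N ->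
    c n = \sum_(i < N) (a n i : R[i]) *: \sum_(m < N) (w i ^+ m : R[i]) *: c m].
Proof.
move=> N0; have [w [a [w1 aN H]]] := root_nodes N0.
exists w, a; split=> // V c n nN.
under eq_bigr do rewrite scaler_sumr.
rewrite exchange_big /= (bigD1 (Ordinal nN)) //= [X in _ + X]big1 => [|m mn].
  rewrite addr0; under eq_bigr do rewrite scalerA.
  by rewrite -scaler_suml H // eqxx scale1r.
under eq_bigr do rewrite scalerA.
rewrite -scaler_suml H //; case: eqP => [E|]; last by rewrite scale0r.
by rewrite -val_eqE /= E eqxx in mn.
Qed.

(** * Complex power series and Liouville's theorem *)

Definition pser_cvg (c : nat -> C) (t l : C) :=
  (fun n => \sum_(m < n) t ^+ m * c m) @ \oo --> l.

Lemma pser_unique c t l l' : pser_cvg c t l -> pser_cvg c t l' -> l = l'.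
Proof. by move=> h h'; exact: (cvg_unique _ h h'). Qed.

Lemma pser_bounded c t l : pser_cvg c t l ->
  exists2 M : R, 0 < M & forall m, rnorm (c m) * rnorm t ^+ m <= M.
Proof.
move=> /cvgC_lt/(_ 1 ltr01)[N HN].
exists (2 + \sum_(i < N) rnorm (c i) * rnorm t ^+ i).
  by rewrite ltr_wpDr // sumr_ge0 // => i _; rewrite mulr_ge0 ?exprn_ge0 ?rnorm_ge0.
move=> m; case: (leqP N m) => [Nm|mN]; last first.
  rewrite (bigD1 (Ordinal mN)) //= addrCA lerDl addr_ge0 // sumr_ge0 // => i _.
  by rewrite mulr_ge0 ?exprn_ge0 ?rnorm_ge0.
rewrite ler_wpDr //.
  by rewrite sumr_ge0 // => i _; rewrite mulr_ge0 ?exprn_ge0 ?rnorm_ge0.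
have -> : rnorm (c m) * rnorm t ^+ m = rnorm (t ^+ m * c m).
  by rewrite rnormM rnormX mulrC.
have -> : t ^+ m * c m = (\sum_(i < m.+1) t ^+ i * c i - l) -
     (\sum_(i < m) t ^+ i * c i - l).
  by rewrite big_ord_recr /= opprB addrA subrK addrAC subrr add0r.
apply: le_trans (rnormB _ _) _.
by rewrite -[2]/(1 + 1) lerD // ltW // HN // ltnW.
Qed.

Lemma sum_half_le (n k : nat) : \sum_(n <= i < n + k) (2^-1 : R) ^+ i <= 2 * 2^-1 ^+ n.
Proof.
suff -> : \sum_(n <= i < n + k) (2^-1 : R) ^+ i = 2 * 2^-1 ^+ n * (1 - 2^-1 ^+ k).
  by rewrite ler_piMr // ?mulr_ge0 ?exprn_ge0 // lerBlDr lerDl exprn_ge0.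
elim: k => [|k IH]; first by rewrite addn0 big_geq // expr0 subrr mulr0.
by rewrite addnS big_nat_recr ?leq_addr //= IH exprD exprS; field.
Qed.

Lemma sum_half_range_le (n k : nat) : \sum_(n <= i < k) (2^-1 : R) ^+ i <= 2 * 2^-1 ^+ n.
Proof.
case: (leqP n k) => [nk|kn]; last by rewrite big_geq ?mulr_ge0 ?exprn_ge0 // ltnW.
by rewrite -(subnKC nk) sum_half_le.
Qed.

Lemma big_ord_ltn_split (V : nmodType) (F : nat -> V) n k : (n <= k)%N ->
  \sum_(i < k) F i = \sum_(i < n) F i + \sum_(n <= i < k) F i.
Proof. by move=> nk; rewrite -!(big_mkord xpredT F) -big_cat_nat. Qed.

(** The terms are at most M (|t| / r)^m, and |t| / r is at most 1/2, so the
remainder is at most twice its first term. *)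
Lemma pser_tail c t l r M n : 0 < r -> (forall m, rnorm (c m) * r ^+ m <= M) ->
  rnorm t <= r / 2 -> pser_cvg c t l ->
  rnorm (l - \sum_(m < n) t ^+ m * c m) <= 2 * M * (rnorm t / r) ^+ n.
Proof.
move=> r0 HM tr ct; set q := rnorm t / r.
have q0 : 0 <= q by rewrite divr_ge0 ?rnorm_ge0 // ltW.
have q2 : q <= 2^-1 by rewrite /q ler_pdivrMr // mulrC.
have M0 : 0 <= M by apply: le_trans (HM 0%N); rewrite mulr_ge0 ?rnorm_ge0.
apply: (@rnorm_lim_le (fun k => \sum_(m < k) t ^+ m * c m - \sum_(m < n) t ^+ m * c m)).
  by apply: cvgB; [exact: ct|exact: cvg_cst].
exists n => k nk; rewrite (big_ord_ltn_split (fun i => t ^+ i * c i) nk) addrAC subrr add0r.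
apply: le_trans (rnorm_sum _ _ _) _.
rewrite -[leRHS]mulrA mulrCA [2 * _]mulrC mulrA.
apply: (@le_trans _ _ (\sum_(n <= i < k) M * q ^+ n * 2^-1 ^+ (i - n))); last first.
  rewrite -mulr_sumr; apply: ler_wpM2l; first by rewrite mulr_ge0 ?exprn_ge0.
  rewrite -{1}(add0n n) big_addn; under eq_bigr do rewrite addnK.
  by apply: le_trans (sum_half_range_le _ _) _; rewrite expr0 mulr1.
rewrite !big_nat; apply: ler_sum => i /andP[ni ik].
rewrite rnormM rnormX -{1}(subnKC ni).
have -> : rnorm t ^+ (n + (i - n)) * rnorm (c i) = rnorm (c i) * r ^+ i * (q ^+ n * q ^+ (i - n)).
  rewrite /q -exprD subnKC // expr_div_n -mulrA mulrC; congr (_ * _).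
  by rewrite mulrCA mulfV ?mulr1 // expf_neq0 // gt_eqF.
rewrite -[leRHS]mulrA; apply: ler_pM => //.
- by rewrite mulr_ge0 ?rnorm_ge0 // exprn_ge0 // ltW.
- by rewrite mulr_ge0 ?exprn_ge0.
apply: ler_wpM2l; first by rewrite exprn_ge0.
by rewrite lerXn2r // nnegrE.
Qed.

Lemma half_expr_small (K e : R) : 0 < e -> exists N, forall n, (N <= n)%N -> K * 2^-1 ^+ n < e.
Proof.
move=> e0; have : (fun n => K * 2^-1 ^+ n : R^o) @ \oo --> (K * 0 : R^o).
  by apply: cvgMr; apply: cvg_expr; rewrite ger0_norm ?invf_lt1 ?ltr1n.
rewrite mulr0 => /cvgrPdist_lt/(_ e e0)[N _ HN]; exists N => n /HN /=.
by rewrite sub0r normrN; apply: le_lt_trans; exact: ler_norm.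
Qed.

Lemma cauchy_estimate c N n (r M : R) : 0 <= r -> (n < N)%N ->
  (forall t : C, rnorm t = r -> rnorm (\sum_(m < N) t ^+ m * c m) <= M) ->
  rnorm (c n) * r ^+ n <= M.
Proof.
move=> r0 nN HM; have N0 : (0 < N)%N by apply: leq_ltn_trans nN.
have [w [a [w1 aN H]]] := node_extract N0.
pose c' m : C := (r%:C%C : C) ^+ m * c m.
have -> : rnorm (c n) * r ^+ n = rnorm (c' n).
  by rewrite rnormM rnormX rnorm_real // mulrC.
rewrite (H _ c' n nN); apply: le_trans (rnorm_sum _ _ _) _.
apply: (@le_trans _ _ (\sum_(i < N) N%:R^-1 * M)); last first.
  by rewrite sumr_const card_ord -[leLHS]mulr_natl mulrA mulfV ?mul1r // pnatr_eq0 -lt0n.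
apply: ler_sum => i _; rewrite rnormZ aN ler_wpM2l ?invr_ge0 //.
have -> : \sum_(m < N) (w i ^+ m : R[i]) *: c' m = \sum_(m < N) (w i * r%:C%C : C) ^+ m * c m.
  by apply: eq_bigr => m _; rewrite -[_ *: _]/(_ * _) /c' mulrA -exprMn.
by apply: HM; rewrite rnormM w1 mul1r rnorm_real.
Qed.

Lemma entire_pser_unif c (h : C -> C) (r e : R) : 0 < r -> 0 < e ->
  (forall t, pser_cvg c t (h t)) ->
  exists N0, forall N, (N0 <= N)%N -> forall t : C, rnorm t <= r ->
    rnorm (h t - \sum_(m < N) t ^+ m * c m) <= e.
Proof.
move=> r0 e0 H; have r2 : 0 < 2 * r by rewrite mulr_gt0.
have [M M0 HM] := pser_bounded (H ((2 * r)%:C%C)).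
rewrite rnorm_real ?(ltW r2) // in HM.
have [N0 HN] := half_expr_small (2 * M) e0.
exists N0 => N /HN HNe t tr.
apply: le_trans (pser_tail (M := M) N r2 HM _ (H t)) _.
  by rewrite mulrC mulKf.
apply: le_trans (ltW HNe); rewrite ler_wpM2l ?mulr_ge0 // ?(ltW M0) //.
rewrite lerXn2r // ?nnegrE ?divr_ge0 ?rnorm_ge0 ?(ltW r2) //.
by rewrite ler_pdivrMr // mulKf.
Qed.

Lemma growth_zero (a K : R) n : (0 < n)%N -> 0 <= a ->
  (forall r : R, 0 < r -> a * r ^+ n <= K) -> a = 0.
Proof.
move=> n0 a0 H; apply/eqP; rewrite eq_le a0 andbT leNgt; apply/negP => ap.
have K0 : 0 <= K by apply: le_trans (H 1 ltr01); rewrite expr1n mulr1.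
pose r := K / a + 1; have r1 : 1 <= r by rewrite lerDr divr_ge0.
have := H r (lt_le_trans ltr01 r1); apply/negP; rewrite -ltNge.
apply: (@lt_le_trans _ _ (a * r)); first by rewrite /r mulrDr mulr1 mulrC divfK ?gt_eqF // ltrDl.
by rewrite ler_wpM2l // ler_eXnr.
Qed.

(** By the Cauchy estimate for a partial sum of large order, c_n r^n stays
bounded as r grows. *)
Lemma liouville_bounded c (h : C -> C) (K : R) : (forall t, pser_cvg c t (h t)) ->
  (forall t, rnorm (h t) <= K) -> forall n, (0 < n)%N -> c n = 0.
Proof.
move=> H hK n n0; apply: rnorm_eq0; apply: (growth_zero (K := K + 1) n0); first exact: rnorm_ge0.
move=> r r0; have [N0 HN] := entire_pser_unif r0 ltr01 H.
apply: (@cauchy_estimate c (maxn N0 n.+1)); rewrite ?(ltW r0) ?leq_maxr // => t tr.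
have := HN _ (leq_maxl N0 n.+1) t; rewrite tr lexx => /(_ isT) h1.
set S := \sum_(m < _) _ in h1 *.
have -> : S = h t - (h t - S) by rewrite subKr.
by apply: le_trans (rnormB _ _) _; rewrite lerD.
Qed.

Definition cauchy_prod (p : {poly R[i]}) (g : nat -> C) i : C :=
  \sum_(j < i.+1) p`_j * g (i - j)%N.

Lemma cauchy_prodE p g i N : (i < N)%N ->
  cauchy_prod p g i = (p * \poly_(m < N) g m)`_i.
Proof.
move=> iN; rewrite coefM; apply: eq_bigr => j _.
by rewrite coef_poly ifT // (leq_ltn_trans (leq_subr _ _)).
Qed.

(** The power series of the inverse of a polynomial p without zeros in the
closed disc of radius r, obtained by dividing by one linear factor after the
other. Each division keeps the coefficients O((2 r / 3)^-m), because 2/3 r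
stays a definite factor below the modulus of the zeros; hence the series
converges to 1/p on the smaller disc of radius r / 3. *)
Lemma pser_inv (r : R) (a : C) (s : seq C) : 0 < r -> a != 0 ->
  (forall z, z \in s -> r < rnorm z) ->
  let p : {poly R[i]} := (a : R[i]) *: \prod_(z <- s) ('X - (z : R[i])%:P) in
  exists g : nat -> C, [/\
    exists2 A : R, 0 <= A & forall m, rnorm (g m) * (2 / 3 * r) ^+ m <= A,
    forall i, cauchy_prod p g i = (i == 0)%:R &
    forall t, rnorm t <= r / 3 -> pser_cvg g t (p.[t]^-1)].
Proof.
move=> r0 a0; elim: s => [|z s IH] sr p.
  exists (fun m => if m == 0%N then a^-1 else 0); split.
  - exists (rnorm (a^-1)); first exact: rnorm_ge0.
    by case=> [|m] /=; rewrite ?expr0 ?mulr1 // rnorm0 mul0r rnorm_ge0.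
  - have pE : p = a%:P by rewrite /p big_nil -mul_polyC mulr1.
    move=> i; rewrite /cauchy_prod big_ord_recl pE coefC /= subn0 big1 ?addr0; last first.
      by move=> j _; rewrite coefC /= mul0r.
    by case: i => [|i] /=; rewrite ?mulr0 // mulfV.
  - move=> t _; have -> : p.[t] = a by rewrite /p big_nil -mul_polyC mulr1 hornerC.
    apply/cvgC_lt => e e0; exists 1%N => -[//|n] _.
    rewrite big_ord_recl /= expr0 mul1r big1 ?addr0 ?subrr ?rnorm0 // => i _.
    by rewrite mulr0.
have zr : r < rnorm z by apply: sr; rewrite inE eqxx.
have z0 : z != 0 by apply/eqP => E; move: zr; rewrite E rnorm0 ltNge (ltW r0).
have [g [[A A0 gA] gp gt]] := IH (fun y ys => sr y (mem_behead (s := z :: s) ys)).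
set q : {poly R[i]} := _ *: _ in gp gt.
have pE : p = ('X - (z : R[i])%:P) * q by rewrite /p big_cons scalerAr.
(* the coefficients of the quotient of the series of g by X - z *)
pose b := fix b m : C := if m is m'.+1 then (b m' - g m) / z else - g 0%N / z.
have b0 : - z * b 0%N = g 0%N by rewrite /= mulNr mulrC divfK // opprK.
have bS m : b m - z * b m.+1 = g m.+1 by rewrite /= mulrC divfK // opprB addrC subrK.
pose A' : R := 3 * A / r.
have A'0 : 0 <= A' by rewrite /A' divr_ge0 ?mulr_ge0 // ltW.
have Ar : A / rnorm z <= A' / 3.
  have -> : A' / 3 = A / r by rewrite /A'; field; rewrite gt_eqF.
  by rewrite ler_wpM2l // lef_pV2 ?posrE // ?(ltW zr) // (lt_trans r0).
have zV : r / rnorm z <= 1 by rewrite ler_pdivrMr ?mul1r ?(ltW zr) // (lt_trans r0).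
have bA m : rnorm (b m) * (2 / 3 * r) ^+ m <= A'.
  elim: m => [|m IHm].
    rewrite expr0 mulr1 /= rnormM rnormV rnormN.
    apply: (@le_trans _ _ (A / rnorm z)).
      by rewrite ler_wpM2r ?invr_ge0 ?rnorm_ge0 // -[leLHS]mulr1 -(expr0 (2 / 3 * r)).
    by apply: (le_trans Ar); rewrite ler_pdivrMr // ler_peMr // ler1n.
  rewrite /= rnormM rnormV mulrAC.
  apply: (@le_trans _ _ ((2 / 3 * r * A' + A) / rnorm z)).
    rewrite ler_wpM2r ?invr_ge0 ?rnorm_ge0 //.
    apply: (@le_trans _ _ ((rnorm (b m) + rnorm (g m.+1)) * (2 / 3 * r) ^+ m.+1)).
      by rewrite ler_wpM2r ?rnormB // exprn_ge0 // mulr_ge0 // ltW.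
    rewrite mulrDl lerD //; rewrite exprS mulrCA ler_wpM2l //.
    by rewrite mulr_ge0 // ltW.
  rewrite mulrDl.
  have h1 : 2 / 3 * r * A' / rnorm z <= 2 / 3 * A'.
    rewrite mulrAC -[_ * r / _]mulrA ler_wpM2r // ler_piMr //.
  by lra.
exists b; split; first by exists A'.
- move=> i; rewrite (@cauchy_prodE _ _ _ i.+1) // pE mulrAC mulrC.
  rewrite -gp coefM; apply: eq_bigr => j _; congr (_ * _).
  rewrite mulrBl coefB coefXM coefCM !coef_poly.
  case: (i - j)%N (leq_subr j i) => [_|m mi] /=; first by rewrite sub0r -mulNr.
  by rewrite !ifT ?bS // ltnS // ltnW.
- clearbody b A'; move=> t tr; have tr2 : rnorm t <= (2 / 3 * r) / 2 by lra.
  have tz : t - z != 0.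
    rewrite subr_eq0; apply/eqP => E; move: tr; rewrite E leNgt.
    by rewrite (le_lt_trans _ zr) // ler_pdivrMr // ler_peMr ?ler1n // ltW.
  have key (M : nat) : \sum_(m < M.+1) t ^+ m * b m =
      (\sum_(m < M.+1) t ^+ m * g m + t ^+ M.+1 * b M) / (t - z).
    apply: (canRL (mulfK tz)); elim: M => [|M IHM].
      rewrite !big_ord_recl !big_ord0 !expr0 -b0 expr1 /=; ring.
    rewrite big_ord_recr [in RHS]big_ord_recr /= mulrDl IHM -(bS M) !exprS; ring.
  rewrite /pser_cvg -(cvg_shiftS (fun M : nat => \sum_(m < M) t ^+ m * b m)).
  have -> : p.[t]^-1 = (q.[t]^-1 + 0) / (t - z).
    by rewrite addr0 pE hornerM hornerXsubC invfM mulrC.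
  rewrite (_ : (fun n => _) = (fun M : nat => (\sum_(m < M.+1) t ^+ m * g m + t ^+ M.+1 * b M) / (t - z))).
    apply: cvgMl; apply: cvgD.
      by have := gt t tr; rewrite /pser_cvg -(cvg_shiftS (fun M : nat => \sum_(m < M) t ^+ m * g m)).
    apply/cvgC_lt => e e0; have [N HN] := half_expr_small (rnorm t * A') e0.
    exists N => M /HN; apply: le_lt_trans; rewrite subr0 rnormM rnormX exprS -!mulrA.
    rewrite ler_wpM2l ?rnorm_ge0 //.
    have r23 : 0 < 2 / 3 * r by rewrite mulr_gt0.
    move: tr2 bA r23; move: (2 / 3 * r) => u tr2 bA r23.
    have -> : A' * 2^-1 ^+ M = A' / u ^+ M * (u / 2) ^+ M.
      by rewrite exprMn -[RHS]mulrA mulKf // expf_neq0 // gt_eqF.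
    rewrite [leRHS]mulrC; apply: ler_pM; rewrite ?exprn_ge0 ?rnorm_ge0 //.
      by rewrite lerXn2r // nnegrE ?rnorm_ge0 // divr_ge0 // ltW.
    by rewrite ler_pdivlMr // exprn_gt0.
  by apply/funext => M; exact: key.
Qed.

(** The inverse 1/h is bounded, but it is not yet known to be given by a series
that converges everywhere. A partial sum p of h of large order is at least 1/2
in modulus on a large disc, so by [pser_inv] the series g of 1/p obeys the
Cauchy estimate there. The coefficients of g of order at most n depend only on
the first coefficients of h; if c_i = 0 for 0 < i < n, then
g_n = - c_n / c_0^2, and the estimate forces c_n = 0. *)
Lemma liouville_bounded_below c (h : C -> C) : (forall t, pser_cvg c t (h t)) ->
  (forall t, 1 <= rnorm (h t)) -> forall n, (0 < n)%N -> c n = 0.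
Proof.
move=> H h1.
(* g is the inverse series of a partial sum of h of order larger than n *)
have key n r : 0 < r -> exists g : nat -> C, rnorm (g n) * r ^+ n <= 3 /\
    forall i, (i <= n)%N -> \sum_(j < i.+1) c j * g (i - j)%N = (i == 0)%:R.
  move=> r0; have r30 : 0 < 3 * r by rewrite mulr_gt0.
  have [N0 HN] := entire_pser_unif r30 (ltac:(by rewrite invr_gt0) : 0 < 2^-1 :> R) H.
  pose N := maxn N0 n.+1; have N0N : (N0 <= N)%N by rewrite leq_maxl.
  pose p : {poly R[i]} := \poly_(m < N) c m.
  have pt (t : C) : rnorm t <= 3 * r -> 2^-1 <= rnorm (p.[t] : C).
    have -> : p.[t] = \sum_(m < N) t ^+ m * c m.
      by rewrite /p horner_poly; apply: eq_bigr => i _; rewrite mulrC.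
    move=> tr; have := HN N N0N t tr.
    set S := \sum_(m < _) _ => h2; have h1t := h1 t.
    have hE : h t = (h t - S) + S by rewrite subrK.
    have h3 : rnorm (h t) <= rnorm (h t - S) + rnorm S by rewrite {1}hE; exact: rnormD.
    lra.
  have [s ps] := closed_field_poly_normal p.
  have a0 : lead_coef p != 0.
    rewrite lead_coef_eq0; apply/eqP => p0.
    have := pt 0; rewrite rnorm0 => /(_ (ltW r30)); rewrite p0 horner0 rnorm0.
    by rewrite leNgt invr_gt0 ltr0n.
  have sr z : z \in s -> 3 * r < rnorm (z : C).
    move=> zs; rewrite ltNge; apply/negP => /pt.
    have -> : p.[z] = 0.
      apply/eqP; rewrite -/(root p z) ps rootZ // root_prod_XsubC //.
    by rewrite rnorm0 leNgt invr_gt0 ltr0n.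
  have [g [[A A0 gA] gp gt]] := pser_inv r30 a0 sr; rewrite -ps in gp gt.
  exists g; split; last first.
    move=> i ni; rewrite -gp; apply: eq_bigr => j _.
    rewrite /p coef_poly ifT //.
    by apply: leq_trans (leq_maxr N0 n.+1); rewrite ltnS (leq_trans _ ni) // -ltnS.
  have [N1 HN1] := half_expr_small (2 * A) ltr01.
  apply: (@cauchy_estimate g (maxn N1 n.+1)); rewrite ?(ltW r0) ?leq_maxr // => t tr.
  have tr3 : rnorm t <= 3 * r / 3 by rewrite tr mulrC mulKf.
  have r23 : 0 < 2 / 3 * (3 * r) by rewrite mulr_gt0.
  have t23 : rnorm t = 2 / 3 * (3 * r) / 2 by rewrite tr; field.
  have t23' : rnorm t <= 2 / 3 * (3 * r) / 2 by rewrite t23.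
  have h4 := pser_tail (maxn N1 n.+1) r23 gA t23' (gt t tr3).
  have tE : rnorm t / (2 / 3 * (3 * r)) = 2^-1 by rewrite tr; field; rewrite gt_eqF.
  rewrite tE in h4; have h3 := HN1 _ (leq_maxl N1 n.+1).
  have h2 : rnorm (p.[t]^-1 : C) <= 2.
    rewrite rnormV -[2]invrK lef_pV2 ?posrE ?invr_gt0 //; first by apply: pt; lra.
    apply: lt_le_trans (pt t _); [by rewrite invr_gt0|lra].
  move: h4; set S := \sum_(m < _) _ => h4.
  have SE : S = p.[t]^-1 - (p.[t]^-1 - S) by rewrite subKr.
  have h5 : rnorm S <= rnorm (p.[t]^-1 : C) + rnorm ((p.[t]^-1 : C) - S) by rewrite {1}SE; exact: rnormB.
  lra.
elim/ltn_ind => n IH n0; apply: rnorm_eq0.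
have c00 : c 0%N != 0.
  have [g [_ /(_ 0%N isT)]] := key 0%N 1 ltr01.
  rewrite big_ord_recl big_ord0 addr0 /= => /eqP; apply: contraTneq => ->.
  by rewrite mul0r eq_sym oner_eq0.
apply: (growth_zero (K := 3 * rnorm (c 0%N) ^+ 2) n0); first exact: rnorm_ge0.
move=> r r0; have [g [gn gc]] := key n r r0.
have g0 : c 0%N * g 0%N = 1 by have := gc 0%N isT; rewrite big_ord_recl big_ord0 addr0.
have gnE : c 0%N * g n + c n * g 0%N = 0.
  have := gc n (leqnn n); rewrite (gtn_eqF n0).
  case: n n0 IH {gn gc} => // n _ IH.
  rewrite big_ord_recl big_ord_recr /= /bump /= !add1n subn0 subnn big1 ?add0r // => i _.
  by rewrite IH ?mul0r // ltnS.
have -> : c n = - (c 0%N ^+ 2 * g n).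
  apply: (@mulIf _ (g 0%N)); first by apply/eqP => E; move: g0; rewrite E mulr0 => /eqP; rewrite eq_sym oner_eq0.
  rewrite mulNr expr2 -!mulrA [g n * _]mulrC [c 0%N * (g 0%N * _)]mulrA g0 mul1r.
  by apply/eqP; rewrite -addr_eq0 addrC gnE.
by rewrite rnormN rnormM rnormX -mulrA mulrC ler_wpM2r // sqr_ge0.
Qed.
Lemma pser0 c h : pser_cvg c 0 h -> h = c 0%N.
Proof.
move=> h0; apply: (pser_unique h0); apply/cvgC_lt => e e0; exists 1%N => -[//|n] _.
rewrite big_ord_recl /= expr0 mul1r big1 ?addr0 ?subrr ?rnorm0 // => i _.
by rewrite /bump /= add1n exprS mul0r mul0r.
Qed.

Lemma pser_cont0 c (h : C -> C) (d : R) : 0 < d ->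
  (forall t, rnorm t <= d -> pser_cvg c t (h t)) ->
  forall e : R, 0 < e -> exists2 del : R, 0 < del &
    forall t, rnorm t <= del -> rnorm (h t - h 0) < e.
Proof.
move=> d0 H e e0; have dd : rnorm (d%:C%C : C) <= d by rewrite rnorm_real // ltW.
have [M M0 HM] := pser_bounded (H _ dd); rewrite rnorm_real ?(ltW d0) // in HM.
have h0 : h 0 = c 0%N by apply: pser0; apply: H; rewrite rnorm0 ltW.
pose f := e * d / (4 * M).
have f0 : 0 < f by rewrite divr_gt0 ?mulr_gt0.
exists (Num.min (d / 2) f); first by rewrite lt_min f0 divr_gt0.
move=> t; rewrite le_min => /andP[t1 t2].
have td : rnorm t <= d by apply: (le_trans t1); rewrite ler_pdivrMr // ler_peMr ?ler1n // ltW.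
have := pser_tail 1 d0 HM t1 (H t td).
rewrite big_ord_recl big_ord0 addr0 expr0 mul1r expr1 -h0 => h1.
apply: (le_lt_trans h1).
apply: (@le_lt_trans _ _ (2 * M * (f / d))).
  by rewrite ler_wpM2l ?mulr_ge0 ?(ltW M0) // ler_wpM2r // invr_ge0 ltW.
have -> : 2 * M * (f / d) = e / 2 by rewrite /f; field; rewrite !gt_eqF.
by rewrite ltr_pdivrMr // ltr_pMr // ltr1n.
Qed.

(** If c_n is the first nonzero coefficient, then |c_n| s^n is bounded by the
remainder, which is O(s^(n+1)). *)
Lemma pser_zero_real c (d : R) : 0 < d ->
  (forall s : R, 0 < s -> s < d -> pser_cvg c (s%:C%C) 0) -> forall n, c n = 0.
Proof.
move=> d0 H; pose s0 := d / 2.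
have s00 : 0 < s0 by rewrite divr_gt0.
have s0d : s0 < d by rewrite ltr_pdivrMr // ltr_pMr // ltr1n.
have [M M0 HM] := pser_bounded (H s0 s00 s0d); rewrite rnorm_real ?(ltW s00) // in HM.
elim/ltn_ind => n IH; apply: rnorm_eq0; apply/eqP; rewrite eq_le rnorm_ge0 andbT.
apply/ler_addgt0Pr => e e0; rewrite add0r.
pose f := e * s0 ^+ n.+1 / (2 * M).
have f0 : 0 < f by rewrite divr_gt0 ?mulr_gt0 ?exprn_gt0.
pose s := Num.min (s0 / 2) f.
have sp : 0 < s by rewrite lt_min f0 divr_gt0.
have [s1 s2] : s <= s0 / 2 /\ s <= f by rewrite !ge_min !lexx orbT.
have sd : s < d by apply: le_lt_trans s1 _; rewrite ltr_pdivrMr // (lt_le_trans s0d) // ler_peMr ?ler1n // ltW.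
have sE : rnorm (s%:C%C : C) = s by rewrite rnorm_real // ltW.
have := pser_tail n.+1 s00 HM (ltac:(by rewrite sE) : rnorm (s%:C%C : C) <= s0 / 2) (H s sp sd).
rewrite sub0r rnormN big_ord_recr /= big1 ?add0r => [|i _]; last by rewrite IH ?mulr0.
rewrite rnormM rnormX sE => h1.
have sn : 0 < s ^+ n by rewrite exprn_gt0.
rewrite -(ler_pM2l sn); apply: (le_trans h1).
have -> : 2 * M * (s / s0) ^+ n.+1 = s ^+ n * (2 * M / s0 ^+ n.+1 * s).
  by rewrite expr_div_n [s ^+ n.+1]exprSr; ring.
rewrite ler_pM2l //; apply: (@le_trans _ _ (2 * M / s0 ^+ n.+1 * f)).
  by rewrite ler_wpM2l // divr_ge0 ?mulr_ge0 ?exprn_ge0 ?(ltW M0) // ltW.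
rewrite le_eqVlt; apply/orP; left; apply/eqP; rewrite /f; field.
by rewrite !gt_eqF // exprn_gt0.
Qed.
End Modulus.

(** * Taylor expansion of homogeneous polynomials *)

Section PolyTaylor.
Variables (R : realType) (E : completeNormedModType R[i]).
Local Notation C := R[i]^o.
Implicit Types (F : (nat -> E) -> C) (x z : nat -> E).

Definition update x (n : nat) (y : E) : nat -> E := fun i => if i == n then y else x i.

Lemma update_comm x i n y y' : i != n -> update (update x i y) n y' = update (update x n y') i y.
Proof.
move=> ni; apply/funext => k; rewrite /update; case: (eqVneq k n) => [->|//].
by rewrite eq_sym (negbTE ni).
Qed.

Definition slot_linear F i := forall x (c : C) (u v : E),
  F (update x i ((c : R[i]) *: u + v)) = c * F (update x i u) + F (update x i v).

(** The part that is homogeneous of degree m in y of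
F (a + y, ..., a + y, x_n, x_(n+1), ...), with a + y in the first n slots, and
polarized: the m occurrences of y are replaced by z_0, ..., z_(m-1). It is the
sum over the choices of m slots among n, computed by the recursion of Pascal's
triangle. *)
Fixpoint mixed_form n m F (a : E) z x : C :=
  if n is n'.+1 then
    mixed_form n' m F a z (update x n' a) +
    (if m is m'.+1 then mixed_form n' m' F a z (update x n' (z m')) else 0)
  else if m is 0%N then F x else 0.

Lemma mixed_form_gt n m F a z x : (n < m)%N -> mixed_form n m F a z x = 0.
Proof.
elim: n m x => [|n IH] [|m] x //= nm.
by rewrite !IH ?addr0 // ltnW.
Qed.

Lemma mixed_form_ext n m F a z z' x : (forall i, (i < m)%N -> z i = z' i) ->
  mixed_form n m F a z x = mixed_form n m F a z' x.
Proof.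
elim: n m x => [//|n IH] m x zz /=; rewrite (IH m) //; congr (_ + _).
case: m zz => [//|m] zz; rewrite zz // (IH m) // => i im.
by apply: zz; exact: ltnW.
Qed.

Lemma mixed_form_slot n m F a z i : slot_linear F i -> (n <= i)%N ->
  slot_linear (mixed_form n m F a z) i.
Proof.
move=> Fi; elim: n m => [|n IH] m ni x c u v /=.
  by case: m => [|m]; rewrite ?Fi // mulr0 addr0.
have ne : i != n by rewrite gtn_eqF.
rewrite !(update_comm _ _ _ ne) (IH m (ltnW ni)).
case: m => [|m]; first by rewrite !addr0.
by rewrite !(update_comm _ _ _ ne) (IH m (ltnW ni)) mulrDr addrACA.
Qed.

(** The argument z_m is used only where the recursion chooses the slot n for it;
there linearity comes from the slot n of F ([mixed_form_slot]). *)
Lemma mixed_form_linear n m F a x o : (forall i, (i < n)%N -> slot_linear F i) -> (o < m)%N ->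
  slot_linear (fun z => mixed_form n m F a z x) o.
Proof.
elim: n m x => [|n IH] m x Fi om z c u v /=.
  by case: m om => // m _; rewrite mulr0 addr0.
have Fi' i : (i < n)%N -> slot_linear F i by move=> h; apply: Fi; exact: ltnW.
rewrite (IH m _ Fi' om); case: m om => // m; rewrite ltnS leq_eqVlt => /orP[/eqP->|om].
  have updm w y : update w m y m = y by rewrite /update eqxx.
  have E1 w y x' : mixed_form n m F a (update w m y) x' = mixed_form n m F a w x'.
    by apply: mixed_form_ext => i im; rewrite /update ltn_eqF.
  rewrite !updm !E1 (mixed_form_slot _ _ _ (Fi n (ltnSn n)) (leqnn n)).
  by rewrite mulrDr addrACA.
have updo w y : update w o y m = w m by rewrite /update gtn_eqF.
by rewrite !updo (IH m _ Fi' om) mulrDr addrACA.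
Qed.

Lemma mixed_form_hom n m F a (c : C) y x : (forall i, (i < n)%N -> slot_linear F i) ->
  mixed_form n m F a (fun=> (c : R[i]) *: y) x = c ^+ m * mixed_form n m F a (fun=> y) x.
Proof.
elim: n m x => [|n IH] m x Fi /=; first by case: m => [|m]; rewrite ?expr0 ?mul1r ?mulr0.
have Fi' i : (i < n)%N -> slot_linear F i by move=> h; apply: Fi; exact: ltnW.
rewrite IH // mulrDr; congr (_ + _); case: m => [|m]; first by rewrite mulr0.
have L := mixed_form_slot m a (fun=> y) (Fi n (ltnSn n)) (leqnn n).
have L0 w : mixed_form n m F a (fun=> y) (update w n 0) = 0.
  by have := L w (-1) 0 0; rewrite scaler0 addr0 mulN1r addNr.
rewrite IH //; have := L x c y 0; rewrite addr0 L0 addr0 => ->.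
by rewrite exprSr mulrA.
Qed.

Lemma mixed_form_sum n F a y x : (forall i, (i < n)%N -> slot_linear F i) ->
  \sum_(m < n.+1) mixed_form n m F a (fun=> y) x =
  F (fun i => if (i < n)%N then a + y else x i).
Proof.
elim: n x => [|n IH] x Fi; first by rewrite big_ord_recl big_ord0 addr0.
have Fi' i : (i < n)%N -> slot_linear F i by move=> h; apply: Fi; exact: ltnW.
rewrite /= big_split /= big_ord_recr /= mixed_form_gt // addr0 [X in _ + X]big_ord_recl /= add0r.
rewrite (IH _ Fi') (IH _ Fi').
pose w i : E := if (i < n)%N then a + y else x i.
have E1 b : (fun i => if (i < n)%N then a + y else update x n b i) = update w n b.
  apply/funext => i; rewrite /update /w; case: (eqVneq i n) => [->|//].
  by rewrite ltnn.
rewrite !E1.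
have := Fi n (ltnSn n) w 1 a y; rewrite scale1r mul1r => <-; apply: (congr1 F).
apply/funext => i; rewrite /update /w ltnS [(i <= n)%N]leq_eqVlt.
by case: eqVneq.
Qed.

Lemma cts_sum (T : topologicalType) (I : Type) (r : seq I) (f : I -> T -> C) :
  (forall i, continuous (f i)) -> continuous (fun p => \sum_(i <- r) f i p).
Proof.
move=> H; elim: r => [|i r IH].
  rewrite (_ : (fun p => _) = (fun=> 0)); first exact: cst_continuous.
  by apply/funext => p; rewrite big_nil.
rewrite (_ : (fun p => _) = (fun p => f i p + \sum_(j <- r) f j p)).
  by move=> p; apply: cvgD; [exact: H|exact: IH].
by apply/funext => p; rewrite big_cons.
Qed.

(** The multilinear form A of P is not assumed continuous, so the continuity of
the components T_m does not come from their formula: T_m is recovered from the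
continuous functions y |-> P (a + w y), with w on the unit circle, by
[node_extract]. *)
Lemma hpoly_expand j (P : E -> C) a : hpoly j P -> exists T : nat -> E -> C,
  [/\ forall m, hpoly m (T m), forall m, (j < m)%N -> T m = 0 &
      forall y, P (a + y) = \sum_(m < j.+1) T m y].
Proof.
move=> [cP [A mA PA]].
pose F x := A (fun i : 'I_j => x i).
have Fi i : (i < j)%N -> slot_linear F i.
  move=> ij x c u v.
  have := mA (Ordinal ij) (fun k => x k) c u v.
  have E1 y : (fun i' : 'I_j => if i' == Ordinal ij then y else x i') =
     (fun i' : 'I_j => update x i y i') by apply/funext => k; rewrite /update.
  by rewrite !E1.
pose T m y := mixed_form j m F a (fun=> y) (fun=> 0).
have TP y : P (a + y) = \sum_(m < j.+1) T m y.
  rewrite mixed_form_sum // PA /F; apply: (congr1 A); apply/funext => i.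
  by rewrite ltn_ord.
have T0 m : (j < m)%N -> T m = 0 by move=> jm; apply/funext => y; rewrite /T mixed_form_gt.
exists T; split; [|exact: T0|exact: TP] => m.
have [jm|mj] := ltnP j m; first by rewrite (T0 _ jm); exact: hpoly0.
split.
  have [w [b [w1 bN H]]] := @node_extract R j.+1 (ltn0Sn j).
  have -> : T m = (fun y => \sum_(i < j.+1) b m i * P (a + (w i : R[i]) *: y)).
    apply/funext => y; rewrite (H _ (fun m => T m y)) //; apply: eq_bigr => i _.
    rewrite -[_ *: _]/(_ * _) TP; congr (_ * _); apply: eq_bigr => k _.
    by rewrite /T mixed_form_hom.
  apply: cts_sum => i y; apply: cvgM; first exact: cvg_cst.
  apply: (@continuous_comp _ _ _ (fun y => a + (w i : R[i]) *: y) P); last exact: cP.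
  by apply: cvgD; [exact: cvg_cst|apply: cvgZr; exact: cvg_id].
pose ext (zz : 'I_m -> E) (i : nat) : E := if insub i is Some o then zz o else 0.
exists (fun zz => mixed_form j m F a (ext zz) (fun=> 0)); last first.
  move=> y; apply: mixed_form_ext => i im; rewrite /ext.
  by case: insubP => // /negP.
move=> o x c u v.
have E1 y : ext (fun i' => if i' == o then y else x i') = update (ext x) o y.
  apply/funext => i; rewrite /ext /update; case: insubP => [k _ <-|im].
    by rewrite -val_eqE.
  by case: eqP => // E1; rewrite E1 ltn_ord in im.
by rewrite !E1 (mixed_form_linear _ _ Fi (ltn_ord o)).
Qed.

Lemma taylor_at_finite (f : E -> C) a (T : nat -> E -> C) N :
  (forall m, hpoly m (T m)) -> (forall m, (N <= m)%N -> T m = 0) ->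
  (forall y, f (a + y) = \sum_(m < N) T m y) -> taylor_at f a T.
Proof.
move=> hT T0 fT; apply/taylor_atP; split=> //; exists 1 => // e e0.
exists N => // n /= Nn x _; rewrite (big_ord_ltn_split (fun m => T m (x - a)) Nn).
have -> : \sum_(N <= i < n) T i (x - a) = 0.
  by rewrite big_nat_cond big1 // => m /andP[/andP[Nm _] _]; rewrite T0.
by rewrite addr0 -fT [a + _]addrC subrK subrr rnorm0.
Qed.

Lemma hpoly_taylor_at j (P : E -> C) a : hpoly j P -> taylor_at P a (taylor P a).
Proof.
move=> hP; have [T [h1 h2 h3]] := hpoly_expand a hP.
have tT : taylor_at P a T by exact: taylor_at_finite h1 h2 h3.
by rewrite (taylorE tT).
Qed.

Lemma hpoly_taylor_gt j (P : E -> C) a m : hpoly j P -> (j < m)%N -> taylor P a m = 0.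
Proof.
move=> hP; have [T [h1 h2 h3]] := hpoly_expand a hP.
by rewrite (taylorE (taylor_at_finite h1 h2 h3)); exact: h2.
Qed.

Lemma hpoly_taylor_sum j (P : E -> C) a y : hpoly j P ->
  P (a + y) = \sum_(m < j.+1) taylor P a m y.
Proof.
move=> hP; have [T [h1 h2 h3]] := hpoly_expand a hP.
by rewrite (taylorE (taylor_at_finite h1 h2 h3)).
Qed.

Lemma entire_taylor_at (f : E -> C) a : entire f -> taylor_at f a (taylor f a).
Proof. by move=> /(_ a)[P fP]; rewrite (taylorE fP). Qed.

Lemma taylor_hpoly (f : E -> C) a m : entire f -> hpoly m (taylor f a m).
Proof. by move=> /(entire_taylor_at a)[]. Qed.

Lemma dhatE m (f : E -> C) a : ((m`!%:R : R[i])^-1) *: dhat m f a = taylor f a m.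
Proof. by rewrite /dhat scalerA mulVf ?scale1r // pnatr_eq0 -lt0n fact_gt0. Qed.

End PolyTaylor.

(** * Entire functions with prescribed Taylor coefficients *)

Section BanachSub.
Variables (R : realType) (V : lmodType R[i]) (S : set V) (N : V -> R).
Hypothesis B : banach_subspace S N.
Local Notation C := R[i]^o.

Lemma bs_scale (c : C) u : S u -> S ((c : R[i]) *: u).
Proof. by move=> Su; rewrite -[_ *: _]addr0; apply: (bs_lin B) => //; exact: (bs_zero B). Qed.

Lemma bs_add u v : S u -> S v -> S (u + v).
Proof. by move=> Su Sv; rewrite -[u]scale1r; exact: (bs_lin B). Qed.

Lemma bs_sub u v : S u -> S v -> S (u - v).
Proof. by move=> Su Sv; rewrite addrC -scaleN1r; exact: (bs_lin B). Qed.

Lemma bs_sum (I : Type) (r : seq I) (P : pred I) (F : I -> V) :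
  (forall i, P i -> S (F i)) -> S (\sum_(i <- r | P i) F i).
Proof. by move=> H; elim/big_ind: _ => //; [exact: (bs_zero B)|exact: bs_add]. Qed.

Lemma bs_norm0 : N 0 = 0.
Proof. by rewrite -(scale0r 0) (bs_normZ B) ?rnorm0 ?mul0r //; exact: (bs_zero B). Qed.

Lemma bs_normN u : S u -> N (- u) = N u.
Proof. by move=> Su; rewrite -scaleN1r (bs_normZ B) // rnormN rnorm1 mul1r. Qed.

Lemma bs_distC u v : S u -> S v -> N (u - v) = N (v - u).
Proof. by move=> Su Sv; rewrite -opprB bs_normN //; exact: bs_sub. Qed.

Lemma bs_norm_sum (I : Type) (r : seq I) (P : pred I) (F : I -> V) :
  (forall i, P i -> S (F i)) -> N (\sum_(i <- r | P i) F i) <= \sum_(i <- r | P i) N (F i).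
Proof.
move=> H; suff : S (\sum_(i <- r | P i) F i) /\
  N (\sum_(i <- r | P i) F i) <= \sum_(i <- r | P i) N (F i) by case.
elim/big_rec2: _ => [|i a b Pi [Sb h]]; first by rewrite bs_norm0; split=> //; exact: (bs_zero B).
split; first by apply: bs_add => //; exact: H.
by apply: le_trans (bs_normD B (H _ Pi) Sb) _; rewrite lerD2l.
Qed.

Lemma bs_tri u v w : S u -> S v -> S w -> N (u - w) <= N (u - v) + N (v - w).
Proof.
move=> Su Sv Sw; have -> : u - w = (u - v) + (v - w) by rewrite addrA subrK.
by apply: (bs_normD B); exact: bs_sub.
Qed.

(** The bound M is allowed to vary with n because completeness of the function
space needs, for a single limit, a rate in terms of every weight. *)
Lemma bs_geo_complete (x : nat -> V) (M : nat -> R) : (forall s, S (x s)) ->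
  (forall s t, (s <= t)%N -> M t <= M s) ->
  (forall s, N (x s.+1 - x s) <= M s * 2^-1 ^+ s) ->
  exists2 l, S l & forall n, N (x n - l) <= 2 * M n * 2^-1 ^+ n.
Proof.
move=> Sx Mh HM.
have M0 n : 0 <= M n.
  have h : 0 <= M n * 2^-1 ^+ n.
    by apply: le_trans (HM n); apply: (bs_norm_ge0 B); exact: bs_sub.
  by rewrite -(pmulr_lge0 _ (_ : 0 < 2^-1 ^+ n)) // exprn_gt0.
have tail n k : N (x (n + k)%N - x n) <= M n * (\sum_(n <= i < n + k) 2^-1 ^+ i).
  elim: k => [|k IH]; first by rewrite addn0 subrr bs_norm0 big_geq // mulr0.
  rewrite addnS big_nat_recr ?leq_addr //= mulrDr [leRHS]addrC.
  apply: le_trans (bs_tri (Sx _) (Sx (n + k)%N) (Sx _)) _; rewrite lerD //.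
  by apply: le_trans (HM _) _; rewrite ler_wpM2r ?exprn_ge0 // Mh // leq_addr.
have tail2 n k : (n <= k)%N -> N (x k - x n) <= 2 * M n * 2^-1 ^+ n.
  move=> nk; rewrite -(subnKC nk); apply: le_trans (tail _ _) _.
  by rewrite [2 * M n]mulrC -mulrA ler_wpM2l // sum_half_le.
have [|l Sl xl] := bs_complete B Sx.
  move=> e e0; have [n0 Hn0] := half_expr_small (4 * M 0%N) e0.
  exists n0 => m n hm hn; apply: le_lt_trans (Hn0 n0 (leqnn _)).
  apply: le_trans (bs_tri (Sx _) (Sx n0) (Sx _)) _.
  rewrite [N (x n0 - _)]bs_distC // (_ : 4 * M 0%N = 2 * M 0%N + 2 * M 0%N); last by ring.
  have Mn : 2 * M n0 * 2^-1 ^+ n0 <= 2 * M 0%N * 2^-1 ^+ n0.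
    by rewrite ler_wpM2r ?exprn_ge0 // ler_wpM2l // Mh.
  by rewrite mulrDl lerD // (le_trans (tail2 _ _ _) Mn).
exists l => // n; apply/ler_addgt0Pr => e e0.
move/cvgrPdist_lt : xl => /(_ e e0)[K _ HK].
have := HK (maxn n K) (leq_maxr n K); rewrite /= sub0r normrN => /(le_lt_trans (ler_norm _)) h.
apply: le_trans (bs_tri (Sx _) (Sx (maxn n K)) Sl) _.
by rewrite lerD ?(ltW h) // bs_distC // tail2 // leq_maxl.
Qed.

End BanachSub.

Section Synthesis.
Variables (R : realType) (E : completeNormedModType R[i]) (Theta : holomorphy_type E).
Local Notation C := R[i]^o.
Local Notation S := (ht_space Theta).
Local Notation N := (ht_norm Theta).

Lemma hpoly_at0 m (P : E -> C) : hpoly m P -> (0 < m)%N -> P 0 = 0.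
Proof.
move=> hP m0; have := hpoly_hom 0 0 hP; rewrite scaler0 => ->.
by rewrite expr0n (gtn_eqF m0) mul0r.
Qed.

Lemma ht_taylor : exists2 s : R, 1 <= s & forall m j a P, (m <= j)%N -> S j P ->
  S m (taylor P a m) /\ N m (taylor P a m) <= s ^+ j * N j P * rnorm a ^+ (j - m).
Proof.
have [s s1 H] := ht_dhat Theta; exists s => // m j a P mj SP.
by have [h1 h2] := H m j a P mj SP; rewrite -dhatE; split=> //; exact: (bs_scale (ht_banach Theta m)).
Qed.

Lemma ht_taylor_in m j a P : S j P -> S m (taylor P a m).
Proof.
move=> SP; case: (leqP m j) => [mj|jm].
  by have [s s1 /(_ m j a P mj SP)[]] := ht_taylor.
rewrite (hpoly_taylor_gt _ (ht_hpoly SP)) //; exact: (bs_zero (ht_banach Theta m)).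
Qed.

(** At the point y = 0 the terms of positive degree of the expansion vanish, and
the term of degree 0 is a constant. *)
Lemma taylor0_cst j a P y : S j P -> taylor P a 0 y = P a.
Proof.
move=> SP; have : S 0 (taylor P a 0) by exact: ht_taylor_in SP.
rewrite ht_space0 => -[c cE].
have := hpoly_taylor_sum a 0 (ht_hpoly SP); rewrite addr0 big_ord_recl big1 /=.
  by rewrite cE addr0.
by move=> i _; apply: (hpoly_at0 (m := i.+1)) => //; apply: ht_hpoly; exact: ht_taylor_in SP.
Qed.

(** The case of degree 0 of the axiom on derivatives compares the norm of the
holomorphy type with the values of P. *)
Lemma ht_eval : exists2 s : R, 1 <= s & forall j a P, S j P ->
  rnorm (P a) <= s ^+ j * N j P * rnorm a ^+ j.
Proof.
have [s s1 H] := ht_taylor; exists s => // j a P SP.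
have [h1] := H 0%N j a P (leq0n j) SP; rewrite subn0.
have -> : taylor P a 0 = (fun=> P a) by apply/funext => y; exact: taylor0_cst SP.
by rewrite (ht_norm0 Theta (P a)).
Qed.

Lemma taylor_hpoly0 j (P : E -> C) m : hpoly j P ->
  taylor P 0 m = if m == j then P else 0.
Proof.
move=> hP; have hT i : hpoly i (if i == j then P else 0).
  by case: eqP => [->//|_]; exact: hpoly0.
rewrite (@taylorE _ _ P 0 (fun i => if i == j then P else 0)) //.
apply: (@taylor_at_finite _ _ _ _ _ j.+1) => // [i ji|y]; first by rewrite gtn_eqF.
rewrite add0r big_ord_recr /= eqxx big1 ?add0r // => i _.
by rewrite ltn_eqF.
Qed.

Lemma cvgC_sum (I : Type) (r : seq I) (u : I -> nat -> C) (l : I -> C) :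
  (forall i, u i @ \oo --> l i) ->
  (fun n => \sum_(i <- r) u i n) @ \oo --> \sum_(i <- r) l i.
Proof.
move=> H; elim: r => [|i r IH].
  rewrite big_nil (_ : (fun n => _) = (fun=> 0)); first exact: cvg_cst.
  by apply/funext => n; rewrite big_nil.
rewrite big_cons (_ : (fun n => _) = (fun n => u i n + \sum_(j <- r) u j n)).
  exact: (cvgD (H i) IH).
by apply/funext => n; rewrite big_cons.
Qed.

Lemma cvgC_zero_bound (u : nat -> C) l (K : R) :
  (forall n, rnorm (u n - l) <= K * 2^-1 ^+ n) -> u @ \oo --> l.
Proof.
move=> H; apply/cvgC_lt => e e0; have [n0 Hn] := half_expr_small K e0.
by exists n0 => n /Hn; exact: le_lt_trans.
Qed.

Variable P : nat -> E -> C.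
Hypothesis SP : forall j, S j (P j).
Hypothesis growth : forall r : R, 0 < r -> exists K : R, forall j, N j (P j) <= K * r ^+ j.

Let NP0 j : 0 <= N j (P j).
Proof. exact: (bs_norm_ge0 (ht_banach Theta j)). Qed.

Lemma growth_half (b : R) : 1 <= b -> exists2 K : R, 0 <= K &
  forall j, b ^+ j * N j (P j) <= K * 2^-1 ^+ j.
Proof.
move=> b1; have b0 : 0 < b by exact: lt_le_trans b1.
have r0 : 0 < (2 * b)^-1 by rewrite invr_gt0 mulr_gt0.
have [K HK] := growth r0.
have K0 : 0 <= K by have := HK 0%N; rewrite expr0 mulr1; exact: le_trans.
exists K => // j; apply: le_trans (ler_wpM2l _ (HK j)) _; first by rewrite exprn_ge0 // ltW.
rewrite mulrCA ler_wpM2l // -exprMn invfM mulrCA mulfV ?mulr1 // gt_eqF //.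
Qed.

(** The m-th Taylor coefficient at a of the sum: the norm of the m-th Taylor
coefficient of P_j at a is at most (s A)^j times the norm of P_j, so the series
converges in the Banach space of degree m, and its sum is again a continuous
homogeneous polynomial. *)
Lemma synth_coef a m : exists2 Q, S m Q &
  forall y, (fun n => \sum_(j < n) taylor (P j) a m y : C) @ \oo --> Q y.
Proof.
have [s s1 H] := ht_taylor; have [s' s'1 He] := ht_eval.
pose A := Num.max 1 (rnorm a); have A1 : 1 <= A by rewrite le_max lexx.
have aA : rnorm a <= A by rewrite le_max lexx orbT.
have sA1 : 1 <= s * A by rewrite mulr_ege1.
have [K K0 HK] := growth_half sA1.
have Sx n : S m (\sum_(j < n) taylor (P j) a m).
  by apply: (bs_sum (ht_banach Theta m)) => i _; exact: ht_taylor_in.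
have [|Q SQ HQ] := bs_geo_complete (ht_banach Theta m) (M := fun=> K) Sx (fun _ _ _ => lexx K).
  move=> j; rewrite big_ord_recr /= addrAC subrr add0r.
  apply: le_trans (HK j); case: (leqP m j) => [mj|jm]; last first.
    rewrite (hpoly_taylor_gt _ (ht_hpoly (SP j))) // (bs_norm0 (ht_banach Theta m)).
    by rewrite mulr_ge0 // exprn_ge0 // (le_trans ler01).
  have [_ /le_trans] := H m j a _ mj (SP j); apply.
  rewrite exprMn mulrAC ler_wpM2r // ler_wpM2l ?exprn_ge0 ?(le_trans ler01) //.
  apply: (@le_trans _ _ (A ^+ (j - m))).
    by rewrite lerXn2r // nnegrE ?rnorm_ge0 // (le_trans ler01).
  by rewrite ler_weXn2l // leq_subr.
exists Q => // y; apply: (@cvgC_zero_bound _ _ (s' ^+ m * (2 * K) * rnorm y ^+ m)) => n.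
have -> : \sum_(j < n) taylor (P j) a m y - Q y = (\sum_(j < n) taylor (P j) a m - Q) y.
  by rewrite !fctE fct_sumE.
apply: le_trans (He _ _ _ _) _; first exact: (bs_sub (ht_banach Theta m)).
rewrite [leRHS]mulrAC ler_wpM2r ?exprn_ge0 ?rnorm_ge0 // -mulrA ler_wpM2l //.
by rewrite exprn_ge0 // (le_trans ler01).
Qed.

(** The double series of the T_(j,m)(y), with T_(j,m) the Taylor coefficient of
order m of P_j at a, converges absolutely and uniformly for |y| < 1. Summing it
over m first gives f (a + y), and summing it over j first gives the Taylor
series of f at a. *)
Lemma synthesis : exists f : E -> C,
  [/\ entire f, forall m, taylor f 0 m = P m,
      forall x, (fun n => \sum_(j < n) P j x : C) @ \oo --> f x &
      forall a m y, (fun n => \sum_(j < n) taylor (P j) a m y : C) @ \oo --> taylor f a m y].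
Proof.
have [|Q0 HQ0] := @choice _ _ (fun (am : E * nat) (Q : E -> C) => S am.2 Q /\
    forall y, (fun n => \sum_(j < n) taylor (P j) am.1 am.2 y : C) @ \oo --> Q y).
  by move=> [a m]; have [Q h1 h2] := synth_coef a m; exists Q.
pose Q a m := Q0 (a, m).
have SQ a m : S m (Q a m) by have [] := HQ0 (a, m).
have QP a m y : (fun n => \sum_(j < n) taylor (P j) a m y : C) @ \oo --> Q a m y.
  by have [_] := HQ0 (a, m); exact.
pose f x := Q x 0%N 0.
have fP x : (fun n => \sum_(j < n) P j x : C) @ \oo --> f x.
  have := QP x 0%N 0; rewrite (_ : (fun n => _) = (fun n => \sum_(j < n) P j x)) //.
  by apply/funext => n; apply: eq_bigr => j _; exact: taylor0_cst.
have fQ a : taylor_at f a (Q a).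
  apply/taylor_atP; split=> [m|]; first exact: ht_hpoly.
  have [s s1 H] := ht_taylor; have [s' s'1 He] := ht_eval.
  have s0 := le_trans ler01 s1; have s'0 := le_trans ler01 s'1.
  pose A := Num.max 1 (rnorm a); have A1 : 1 <= A by rewrite le_max lexx.
  have A0 := le_trans ler01 A1.
  have aA : rnorm a <= A by rewrite le_max lexx orbT.
  have b1 : 1 <= 2 * (s * s' * A).
    by apply: le_trans (_ : 2 <= _); [rewrite ler1n|rewrite ler_peMr // !mulr_ege1].
  have [K K0 HK] := growth_half b1.
  exists 1 => // e e0; have [n0 Hn] := half_expr_small (2 * K) e0.
  exists n0 => // n /= /Hn hn x xa; apply: le_lt_trans hn.
  pose y := x - a; have y1 : rnorm y <= 1 by exact: ltW.
  have xE : x = a + y by rewrite /y addrC subrK.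
  rewrite -/y xE.
  (* A polynomial of degree j has no Taylor coefficient of order m > j, so only
     the P_j with j >= n contribute to the error of the partial sum of order n;
     its j + 1 <= 2^j coefficients are bounded by the same power of s s' A. *)
  have step j : rnorm (\sum_(m < n) taylor (P j) a m y - P j (a + y) : C) <=
      if (n <= j)%N then K * 2^-1 ^+ j else 0.
    rewrite (hpoly_taylor_sum _ _ (ht_hpoly (SP j))).
    case: leqP => [nj|jn]; last first.
      rewrite (big_ord_ltn_split (fun m => taylor (P j) a m y) jn) addrAC subrr add0r.
      rewrite big_nat_cond big1 ?rnorm0 // => m /andP[/andP[jm _] _].
      by rewrite (hpoly_taylor_gt _ (ht_hpoly (SP j))).
    rewrite [X in _ - X](big_ord_ltn_split (fun m => taylor (P j) a m y) (leqW nj)).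
    rewrite opprD addrA subrr sub0r rnormN; apply: le_trans (rnorm_sum _ _ _) _.
    apply: le_trans (HK j).
    have tm m : (m <= j)%N -> rnorm (taylor (P j) a m y) <= (s * s' * A) ^+ j * N j (P j).
      move=> mj; have [ST NT] := H m j a _ mj (SP j).
      apply: le_trans (He _ _ _ ST) _.
      apply: (@le_trans _ _ (s' ^+ m * N m (taylor (P j) a m))).
        rewrite ler_piMr //; last by rewrite exprn_ile1 // rnorm_ge0.
        by rewrite mulr_ge0 ?exprn_ge0 //; exact: (bs_norm_ge0 (ht_banach Theta m)).
      have sj : s' ^+ m <= s' ^+ j by rewrite ler_weXn2l.
      have aj : rnorm a ^+ (j - m) <= A ^+ j.
        apply: (@le_trans _ _ (A ^+ (j - m))); last by rewrite ler_weXn2l // leq_subr.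
        by rewrite lerXn2r // nnegrE rnorm_ge0.
      apply: le_trans (ler_pM _ _ sj NT) _; first exact: exprn_ge0.
        exact: (bs_norm_ge0 (ht_banach Theta m)).
      rewrite [leRHS](_ : _ = s' ^+ j * (s ^+ j * N j (P j) * A ^+ j)).
        by rewrite !ler_wpM2l ?mulr_ge0 ?exprn_ge0.
      by rewrite !exprMn; ring.
    apply: (@le_trans _ _ (\sum_(n <= m < j.+1) (s * s' * A) ^+ j * N j (P j))).
      by rewrite !big_nat; apply: ler_sum => m /andP[_ mj]; exact: tm.
    rewrite sumr_const_nat [in leRHS]exprMn -[leRHS]mulrA -[leLHS]mulr_natl.
    rewrite ler_wpM2r ?mulr_ge0 ?exprn_ge0 ?mulr_ge0 //.
    rewrite -natrX ler_nat (leq_trans (leq_subr _ _)) //; exact: ltn_expl.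
  apply: (@rnorm_lim_le _ (fun J => \sum_(m < n) \sum_(j < J) taylor (P j) a m y -
     \sum_(j < J) P j (a + y))).
    apply: cvgB => //.
    by apply: cvgC_sum => m; exact: QP.
  exists n => J nJ; rewrite exchange_big /= -sumrB.
  apply: le_trans (rnorm_sum _ _ _) _.
  apply: (@le_trans _ _ (\sum_(j < J) if (n <= j)%N then K * 2^-1 ^+ j else 0)).
    by apply: ler_sum => j _; exact: step.
  rewrite (big_ord_ltn_split (fun j => if (n <= j)%N then K * 2^-1 ^+ j else 0) nJ).
  rewrite big1 ?add0r => [|i _]; last by rewrite leqNgt ltn_ord.
  rewrite (eq_big_nat _ _ (F2 := fun j => K * 2^-1 ^+ j)); last by move=> j /andP[-> _].
  by rewrite -mulr_sumr [2 * K]mulrC -mulrA ler_wpM2l // sum_half_range_le.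
have fT a : taylor f a = Q a by rewrite (taylorE (fQ a)).
exists f; split; [by move=> a; exists (Q a)| |exact: fP|by move=> a m y; rewrite fT; exact: QP].
move=> m; rewrite fT; apply/funext => y.
apply: (cvg_unique _ (QP 0 m y)); first exact: norm_hausdorff.
apply/cvgC_lt => e e0; exists m.+1 => n mn.
rewrite (bigD1 (Ordinal mn)) //= big1 => [|j jm].
  rewrite (taylor_hpoly0 _ (ht_hpoly (SP m))).
  by rewrite eqxx addr0 subrr rnorm0.
rewrite (taylor_hpoly0 _ (ht_hpoly (SP j))).
by case: eqP => // E1; move: jm; rewrite -val_eqE /= E1 eqxx.
Qed.

End Synthesis.

(** * The identity theorem *)

Section Identity.
Variables (R : realType) (E : completeNormedModType R[i]).
Local Notation C := R[i]^o.

Lemma taylor_line (f : E -> C) x a : entire f ->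
  exists2 d : R, 0 < d & forall s : C, rnorm s < d ->
    pser_cvg (fun m => taylor f x m a) s (f (x + (s : R[i]) *: a)).
Proof.
move=> ef; have /taylor_atP[hT [r r0 Hr]] := entire_taylor_at x ef.
have a1 : 0 < rnorm a + 1 by rewrite ltr_wpDl // rnorm_ge0.
exists (r / (rnorm a + 1)); first exact: divr_gt0.
move=> s sd; apply/cvgC_lt => e e0; have [N _ HN] := Hr e e0.
exists N => n /HN /(_ (x + (s : R[i]) *: a)); rewrite [x + _]addrC addrK addrC.
under eq_bigr do rewrite (hpoly_hom _ _ (hT _)).
apply; rewrite rnormZ; move: sd; rewrite ltr_pdivlMr //; apply: le_lt_trans.
by rewrite ler_wpM2l ?rnorm_ge0 // lerDl.
Qed.

(** On each real half-line from 0 the set of points up to which f vanishes is open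
and closed. It is open because at its endpoint the Taylor series along the line
vanishes on one side, hence identically. *)
Lemma entire_identity0 (f : E -> C) : entire f -> (forall m, taylor f 0 m = 0) -> f = 0.
Proof.
move=> ef f0; apply/funext => a; pose h (s : R) := f ((s%:C%C : R[i]) *: a).
have step t0 : 0 <= t0 -> t0 = 0 \/ (forall s, 0 <= s -> s < t0 -> h s = 0) ->
    exists2 d : R, 0 < d & forall s, t0 <= s -> s < t0 + d -> h s = 0.
  move=> t00 H; set x : E := (t0%:C%C : R[i]) *: a.
  suff T0 m : taylor f x m a = 0.
    have [d d0 Hd] := taylor_line x a ef; exists d => // s ts sd.
    have [st0 sd'] : 0 <= s - t0 /\ s - t0 < d by lra.
    have := Hd (s - t0)%:C%C; rewrite rnorm_real // => /(_ sd').
    rewrite /x -scalerDl -rmorphD [t0 + _]addrC subrK => hs.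
    apply: (pser_unique hs); apply/cvgC_lt => e e0; exists 0%N => n _.
    by rewrite big1 ?subrr ?rnorm0 // => i _; rewrite T0 mulr0.
  have [t0E|t0n] := eqVneq t0 0.
    have -> : x = 0 by rewrite /x t0E scale0r.
    by rewrite f0.
  have t0p : 0 < t0 by rewrite lt_neqAle eq_sym t0n.
  case: H => [t0E|H]; first by rewrite t0E eqxx in t0n.
  have [d d0 Hd] := taylor_line x (- a) ef.
  suff : taylor f x m (- a) = 0.
    have -> : - a = (-1 : R[i]) *: a by rewrite scaleN1r.
    rewrite (hpoly_hom _ _ (taylor_hpoly x m ef)) => /eqP.
    by rewrite mulf_eq0 expf_eq0 oppr_eq0 oner_eq0 andbF => /eqP.
  pose d' := Num.min d t0; have d'0 : 0 < d' by rewrite lt_min d0.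
  apply: (@pser_zero_real _ (fun m => taylor f x m (- a)) d') => // s s0.
  rewrite lt_min => /andP[sd st].
  have := Hd s%:C%C; rewrite rnorm_real ?(ltW s0) // => /(_ sd).
  by rewrite scalerN /x -scalerBl -rmorphB -/(h _) H // ?subr_ge0 ?(ltW st) // ltrBlDr ltrDl.
pose A := [set t : R | 0 <= t <= 1 /\ forall s, 0 <= s <= t -> h s = 0].
have A0 : A 0.
  split=> [|s]; first by rewrite lexx ler01.
  rewrite -eq_le => /eqP <-; have [d d0 Hd] := step 0 (lexx 0) (or_introl erefl).
  by apply: Hd; rewrite ?add0r.
have supA : has_sup A by split; [exists 0|exists 1 => t [/andP[]]].
have s0 : 0 <= sup A by apply: ub_le_sup => //; case: supA.
have H s : 0 <= s -> s < sup A -> h s = 0.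
  move=> sp; rewrite -subr_gt0 => /(sup_adherent)/(_ supA)[t [_ At]]; rewrite subKr => st.
  by apply: At; rewrite sp ltW.
have [d d0 Hd] := step _ s0 (or_intror H).
have H' s : 0 <= s -> s < sup A + d -> h s = 0.
  by move=> sp sd; case: (ltP s (sup A)) => [/H|/Hd]; apply.
suff : h 1 = 0 by rewrite /h scale1r.
apply: (H' 1); rewrite ?ler01 // ltNge; apply/negP => d1.
suff : sup A + d / 2 <= sup A by rewrite gerDl leNgt divr_gt0.
apply: ub_le_sup; first by case: supA.
split=> [|s /andP[s1 s2]]; first by apply/andP; split; lra.
by apply: H' => //; lra.
Qed.

Lemma entire_lin (c : C) (f g : E -> C) : entire f -> entire g -> entire ((c : R[i]) *: f + g).
Proof.
move=> ef eg a; have [P fP] := ef a; have [Q gQ] := eg a.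
by eexists; exact: taylor_at_lin fP gQ.
Qed.

Lemma taylor_lin (c : C) (f g : E -> C) a m : entire f -> entire g ->
  taylor ((c : R[i]) *: f + g) a m = (c : R[i]) *: taylor f a m + taylor g a m.
Proof.
move=> /(entire_taylor_at a) fT /(entire_taylor_at a) gT.
by rewrite (taylorE (taylor_at_lin c fT gT)).
Qed.

Lemma entire_identity (f g : E -> C) : entire f -> entire g ->
  (forall m, taylor f 0 m = taylor g 0 m) -> f = g.
Proof.
move=> ef eg fg; apply/eqP; rewrite -subr_eq0; apply/eqP.
rewrite addrC -scaleN1r; apply: entire_identity0; first exact: entire_lin.
by move=> m; rewrite taylor_lin // fg scaleN1r addNr.
Qed.

End Identity.

(** * The weights *)

Section Weights.
Variables (R : realType) (k : \bar R).
Hypothesis hk : (1 < k)%E.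
Local Notation w := (@exp_weight R k).

Lemma fact_ge_pow (A : R) j : 0 <= A -> A ^+ j <= j`!%:R * expR A.
Proof.
move=> A0; have f0 : 0 < j`!%:R :> R by rewrite ltr0n fact_gt0.
rewrite mulrC -ler_pdivrMr //; case: j f0 => [|j] f0.
  by rewrite expr0 divr1 -expR0 ler_expR.
by apply: le_trans (expR_ge1Dxn j A0); rewrite lerDr.
Qed.

(** With x = j / (k e) the weight is exp (e x ln x), and x ln x >= -1. *)
Lemma exp_weight_lower : exists2 w0 : R, 0 < w0 & forall j, w0 <= w j.
Proof.
rewrite /exp_weight; case: k hk => [r| |] //= r1; last by exists 1.
rewrite lte_fin in r1; have r0 : 0 < r by exact: lt_trans r1.
pose e : R := expR 1; have e0 : 0 < e by exact: expR_gt0.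
exists (expR (- e)); first exact: expR_gt0.
case=> [|j]; first by rewrite !mul0r powRr0 expR_le1 oppr_le0 ltW.
pose x : R := j.+1%:R / (r * e); have x0 : 0 < x by rewrite divr_gt0 // mulr_gt0.
rewrite -/e -/x /powR gt_eqF // ler_expR.
have -> : j.+1%:R / r = e * x by rewrite /x; field; rewrite !gt_eqF.
rewrite -mulrA -mulrN1 ler_pM2l // -ler_pdivrMl // mulrN1 lerNl -lnV ?posrE //.
by rewrite ltW // ln_sublinear // invr_gt0.
Qed.

(** For finite k the exponent 1 - s is 1/k, by j^j <= j! e^j; for k = +oo the
weights are 1 and s = 1. So k > 1 is the condition that s be positive. *)
Lemma exp_weight_fact : exists2 s : R, 0 < s &
  forall j, w j <= j`!%:R `^ (1 - s).
Proof.
rewrite /exp_weight; case: k hk => [r| |] //= r1; last first.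
  by exists 1 => // j; rewrite subrr powRr0.
rewrite lte_fin in r1; have r0 : 0 < r by exact: lt_trans r1.
exists (1 - r^-1); first by rewrite subr_gt0 invf_lt1.
move=> j; rewrite subKr powRrM.
apply: ge0_ler_powR; rewrite ?invr_ge0 ?nnegrE ?powR_ge0 ?ler0n ?(ltW r0) //.
pose e : R := expR 1; have e0 : 0 < e by exact: expR_gt0.
rewrite -/e powR_mulrn ?divr_ge0 ?mulr_ge0 ?(ltW r0) ?(ltW e0) ?ler0n //.
have ej : 0 < e ^+ j by rewrite exprn_gt0.
apply: (@le_trans _ _ ((j%:R / e) ^+ j)).
  rewrite lerXn2r ?nnegrE ?divr_ge0 ?mulr_ge0 ?(ltW r0) ?(ltW e0) ?ler0n //.
  rewrite ler_wpM2l ?ler0n // lef_pV2 ?posrE ?mulr_gt0 //.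
  by rewrite ler_peMl ?(ltW r1) // ltW.
rewrite expr_div_n ler_pdivrMr //.
apply: le_trans (fact_ge_pow _ (ler0n _ j)) _.
by rewrite /e -expRM_natl mulr1.
Qed.

(** The quotient is at most (j!)^-s, and j! dominates A^j for every A. The choice
A = eps^(-1/s) gives the rate eps. *)
Lemma exp_weight_upper (eps : R) : 0 < eps ->
  exists2 K : R, 0 <= K & forall j, w j / j`!%:R <= K * eps ^+ j.
Proof.
move=> eps0; have [s s0 Hs] := exp_weight_fact.
pose A := (eps^-1) `^ (s^-1); have A0 : 0 <= A by exact: powR_ge0.
exists (expR A `^ s); first exact: powR_ge0.
move=> j; have f0 : 0 < j`!%:R :> R by rewrite ltr0n fact_gt0.
have As : (A ^+ j) `^ s = eps ^- j.
  have As1 : A `^ s = eps^-1.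
    by rewrite /A -powRrM mulVf ?gt_eqF // powRr1 ?invr_ge0 ?(ltW eps0).
  by rewrite -powR_mulrn // powRAC As1 powR_mulrn ?invr_ge0 ?(ltW eps0) // exprVn.
have h : (A ^+ j) `^ s <= (j`!%:R * expR A) `^ s.
  apply: ge0_ler_powR; rewrite ?nnegrE ?(ltW s0) ?exprn_ge0 ?mulr_ge0 ?expR_ge0 ?(ltW f0) //.
  exact: fact_ge_pow.
rewrite As powRM ?(ltW f0) ?expR_ge0 // in h.
have fs : 0 < j`!%:R `^ s :> R by rewrite powR_gt0.
apply: (@le_trans _ _ ((j`!%:R `^ s)^-1)).
  rewrite ler_pdivrMr //; apply: le_trans (Hs j) _.
  rewrite powRB; last by rewrite (gt_eqF f0) implybT.
  rewrite powRr1 ?(ltW f0) //.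
  by rewrite mulrC.
have ej : 0 < eps ^+ j by rewrite exprn_gt0.
rewrite -[eps ^- j]mul1r ler_pdivrMr // in h.
rewrite -[leLHS]mul1r ler_pdivrMr //; apply: (le_trans h).
by rewrite [leRHS]mulrC mulrA.
Qed.

End Weights.

(** * Elements of the space and their coefficients *)

Section ExpBasics.
Variables (R : realType) (E : completeNormedModType R[i]) (Theta : holomorphy_type E).
Variable (k : \bar R).
Hypothesis hk : (1 < k)%E.
Local Notation C := R[i]^o.
Local Notation S := (ht_space Theta).
Local Notation N := (ht_norm Theta).
Local Notation w := (@exp_weight R k).
Local Notation X := (Exp Theta k).

Lemma coef_normE (f : E -> C) j : coef_norm Theta f j = N j (taylor f 0 j).
Proof. by rewrite /coef_norm dhatE. Qed.

Lemma dhat_in (f : E -> C) j : S j (dhat j f 0) <-> S j (taylor f 0 j).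
Proof.
split=> [h|h]; first by rewrite -dhatE; exact: (bs_scale (ht_banach Theta j)).
exact: (bs_scale (ht_banach Theta j)).
Qed.

Lemma exp_norm_term (f : E -> C) (rho e : R) j : 0 < rho ->
  (forall i, S i (taylor f 0 i)) -> (exp_norm Theta k rho f <= e%:E)%E ->
  w j * N j (taylor f 0 j) <= e * rho ^+ j.
Proof.
move=> rho0 Sf /(le_trans _) h.
have t0 i : 0 <= rho ^- i * w i * coef_norm Theta f i.
  rewrite coef_normE mulr_ge0 ?(bs_norm_ge0 (ht_banach Theta i)) // mulr_ge0 ?exp_weight_ge0 //.
  by rewrite invr_ge0 exprn_ge0 // ltW.
have : (\sum_(0 <= i < j.+1) (rho ^- i * w i * coef_norm Theta f i)%:E <= e%:E)%E.
  by apply: h; apply: nneseries_lim_ge => i _ _; rewrite lee_fin.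
rewrite sumEFin lee_fin big_nat_recr //= => h2.
rewrite -ler_pdivrMr ?exprn_gt0 // mulrC mulrA -coef_normE; apply: le_trans h2.
by rewrite lerDr sumr_ge0.
Qed.

Lemma exp_norm_bound (f : E -> C) (rho c : R) : 0 < rho ->
  (forall i, S i (taylor f 0 i)) ->
  (forall j, w j * N j (taylor f 0 j) <= c * (rho / 2) ^+ j) ->
  (exp_norm Theta k rho f <= (2 * c)%:E)%E.
Proof.
move=> rho0 Sf H.
have c0 : 0 <= c.
  have := H 0%N; rewrite expr0 mulr1; apply: le_trans.
  by rewrite mulr_ge0 ?exp_weight_ge0 // (bs_norm_ge0 (ht_banach Theta 0)).
apply: lime_le.
  apply: is_cvg_nneseries => i _ _; rewrite lee_fin.
  rewrite coef_normE mulr_ge0 ?(bs_norm_ge0 (ht_banach Theta i)) // mulr_ge0 ?exp_weight_ge0 //.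
  by rewrite invr_ge0 exprn_ge0 // ltW.
apply: nearW => n; rewrite sumEFin lee_fin.
apply: (@le_trans _ _ (\sum_(0 <= j < n) c * 2^-1 ^+ j)).
  apply: ler_sum => j _; rewrite coef_normE -mulrA ler_pdivrMl ?exprn_gt0 //.
  by rewrite mulrCA -exprMn.
by rewrite -mulr_sumr mulrC ler_wpM2r //; have := sum_half_range_le R 0 n; rewrite expr0 mulr1.
Qed.

(** The condition on the coefficients that defines the space, in a form that is
the same for finite and infinite k. *)
Definition rapid (P : nat -> E -> C) := forall rho : R, 0 < rho ->
  exists c : R, forall j, w j * N j (P j) <= c * rho ^+ j.

Lemma exp_growthP (f : E -> C) : (forall i, S i (taylor f 0 i)) ->
  exp_growth Theta k f <-> rapid (taylor f 0).
Proof.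
move=> Sf.
have q0 j : 0 <= N j (taylor f 0 j) by exact: (bs_norm_ge0 (ht_banach Theta j)).
rewrite /exp_growth; case: ifPn => [/eqP koo|kf].
  have w1 j : w j = 1 by rewrite /exp_weight koo eqxx.
  split=> [H rho rho0|H].
    move/cvgrPdist_lt : H => /(_ _ rho0)[n0 _ Hn0].
    pose K := 1 + \sum_(i < n0.+1) N i (taylor f 0 i) / rho ^+ i.
    have T0 i : 0 <= N i (taylor f 0 i) / rho ^+ i.
      by rewrite divr_ge0 // exprn_ge0 // ltW.
    exists K => j; rewrite w1 mul1r -ler_pdivrMr ?exprn_gt0 //.
    case: (ltnP j n0.+1) => [jn|nj].
      rewrite /K (bigD1 (Ordinal jn)) //= addrCA lerDl addr_ge0 // sumr_ge0 //.
    rewrite ler_wpDr ?sumr_ge0 // ler_pdivrMr ?exprn_gt0 // mul1r.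
    have := Hn0 j (ltnW nj); rewrite /= sub0r normrN ger0_norm ?powR_ge0 // coef_normE => h.
    have jn0 : (j%:R : R) != 0 by rewrite pnatr_eq0 -lt0n (leq_trans _ nj).
    have -> : N j (taylor f 0 j) = (N j (taylor f 0 j) `^ (j%:R^-1)) ^+ j.
      by rewrite -powR_mulrn ?powR_ge0 // -powRrM mulVf // powRr1.
    by rewrite lerXn2r ?nnegrE ?powR_ge0 // ltW.
  apply/cvgrPdist_le => e e0.
  have [c Hc] := H (e / 2) (ltac:(by rewrite divr_gt0)).
  have [n0 Hn0] := half_expr_small c ltr01.
  exists (maxn 1 n0) => // j /=; rewrite geq_max => /andP[j1 /Hn0 jn].
  have jn0 : (j%:R : R) != 0 by rewrite pnatr_eq0 -lt0n.
  rewrite sub0r normrN ger0_norm ?powR_ge0 // coef_normE.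
  have key : N j (taylor f 0 j) <= e ^+ j.
    have := Hc j; rewrite w1 mul1r => /le_trans; apply.
    rewrite exprMn mulrCA ler_piMr ?exprn_ge0 ?(ltW e0) //.
    exact: ltW.
  apply: le_trans (ge0_ler_powR _ _ _ key) _.
  - by rewrite invr_ge0.
  - by rewrite nnegrE.
  - by rewrite nnegrE exprn_ge0 // ltW.
  by rewrite -powR_mulrn ?(ltW e0) // -powRrM mulfV // powRr1 ?(ltW e0).
split=> H rho rho0.
  have := H rho rho0; case E1 : (exp_norm Theta k rho f) => [x| |] // _.
    by exists x => j; apply: exp_norm_term => //; rewrite E1 lexx.
  exists 0 => j; apply: exp_norm_term => //; by rewrite E1 leNye.
have [c Hc] := H (rho / 2) (ltac:(by rewrite divr_gt0)).
by apply: le_lt_trans (exp_norm_bound rho0 Sf Hc) _; rewrite ltry.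
Qed.

Lemma exp_setP (f : E -> C) : exp_set Theta k f <->
  [/\ entire f, forall j, S j (taylor f 0 j) & rapid (taylor f 0)].
Proof.
split=> [[ef Sf gf]|[ef Sf gf]].
  have Sf' j : S j (taylor f 0 j) by apply/dhat_in.
  by split=> //; apply/exp_growthP.
by split=> // [j|]; [apply/dhat_in|apply/exp_growthP].
Qed.

Lemma ExpP (f : X) : [/\ entire f, forall j, S j (taylor f 0 j) & rapid (taylor f 0)].
Proof. by apply/exp_setP; case: f => f /= /asboolP. Qed.

Lemma Exp_entire (f : X) : entire f. Proof. by case: (ExpP f). Qed.
Lemma Exp_coef_in (f : X) j : S j (taylor f 0 j). Proof. by case: (ExpP f). Qed.
Hint Resolve Exp_entire Exp_coef_in : core.

Lemma Exp_ext (f g : X) : (forall m, taylor f 0 m = taylor g 0 m) -> f = g.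
Proof. move=> fg; apply: val_inj; exact: (entire_identity (Exp_entire f) (Exp_entire g) fg). Qed.

Lemma Exp_linE (c : C) (f g : X) :
  (((c : R[i]) *: f + g : X) : E -> C) = (c : R[i]) *: (f : E -> C) + (g : E -> C).
Proof. by []. Qed.

Lemma taylor_Exp_lin (c : C) (f g : X) m :
  taylor ((c : R[i]) *: f + g : X) 0 m = (c : R[i]) *: taylor f 0 m + taylor g 0 m.
Proof. by rewrite Exp_linE taylor_lin. Qed.

Lemma taylor_ExpB (f g : X) m : taylor (f - g : X) 0 m = taylor f 0 m - taylor g 0 m.
Proof. by rewrite addrC -scaleN1r taylor_Exp_lin scaleN1r addrC. Qed.

Lemma taylor_Exp0 m : taylor (0 : X) 0 m = 0.
Proof. by rewrite -[0 : X](subrr 0) taylor_ExpB subrr. Qed.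

Lemma taylor_ExpD (f g : X) m : taylor (f + g : X) 0 m = taylor f 0 m + taylor g 0 m.
Proof. by rewrite -[f in LHS]scale1r taylor_Exp_lin scale1r. Qed.

Lemma taylor_ExpZ (c : C) (f : X) m : taylor ((c : R[i]) *: f : X) 0 m = (c : R[i]) *: taylor f 0 m.
Proof. by rewrite -[_ *: f]addr0 taylor_Exp_lin taylor_Exp0 addr0. Qed.

Lemma taylor_Exp_sum (I : Type) (r : seq I) (F : I -> X) m :
  taylor (\sum_(i <- r) F i : X) 0 m = \sum_(i <- r) taylor (F i) 0 m.
Proof.
elim: r => [|i r IH]; first by rewrite !big_nil taylor_Exp0.
by rewrite !big_cons taylor_ExpD IH.
Qed.

Lemma rapid_growth (P : nat -> E -> C) : (forall j, S j (P j)) -> rapid P ->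
  forall r : R, 0 < r -> exists K : R, forall j, N j (P j) <= K * r ^+ j.
Proof.
move=> SP rP r r0; have [w0 w00 Hw] := exp_weight_lower hk.
have [c Hc] := rP r r0; exists (c / w0) => j.
rewrite mulrAC ler_pdivlMr // mulrC; apply: le_trans (Hc j).
by rewrite ler_wpM2r // (bs_norm_ge0 (ht_banach Theta j)).
Qed.

Lemma Exp_synthesis (P : nat -> E -> C) : (forall j, S j (P j)) -> rapid P ->
  exists f : X, [/\ forall m, taylor f 0 m = P m,
      forall x, (fun n => \sum_(j < n) P j x : C) @ \oo --> f x &
      forall a m y, (fun n => \sum_(j < n) taylor (P j) a m y : C) @ \oo --> taylor f a m y].
Proof.
move=> SP rP; have [f [ef f0 fx ft]] := synthesis SP (rapid_growth SP rP).
have fX : f \in exp_pred Theta k.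
  apply/asboolP/exp_setP; split=> // [j|]; first by rewrite f0.
  by rewrite (_ : taylor f 0 = P) //; apply/funext.
by exists (MkExp fX).
Qed.

Lemma Exp_series (f : X) :
  (forall x, (fun n => \sum_(j < n) taylor f 0 j x : C) @ \oo --> f x) /\
  (forall a m y, (fun n => \sum_(j < n) taylor (taylor f 0 j) a m y : C) @ \oo --> taylor f a m y).
Proof.
have [ef Sf rf] := ExpP f; have [g [g0 gx gt]] := Exp_synthesis Sf rf.
have fg : f = g by apply: Exp_ext => m; rewrite g0.
by split=> [x|a m y]; [have := gx x|have := gt a m y]; rewrite -fg.
Qed.

End ExpBasics.

(** * The topology and completeness *)

Section ExpTopology.
Variables (R : realType) (E : completeNormedModType R[i]) (Theta : holomorphy_type E).
Variable (k : \bar R).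
Hypothesis hk : (1 < k)%E.
Local Notation C := R[i]^o.
Local Notation S := (ht_space Theta).
Local Notation N := (ht_norm Theta).
Local Notation w := (@exp_weight R k).
Local Notation X := (Exp Theta k).
Implicit Types (f g : X) (n : nat) (c d : R).

Hint Resolve Exp_entire Exp_coef_in : core.

Let B j := ht_banach Theta j.

Definition wrad n : R := 2^-1 ^+ n.

Lemma wrad_gt0 n : 0 < wrad n. Proof. exact: exprn_gt0. Qed.
Lemma wrad_ge0 n : 0 <= wrad n. Proof. exact: exprn_ge0. Qed.
Hint Resolve wrad_gt0 wrad_ge0 : core.

Lemma wrad_le m n : (m <= n)%N -> wrad n <= wrad m.
Proof. by move=> mn; rewrite ler_wiXn2l // invf_le1 // ler1n. Qed.

Lemma wrad_small (e : R) : 0 < e -> exists n, wrad n <= e.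
Proof.
move=> e0; have [n Hn] := half_expr_small 1 e0; exists n.
by have := Hn n (leqnn n); rewrite mul1r => /ltW.
Qed.

(** The coefficientwise supremum version of the seminorm of parameter 2^-n is at
most c. These conditions define the same topology as the given norms, and they
avoid sums of series. *)
Definition bnd f n c := forall j, w j * N j (taylor f 0 j) <= c * wrad n ^+ j.

Lemma Exp_norm_ge0 f j : 0 <= N j (taylor f 0 j).
Proof. exact: (bs_norm_ge0 (B j)). Qed.

Lemma bnd_ge0 f n c : bnd f n c -> 0 <= c.
Proof.
move=> /(_ 0%N); rewrite expr0 mulr1; apply: le_trans.
by rewrite mulr_ge0 ?exp_weight_ge0 // Exp_norm_ge0.
Qed.

Lemma bnd_le f n c d : c <= d -> bnd f n c -> bnd f n d.
Proof. by move=> cd H j; apply: le_trans (H j) _; rewrite ler_wpM2r // exprn_ge0. Qed.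

Lemma bnd_mono f m n c : (m <= n)%N -> bnd f n c -> bnd f m c.
Proof.
move=> mn H j; apply: le_trans (H j) _; rewrite ler_wpM2l ?(bnd_ge0 H) //.
by rewrite lerXn2r ?nnegrE // wrad_le.
Qed.

Lemma bnd0 n c : 0 <= c -> bnd 0 n c.
Proof.
by move=> c0 j; rewrite taylor_Exp0 (bs_norm0 (B j)) mulr0 mulr_ge0 // exprn_ge0.
Qed.

Lemma bnd_lin (a : C) f g n c d : bnd f n c -> bnd g n d ->
  bnd ((a : R[i]) *: f + g) n (rnorm a * c + d).
Proof.
move=> Hf Hg j; rewrite taylor_Exp_lin mulrDl.
have Saf : S j ((a : R[i]) *: taylor f 0 j) by exact: (bs_scale (B j)).
apply: (@le_trans _ _ (w j * (rnorm a * N j (taylor f 0 j) + N j (taylor g 0 j)))).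
  rewrite ler_wpM2l ?exp_weight_ge0 //.
  by apply: le_trans (bs_normD (B j) Saf _) _ => //; rewrite (bs_normZ (B j)).
rewrite mulrDr lerD // mulrCA -mulrA ler_wpM2l ?rnorm_ge0 //.
Qed.

Lemma bndZ (a : C) f n c : bnd f n c -> bnd ((a : R[i]) *: f) n (rnorm a * c).
Proof.
by move=> H; have := bnd_lin a H (bnd0 n (lexx 0)); rewrite !addr0.
Qed.

Lemma bndD f g n c d : bnd f n c -> bnd g n d -> bnd (f + g) n (c + d).
Proof. by move=> Hf Hg; have := bnd_lin 1 Hf Hg; rewrite scale1r rnorm1 mul1r. Qed.

Lemma bndN f n c : bnd f n c -> bnd (- f) n c.
Proof. by move=> H; have := bndZ (-1) H; rewrite scaleN1r rnormN rnorm1 mul1r. Qed.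

Lemma bnd_distC f g n c : bnd (f - g) n c -> bnd (g - f) n c.
Proof. by move/bndN; rewrite opprB. Qed.

Lemma bnd_tri f g h n c d : bnd (f - g) n c -> bnd (g - h) n d -> bnd (f - h) n (c + d).
Proof. by move=> /bndD H /H; rewrite addrA subrK. Qed.

Lemma bnd_ex f n : exists2 c, 0 < c & bnd f n c.
Proof.
have [_ _ /(_ _ (wrad_gt0 n))[c Hc]] := ExpP f.
have c0 : 0 <= c by exact: (@bnd_ge0 f n).
by exists (c + 1); [rewrite ltr_wpDl|apply: (@bnd_le f n c) => //; rewrite lerDl].
Qed.

Lemma bnd_eval0 : exists2 K : R, 0 < K & forall f n c, bnd f n c -> rnorm (f 0) <= K * c.
Proof.
have [w0 w00 Hw] := exp_weight_lower hk.
exists w0^-1; first by rewrite invr_gt0.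
move=> f n c /(_ 0%N); rewrite expr0 mulr1 => H.
have f0 : f 0 = taylor f 0 0 0.
  have [d d0] := taylor_line 0 0 (Exp_entire f).
  by move=> /(_ 0); rewrite rnorm0 scaler0 addr0 => /(_ d0)/pser0.
have : S 0 (taylor f 0 0) by [].
rewrite ht_space0 => -[z zE].
rewrite f0; move: H; rewrite zE (ht_norm0 Theta z) => H.
by rewrite mulrC ler_pdivlMr // mulrC; apply: le_trans H; rewrite ler_wpM2r ?rnorm_ge0.
Qed.

Lemma exp_norm_fin f (rho : R) : 0 < rho -> exists2 x : R, 0 <= x & exp_norm Theta k rho f = x%:E.
Proof.
move=> rho0; have [_ Sf rf] := ExpP f.
have [c Hc] := rf (rho / 2) (ltac:(by rewrite divr_gt0)).
have h := exp_norm_bound rho0 Sf Hc.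
have h0 : (0 <= exp_norm Theta k rho f)%E.
  apply: nneseries_ge0 => j _ _; rewrite lee_fin coef_normE.
  by rewrite mulr_ge0 ?Exp_norm_ge0 // mulr_ge0 ?exp_weight_ge0 // invr_ge0 exprn_ge0 // ltW.
move: h h0; case: (exp_norm _ _ _ _) => [x| |] //; rewrite ?lee_fin.
by move=> _ x0; exists x.
Qed.

Lemma exp_norm_tri f g (rho : R) : 0 < rho ->
  (exp_norm Theta k rho (f + g)%R <= exp_norm Theta k rho f + exp_norm Theta k rho g)%E.
Proof.
move=> rho0.
have w0 j : 0 <= rho ^- j * w j :> R.
  by rewrite mulr_ge0 ?exp_weight_ge0 // invr_ge0 exprn_ge0 // ltW.
have t0 (h : X) j : 0 <= rho ^- j * w j * coef_norm Theta h j.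
  by rewrite coef_normE; apply: mulr_ge0; [exact: w0|exact: Exp_norm_ge0].
rewrite /exp_norm -nneseriesD; last 2 first.
- by move=> j _; rewrite lee_fin t0.
- by move=> j _; rewrite lee_fin t0.
apply: lee_nneseries => j _; first by move=> _; rewrite lee_fin t0.
rewrite -EFinD lee_fin -mulrDr; apply: ler_wpM2l => //.
by rewrite !coef_normE taylor_ExpD; exact: (bs_normD (B j)).
Qed.

(** A supremum bound at the parameter rho / 2 gives a convergent geometric series
at the parameter rho. *)
Lemma ball_bnd f0 f (rho e : R) : 0 < rho -> exp_ball f0 rho e f ->
  exists n c, 0 < c /\ forall g, bnd (g - f) n c -> exp_ball f0 rho e g.
Proof.
move=> rho0 fb; have [x x0 xE] := exp_norm_fin (f - f0) rho0.
have xe : x < e by rewrite -lte_fin -xE.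
have [n Hn] := wrad_small (ltac:(by rewrite divr_gt0) : 0 < rho / 2).
exists n, ((e - x) / 4); split; first by rewrite divr_gt0 // subr_gt0.
move=> g Hg; suff : (exp_norm Theta k rho (g - f0)%R < e%:E)%E by [].
have -> : g - f0 = (g - f) + (f - f0) by rewrite addrA subrK.
apply: le_lt_trans (exp_norm_tri _ _ rho0) _.
have Hg' : forall j, w j * N j (taylor (g - f : X) 0 j) <= (e - x) / 4 * (rho / 2) ^+ j.
  move=> j; apply: le_trans (Hg j) _; rewrite ler_wpM2l ?(bnd_ge0 Hg) //.
  by rewrite lerXn2r // nnegrE // ltW // divr_gt0.
apply: le_lt_trans (leeD2r _ (exp_norm_bound rho0 (Exp_coef_in (g - f)) Hg')) _.
by rewrite xE -EFinD lte_fin; lra.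
Qed.

Lemma open_bnd (U : set X) f : open U -> U f ->
  exists n c, 0 < c /\ forall g, bnd (g - f) n c -> U g.
Proof.
move=> [D' D'sub <-] [A DA Af].
have [F FD FE] := D'sub A DA.
suff [n [c [c0 H]]] : exists n c, 0 < c /\
    forall g, bnd (g - f) n c -> forall V : set X, V \in (finmap.enum_fset F) -> V g.
  exists n, c; split=> // g /H Hg; exists A; first exact: DA.
  have Ag : (A : set X) g by rewrite -FE => V VF; exact: (Hg V VF).
  exact: Ag.
have : forall V : set X, V \in (finmap.enum_fset F) -> exp_subbase V /\ V f.
  move=> V VF; split; first by have := FD V VF; rewrite inE.
  have : (A : set X) f by exact: Af.
  by rewrite -FE => /(_ V VF).
elim: (finmap.enum_fset F) => [_|V s IH H].
  by exists 0%N, 1; split=> // g _ V; rewrite inE.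
have [n1 [c1 [c10 H1]]] := IH (fun V Vs => H V (mem_behead (s := _ :: _) Vs)).
have [[f0 [rho [e [rho0 e0 VE]]]] Vf] := H V (mem_head _ _).
rewrite VE in Vf; have [n2 [c2 [c20 H2]]] := ball_bnd rho0 Vf.
exists (maxn n1 n2), (Num.min c1 c2); split; first by rewrite lt_min c10.
move=> g Hg W; rewrite inE => /orP[/eqP->|Ws].
  rewrite VE; apply: H2; apply: (bnd_mono (leq_maxr n1 n2)).
  by apply: bnd_le Hg; rewrite ge_min lexx orbT.
apply: H1 => //; apply: (bnd_mono (leq_maxl n1 n2)).
by apply: bnd_le Hg; rewrite ge_min lexx.
Qed.

Lemma bnd_open f n c : 0 < c ->
  exists V : set X, [/\ open V, V f & forall g, V g -> bnd (g - f) n c].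
Proof.
move=> c0; exists (exp_ball f (wrad n) c); split.
- exists [set exp_ball f (wrad n) c]; last by rewrite bigcup_set1.
  move=> _ ->; apply: finI_from1; exists f, (wrad n), c; split=> //.
- suff : (exp_norm Theta k (wrad n) (f - f)%R < c%:E)%E by []; rewrite subrr.
  apply: (@le_lt_trans _ _ (2 * 0)%:E); last by rewrite mulr0 lte_fin.
  apply: (exp_norm_bound (wrad_gt0 n) (Exp_coef_in 0)) => j.
  by rewrite taylor_Exp0 (bs_norm0 (B j)) mulr0 mul0r.
- move=> g Hg j; have /ltW h : (exp_norm Theta k (wrad n) (g - f)%R < c%:E)%E by [].
  exact: (exp_norm_term _ (wrad_gt0 n) (Exp_coef_in (g - f)) h).
Qed.

(** The limit is taken coefficient by coefficient in the Banach spaces of the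
holomorphy type; the rates are uniform in the degree, so the limit
coefficients decrease rapidly and [Exp_synthesis] applies. *)
Lemma Exp_complete (x : nat -> X) : (forall s, bnd (x s.+1 - x s) s (wrad s)) ->
  exists l, forall s, bnd (l - x s) s (2 * wrad s).
Proof.
move=> H; have [w0 w00 Hw] := exp_weight_lower hk.
have wp j : 0 < w j by exact: lt_le_trans (Hw j).
have H1 j : exists2 l, S j l & forall n,
    N j (taylor (x n) 0 j - l) <= 2 * (wrad n ^+ j / w j) * 2^-1 ^+ n.
  apply: (@bs_geo_complete _ _ _ _ (B j) (fun s => taylor (x s) 0 j) (fun s => wrad s ^+ j / w j)) => //.
    move=> s t st; rewrite ler_wpM2r ?invr_ge0 ?(ltW (wp j)) //.
    by rewrite lerXn2r ?nnegrE // wrad_le.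
  move=> s; have := H s j; rewrite taylor_ExpB => h.
  by rewrite mulrAC ler_pdivlMr // mulrC [_ ^+ j * _]mulrC.
have [P HP] := @choice _ _ (fun j l => S j l /\ forall n,
    N j (taylor (x n) 0 j - l) <= 2 * (wrad n ^+ j / w j) * 2^-1 ^+ n)
    (fun j => let: ex_intro2 l a b := H1 j in ex_intro _ l (conj a b)).
have SP j : S j (P j) by case: (HP j).
have HP' n j : w j * N j (P j - taylor (x n) 0 j) <= 2 * wrad n * wrad n ^+ j.
  rewrite (bs_distC (B j)) //; have [_ /(_ n)] := HP j.
  rewrite -(ler_pM2l (wp j)) => /le_trans; apply.
  rewrite le_eqVlt; apply/orP; left; apply/eqP; rewrite -/(wrad n); field.
  by rewrite gt_eqF.
have rP : rapid Theta k P.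
  move=> rho rho0; have [n Hn] := wrad_small rho0.
  have [c c0 Hc] := bnd_ex (x n) n; exists (2 * wrad n + c) => j.
  apply: (@le_trans _ _ ((2 * wrad n + c) * wrad n ^+ j)); last first.
    by rewrite ler_wpM2l ?lerXn2r ?nnegrE ?(ltW rho0) // addr_ge0 ?(ltW c0) // mulr_ge0.
  rewrite mulrDl; apply: le_trans (lerD (HP' n j) (Hc j)).
  rewrite -mulrDr ler_wpM2l ?exp_weight_ge0 //.
  rewrite -{1}(subrK (taylor (x n) 0 j) (P j)); apply: (bs_normD (B j)) => //.
  exact: (bs_sub (B j)).
have [l [lP _ _]] := Exp_synthesis hk SP rP.
by exists l => s j; rewrite taylor_ExpB lP.
Qed.

End ExpTopology.

(** * Exponentials of functionals *)

Section Dual.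
Variables (R : realType) (E : completeNormedModType R[i]).
Local Notation C := R[i]^o.
Implicit Types (phi psi : E -> C).

Lemma top_dual_lin phi psi (c : C) : top_dual phi -> top_dual psi ->
  top_dual (phi + (c : R[i]) *: psi).
Proof.
move=> [l1 c1] [l2 c2]; split=> [a u v|x].
  rewrite !fctE (l1 a u v) (l2 a u v) scalerDr !scalerDr addrACA; congr (_ + _).
  by congr (_ + _); rewrite !scalerA mulrC.
by apply: cvgD; [exact: c1|apply: cvgZr; exact: c2].
Qed.

Lemma top_dual0 : top_dual (0 : E -> C).
Proof.
split=> [a u v|]; first by rewrite /= scaler0 addr0.
exact: cst_continuous.
Qed.

Lemma top_dualZ phi (c : C) : top_dual phi -> top_dual ((c : R[i]) *: phi).
Proof. by move=> d; rewrite -[_ *: _]add0r; exact: (top_dual_lin c top_dual0 d). Qed.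

Lemma dual_at0 phi : top_dual phi -> phi 0 = 0.
Proof. by move=> [l _]; have := l (-1) 0 0; rewrite scaler0 addr0 => ->; rewrite scaleN1r addNr. Qed.

Lemma dual_scale phi (c : C) x : top_dual phi -> phi ((c : R[i]) *: x) = c * phi x.
Proof.
move=> dphi; have [l _] := dphi.
by have := l c x 0; rewrite addr0 (dual_at0 dphi) addr0.
Qed.

Lemma dual_add phi x y : top_dual phi -> phi (x + y) = phi x + phi y.
Proof. by move=> [l _]; have := l 1 x y; rewrite !scale1r. Qed.

Let ball_img phi := [set rnorm (phi x) | x in [set x : E | rnorm x <= 1]].

Lemma dual_has_sup phi : top_dual phi -> has_sup (ball_img phi).
Proof.
move=> dphi; split.
  by exists (rnorm (phi 0)), 0 => //=; rewrite rnorm0.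
have [_ /(_ 0)] := dphi.
move=> /cvgrPdist_lt/(_ 1 ltr01)/nbhs_ballP[d d0 Hd].
have dE : d = (complex.Re d)%:C%C by rewrite RRe_real // gtr0_real.
set e := complex.Re d in dE; have e0 : 0 < e by rewrite -ltcR -dE.
exists (2 / e) => _ [x /= x1 <-].
have h : rnorm (phi ((((e / 2)%:C%C : C) : R[i]) *: x)) < 1.
  have := Hd ((((e / 2)%:C%C : C) : R[i]) *: x).
  rewrite (dual_at0 dphi) /= -ball_normE /= !sub0r !normrN dE !rnormE ltcR => H.
  rewrite -ltcR; apply: H; rewrite rnormZ rnorm_real ?divr_ge0 ?(ltW e0) //.
  apply: (@le_lt_trans _ _ (e / 2)); first by rewrite ler_piMr // divr_ge0 // ltW.
  by rewrite ltr_pdivrMr // ltr_pMr // ltr1n.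
move: h; rewrite dual_scale // rnormM rnorm_real ?divr_ge0 ?(ltW e0) // => /ltW.
by rewrite mulrC -ler_pdivlMr ?divr_gt0 // invf_div mul1r.
Qed.

Lemma dual_le phi x : top_dual phi -> rnorm x <= 1 -> rnorm (phi x) <= dual_norm phi.
Proof.
by move=> dphi x1; apply: ub_le_sup; [case: (dual_has_sup dphi)|exists x].
Qed.

Lemma dual_ge0 phi : top_dual phi -> 0 <= dual_norm phi.
Proof.
move=> dphi; apply: (@le_trans _ _ (rnorm (phi 0))); first exact: rnorm_ge0.
by apply: dual_le => //; rewrite rnorm0.
Qed.

Lemma dual_norm_lin phi psi (c : C) : top_dual phi -> top_dual psi ->
  dual_norm (phi + (c : R[i]) *: psi) <= dual_norm phi + rnorm c * dual_norm psi.
Proof.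
move=> d1 d2; apply: ge_sup.
  by exists (rnorm ((phi + (c : R[i]) *: psi) 0)), 0 => //=; rewrite rnorm0.
move=> _ [x /= x1 <-]; apply: le_trans (rnormD _ _) _.
by rewrite rnormZ lerD ?dual_le // ler_wpM2l ?rnorm_ge0 // dual_le.
Qed.

End Dual.

Section Exponentials.
Variables (R : realType) (E : completeNormedModType R[i]) (Theta : holomorphy_type E).
Variable (k : \bar R).
Hypothesis hk : (1 < k)%E.
Hypothesis hT : pi1_holomorphy_type Theta.
Local Notation C := R[i]^o.
Local Notation S := (ht_space Theta).
Local Notation N := (ht_norm Theta).
Local Notation w := (@exp_weight R k).
Local Notation X := (Exp Theta k).
Implicit Types (phi psi : E -> C).
Hint Resolve Exp_entire Exp_coef_in wrad_gt0 wrad_ge0 : core.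
Let B j := ht_banach Theta j.

Definition Exp_of_coefs (P : nat -> E -> C) : X := xget 0 [set f : X | forall j, taylor f 0 j = P j].

Lemma taylor_Exp_of_coefs P j : (forall i, S i (P i)) -> rapid Theta k P -> taylor (Exp_of_coefs P) 0 j = P j.
Proof.
move=> SP rP; have [f [fP _ _]] := Exp_synthesis hk SP rP.
by rewrite /Exp_of_coefs; case: xgetP => [g _ gP|/(_ f)//]; exact: gP.
Qed.

Lemma power_in phi (c : C) j : top_dual phi -> S j (fun x => c * phi x ^+ j).
Proof.
move=> dphi; apply: (pi1_sub hT); exists 1%N, (fun=> c), (fun=> phi); split=> //.
by apply/funext => x; rewrite big_ord1.
Qed.

(** The j-homogeneous part of psi^n e^phi / n!. *)
Definition mixed_power phi psi n j : E -> C :=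
  fun x => (j`!%:R)^-1 * ('C(j, n)%:R * phi x ^+ (j - n) * psi x ^+ n).

Lemma mixed_power_gt phi psi n j : (j < n)%N -> mixed_power phi psi n j = 0.
Proof. by move=> jn; apply/funext => x; rewrite /mixed_power bin_small // !mul0r mulr0. Qed.

Lemma mixed_power_sum phi psi j (t : C) x :
  (j`!%:R)^-1 * (phi + (t : R[i]) *: psi) x ^+ j =
  \sum_(n < j.+1) t ^+ n * mixed_power phi psi n j x.
Proof.
rewrite !fctE exprDn mulr_sumr; apply: eq_bigr => n _.
rewrite -[t *: psi x]/(t * psi x) exprMn /mixed_power -mulr_natl; ring.
Qed.

(** Up to the factor 1/j!, the mixed power is the coefficient of t^n in
(phi + t psi)^j; as an average of the powers (phi + w psi)^j with |w| = 1 it is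
of finite type, and its norm is controlled by the bound on powers. *)
Lemma mixed_power_bound : exists2 K : R, 0 < K & forall phi psi n j,
  top_dual phi -> top_dual psi -> S j (mixed_power phi psi n j) /\
  N j (mixed_power phi psi n j) <= (K * (dual_norm phi + dual_norm psi)) ^+ j / j`!%:R.
Proof.
have [K K0 HK] := pi1_bound hT; exists K => // phi psi n j d1 d2.
have D0 : 0 <= K * (dual_norm phi + dual_norm psi).
  by rewrite mulr_ge0 ?(ltW K0) // addr_ge0 // dual_ge0.
case: (ltnP j n) => [jn|nj].
  rewrite mixed_power_gt // (bs_norm0 (B j)); split; first exact: (bs_zero (B j)).
  by rewrite divr_ge0 // exprn_ge0.
have [z [a [z1 aN H]]] := @node_extract R j.+1 (ltn0Sn j).
have nj' : (n < j.+1)%N by rewrite ltnS.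
pose g i : E -> C := fun x => (j`!%:R)^-1 * (phi + (z i : R[i]) *: psi) x ^+ j.
have dg i : top_dual (phi + (z i : R[i]) *: psi) by exact: top_dual_lin.
have Sg i : S j (g i) by apply: (power_in _ _ (dg i)).
have mE : mixed_power phi psi n j = \sum_(i < j.+1) (a n i : R[i]) *: g i.
  rewrite (H _ (fun m => mixed_power phi psi m j) n nj'); apply: eq_bigr => i _.
  congr (_ *: _); apply/funext => x; rewrite /g mixed_power_sum fct_sumE.
  by apply: eq_bigr => m _; rewrite fctE.
rewrite mE; split; first by apply: (bs_sum (B j)) => i _; exact: (bs_scale (B j)).
apply: le_trans (bs_norm_sum (B j) _ _) _ => [i _|]; first exact: (bs_scale (B j)).
apply: (@le_trans _ _ (\sum_(i < j.+1) j.+1%:R^-1 *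
   ((K * (dual_norm phi + dual_norm psi)) ^+ j / j`!%:R))); last first.
  by rewrite sumr_const card_ord -[leLHS]mulr_natl mulrA mulfV ?mul1r // pnatr_eq0.
apply: ler_sum => i _; rewrite (bs_normZ (B j)) // aN ler_wpM2l ?invr_ge0 //.
apply: le_trans (HK _ _ j (dg i)) _.
rewrite rnormV rnorm_nat ler_wpM2r ?invr_ge0 // exprMn ler_wpM2l ?exprn_ge0 ?(ltW K0) //.
apply: lerXn2r; rewrite ?nnegrE; [exact: dual_ge0 (dg i)|by apply: addr_ge0; exact: dual_ge0|].
by apply: le_trans (dual_norm_lin _ d1 d2) _; rewrite z1 mul1r.
Qed.

Lemma mixed_power_in phi psi n j : top_dual phi -> top_dual psi -> S j (mixed_power phi psi n j).
Proof. by move=> d1 d2; have [K _ H] := mixed_power_bound; have [] := H phi psi n j d1 d2. Qed.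

Lemma mixed_power_scale phi psi n j (t : C) : mixed_power phi ((t : R[i]) *: psi) n j = (t ^+ n : R[i]) *: mixed_power phi psi n j.
Proof.
apply/funext => x; rewrite /mixed_power !fctE -![_ *: _]/(_ * _) exprMn; ring.
Qed.

(** Replacing psi by s psi multiplies the mixed power by s^n, hence the gain
s^-n. *)
Lemma mixed_power_rapid_bound (b : R) (rho : R) : 0 <= b -> 0 < rho -> exists2 G : R, 0 <= G &
  forall phi psi (s : R) n j, top_dual phi -> top_dual psi -> 0 < s ->
  dual_norm phi + s * dual_norm psi <= b ->
  w j * N j (mixed_power phi psi n j) <= G * s ^- n * rho ^+ j.
Proof.
move=> b0 rho0; have [K K0 HK] := mixed_power_bound.
have b1 : 0 < K * b + 1 by rewrite ltr_wpDl // mulr_ge0 // ltW.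
have [G G0 HG] := exp_weight_upper hk (divr_gt0 rho0 b1).
exists G => // phi psi s n j d1 d2 s0 sb.
have ds := top_dualZ s%:C%C d2.
have sn0 : (s%:C%C ^+ n : R[i]) != 0 by rewrite expf_neq0 // gt_eqF // ltcR.
have sn : 0 < s ^+ n by rewrite exprn_gt0.
have -> : mixed_power phi psi n j = ((s%:C%C ^+ n)^-1 : R[i]) *: mixed_power phi ((s%:C%C : R[i]) *: psi) n j.
  by rewrite mixed_power_scale scalerA mulVf // scale1r.
have [Sm Nm] := HK phi _ n j d1 ds.
rewrite (bs_normZ (B j)) // rnormV rnormX rnorm_real ?(ltW s0) //.
rewrite mulrCA [G * _]mulrC -mulrA ler_wpM2l ?invr_ge0 ?(ltW sn) //.
apply: le_trans (ler_wpM2l (exp_weight_ge0 k j) Nm) _.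
rewrite mulrCA mulrC; apply: le_trans (ler_wpM2r _ (HG j)) _.
  by rewrite exprn_ge0 // mulr_ge0 ?(ltW K0) // addr_ge0 // dual_ge0.
rewrite -mulrA ler_wpM2l // -exprMn lerXn2r ?nnegrE ?(ltW rho0) //.
  by rewrite mulr_ge0 ?divr_ge0 ?mulr_ge0 ?(ltW K0) ?(ltW b1) ?(ltW rho0) // addr_ge0 // dual_ge0.
rewrite mulrAC ler_pdivrMr // ler_wpM2l ?(ltW rho0) //.
apply: (@le_trans _ _ (K * b)); last by rewrite lerDl.
rewrite ler_wpM2l ?(ltW K0) //; apply: le_trans sb; rewrite lerD2l.
have := dual_norm_lin (s%:C%C) (@top_dual0 R E) d2.
rewrite add0r rnorm_real ?(ltW s0) // => /le_trans; apply.
rewrite gerDr; apply: ge_sup.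
  by exists (rnorm (0 : C)), 0 => //=; rewrite rnorm0.
by move=> _ [x _ <-]; rewrite rnorm0.
Qed.

Lemma mixed_power_rapid phi psi n : top_dual phi -> top_dual psi -> rapid Theta k (mixed_power phi psi n).
Proof.
move=> d1 d2 rho rho0.
have b0 : 0 <= dual_norm phi + 1 * dual_norm psi by rewrite mul1r addr_ge0 // dual_ge0.
have [G G0 HG] := mixed_power_rapid_bound b0 rho0.
by exists (G * 1 ^- n) => j; exact: HG.
Qed.

(** psi^n e^phi / n!. *)
Definition mixed_exp phi psi n : X := Exp_of_coefs (mixed_power phi psi n).
Definition exponential phi : X := mixed_exp phi 0 0.

Lemma taylor_mixed_exp phi psi n j : top_dual phi -> top_dual psi ->
  taylor (mixed_exp phi psi n) 0 j = mixed_power phi psi n j.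
Proof.
move=> d1 d2; apply: taylor_Exp_of_coefs; last exact: mixed_power_rapid.
by move=> i; exact: mixed_power_in.
Qed.

Lemma taylor_exponential phi j : top_dual phi ->
  taylor (exponential phi) 0 j = (fun x => (j`!%:R)^-1 * phi x ^+ j).
Proof.
move=> d1; rewrite (taylor_mixed_exp _ _ d1 (@top_dual0 R E)).
by apply/funext => x; rewrite /mixed_power bin0 subn0 expr0 mulr1 mul1r.
Qed.

(** For n = 0 the factor psi^n reduces to 1 by computation. *)
Lemma mixed_exp0 phi psi : mixed_exp phi psi 0 = exponential phi.
Proof. by []. Qed.

Lemma mixed_exp_scale phi psi n (t : C) : top_dual phi -> top_dual psi ->
  mixed_exp phi ((t : R[i]) *: psi) n = (t ^+ n : R[i]) *: mixed_exp phi psi n.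
Proof.
move=> d1 d2; apply: Exp_ext => j; apply: etrans (taylor_mixed_exp n j d1 (top_dualZ t d2)) _.
by rewrite mixed_power_scale -(taylor_mixed_exp n j d1 d2) taylor_ExpZ.
Qed.

(** The expansion e^(phi + psi) = sum of psi^n e^phi / n!, with a remainder that is
O(s^-n) as soon as s |psi| is bounded; used with psi replaced by t psi, it is a
convergent power series in t with coefficients in the space. *)
Lemma exp_expand (b : R) (m : nat) : 0 <= b -> exists2 G : R, 0 <= G &
  forall phi psi (s : R) n, top_dual phi -> top_dual psi -> 2 <= s ->
  dual_norm phi + s * dual_norm psi <= b ->
  bnd (exponential (phi + psi) - \sum_(i < n) mixed_exp phi psi i) m (2 * G * s ^- n).
Proof.
move=> b0; have [G G0 HG] := mixed_power_rapid_bound b0 (wrad_gt0 R m).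
exists G => // phi psi s n d1 d2 s2 sb j.
have s0 : 0 < s by exact: lt_le_trans s2.
have d12 : top_dual (phi + psi) by rewrite -[psi]scale1r; exact: top_dual_lin.
rewrite taylor_ExpB taylor_Exp_sum (taylor_exponential _ d12).
under eq_bigr do rewrite (taylor_mixed_exp _ _ d1 d2).
pose L := maxn n j.+1.
have -> : (fun x => (j`!%:R)^-1 * (phi + psi) x ^+ j) = \sum_(i < L) mixed_power phi psi i j.
  apply/funext => x; have := mixed_power_sum phi psi j 1 x; rewrite scale1r => ->.
  rewrite fct_sumE (big_ord_ltn_split (fun i => mixed_power phi psi i j x) (leq_maxr n j.+1)).
  rewrite [X in _ = _ + X]big_nat_cond [X in _ = _ + X]big1 ?addr0.
    by apply: eq_bigr => i _; rewrite expr1n mul1r.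
  by move=> i /andP[/andP[ji _] _]; rewrite mixed_power_gt.
rewrite (big_ord_ltn_split (fun i => mixed_power phi psi i j) (leq_maxl n j.+1)) addrAC subrr add0r.
apply: (@le_trans _ _ (\sum_(n <= i < L) w j * N j (mixed_power phi psi i j))).
  rewrite -mulr_sumr ler_wpM2l ?exp_weight_ge0 //.
  by apply: (bs_norm_sum (B j)) => i _; exact: mixed_power_in.
apply: (@le_trans _ _ (\sum_(n <= i < L) G * s ^- i * wrad R m ^+ j)).
  by apply: ler_sum => i _; exact: HG.
rewrite -mulr_suml -mulr_sumr ler_wpM2r ?exprn_ge0 //.
rewrite [2 * G]mulrC -mulrA ler_wpM2l //.
apply: (@le_trans _ _ (\sum_(n <= i < L) s ^- n * 2^-1 ^+ (i - n))).
  rewrite !big_nat; apply: ler_sum => i /andP[ni _].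
  rewrite -{1}(subnKC ni) exprD invfM ler_wpM2l ?invr_ge0 ?exprn_ge0 ?(ltW s0) //.
  by rewrite -!exprVn lerXn2r ?nnegrE ?invr_ge0 ?(ltW s0) // lef_pV2 ?posrE.
rewrite -mulr_sumr mulrC ler_wpM2r ?invr_ge0 ?exprn_ge0 ?(ltW s0) //.
rewrite -{1}(add0n n) big_addn; under eq_bigr do rewrite addnK.
by apply: le_trans (sum_half_range_le _ _ _) _; rewrite expr0 mulr1.
Qed.

Lemma exponential_cont phi n (e : R) : top_dual phi -> 0 < e -> exists2 d : R, 0 < d &
  forall eta, top_dual eta -> dual_norm eta < d -> bnd (exponential (phi + eta) - exponential phi) n e.
Proof.
move=> d1 e0; have b0 : 0 <= dual_norm phi + 1 by rewrite addr_ge0 // dual_ge0.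
have [G G0 HG] := exp_expand n b0.
pose s := 2 + 2 * G / e; have s2 : 2 <= s by rewrite /s lerDl divr_ge0 ?mulr_ge0 // ltW.
have s0 : 0 < s by exact: lt_le_trans s2.
exists s^-1; first by rewrite invr_gt0.
move=> eta de etad; have := HG phi eta s 1%N d1 de s2.
rewrite big_ord1 mixed_exp0 => H.
apply: (@bnd_le _ _ _ _ _ _ (2 * G * s ^- 1)); last first.
  apply: H; rewrite lerD2l mulrC -ler_pdivlMr //; by rewrite div1r ltW.
rewrite expr1 ler_pdivrMr // /s mulrDr [e * (_ / _)]mulrC divfK ?gt_eqF //.
by rewrite lerDr mulr_ge0 // ltW.
Qed.

(** The derivative of e^phi in the direction y is phi(y) e^phi, read off from the
derivatives of the powers phi^j / j!. *)
Lemma taylor_exponential1 phi x y : top_dual phi -> taylor (exponential phi) x 1 y = phi y * exponential phi x.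
Proof.
move=> d1; have [fx ft] := Exp_series hk (exponential phi).
pose Q j m : E -> C := fun y => (j`!%:R)^-1 * ('C(j, m)%:R * phi x ^+ (j - m)) * phi y ^+ m.
have T j m : taylor (taylor (exponential phi) 0 j) x m = Q j m.
  have h : taylor_at (taylor (exponential phi) 0 j) x (Q j).
    rewrite (taylor_exponential _ d1); apply: (@taylor_at_finite _ _ _ _ _ j.+1).
    - by move=> i; apply: (@ht_hpoly _ _ Theta); exact: power_in.
    - by move=> i ji; apply/funext => z; rewrite /Q bin_small // mul0r mulr0 mul0r.
    move=> z; rewrite (dual_add _ _ d1) exprDn mulr_sumr; apply: eq_bigr => i _.
    by rewrite /Q -mulr_natl; ring.
  by rewrite (taylorE h).
have := ft x 1%N y; rewrite -(cvg_shiftS (fun n => \sum_(j < n) taylor (taylor (exponential phi) 0 j) x 1 y)).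
move=> h; apply: (cvg_unique _ h); first exact: norm_hausdorff.
rewrite (_ : (fun n => _) = (fun n => phi y * \sum_(j < n) taylor (exponential phi) 0 j x)).
  by apply: cvgMr; exact: fx.
apply/funext => n; rewrite big_ord_recl T /Q bin0n /= mul0r mulr0 mul0r add0r mulr_sumr.
apply: eq_bigr => j _; rewrite T (taylor_exponential _ d1) /Q /bump /= add1n bin1 subn1 /= expr1 factS natrM.
have j0 : (j.+1%:R : C) != 0 by rewrite pnatr_eq0.
have f0 : (j`!%:R : C) != 0 by rewrite pnatr_eq0 -lt0n fact_gt0.
move: (j.+1%:R : C) (j`!%:R : C) j0 f0 => a b a0 b0.
by field; rewrite a0 b0.
Qed.

End Exponentials.

(** * Density of the exponentials *)

Section Density.
Variables (R : realType) (E : completeNormedModType R[i]) (Theta : holomorphy_type E).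
Variable (k : \bar R).
Hypothesis hk : (1 < k)%E.
Hypothesis hT : pi1_holomorphy_type Theta.
Local Notation C := R[i]^o.
Local Notation S := (ht_space Theta).
Local Notation N := (ht_norm Theta).
Local Notation w := (@exp_weight R k).
Local Notation X := (Exp Theta k).
Local Notation exponential := (@exponential R E Theta k).
Local Notation mixed_exp := (@mixed_exp R E Theta k).
Implicit Types (phi psi : E -> C) (M : set X).
Hint Resolve Exp_entire Exp_coef_in wrad_gt0 wrad_ge0 : core.
Let B j := ht_banach Theta j.

Record closed_subspace M : Prop := ClosedSubspace {
  cs_zero : M 0;
  cs_lin : forall (a : C) f g, M f -> M g -> M ((a : R[i]) *: f + g);
  cs_closed : forall f, (forall n (e : R), 0 < e -> exists2 g, M g & bnd (f - g) n e) -> M f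
}.

Lemma cs_scale M (a : C) f : closed_subspace M -> M f -> M ((a : R[i]) *: f).
Proof. by move=> cM Mf; rewrite -[_ *: f]addr0; apply: (cs_lin cM) => //; exact: cs_zero. Qed.

Lemma cs_add M f g : closed_subspace M -> M f -> M g -> M (f + g).
Proof. by move=> cM Mf Mg; rewrite -[f]scale1r; exact: cs_lin. Qed.

Lemma cs_sub M f g : closed_subspace M -> M f -> M g -> M (f - g).
Proof. by move=> cM Mf Mg; rewrite addrC -scaleN1r; exact: cs_lin. Qed.

Lemma cs_sum M (I : Type) (r : seq I) (F : I -> X) : closed_subspace M ->
  (forall i, M (F i)) -> M (\sum_(i <- r) F i).
Proof.
move=> cM H; elim: r => [|i r IH]; first by rewrite big_nil; exact: cs_zero.
by rewrite big_cons; exact: cs_add.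
Qed.

(** Differentiation inside M: if M contains psi^i e^phi / i! for i < m, then it
contains t^-m (e^(phi + t psi) - sum_(i < m) t^i psi^i e^phi / i!), which tends
to psi^m e^phi / m! as t --> 0. *)
Lemma cs_mixed_exp M phi psi (d : R) : closed_subspace M -> top_dual phi -> top_dual psi ->
  0 < d -> (forall t : C, rnorm t <= d -> M (exponential (phi + (t : R[i]) *: psi))) ->
  forall m, M (mixed_exp phi psi m).
Proof.
move=> cM d1 d2 d0 HM; elim/ltn_ind => m IH; apply: (cs_closed cM) => n e e0.
have b0 : 0 <= dual_norm phi + 2 * dual_norm psi.
  by apply: addr_ge0; [exact: dual_ge0|apply: mulr_ge0 => //; exact: dual_ge0].
have [G G0 HG] := exp_expand hk hT n b0.
(* t <= 1 allows s = 2 / t >= 2 in the expansion with t psi, for which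
   s |t psi| = 2 |psi| does not depend on t. *)
pose t := Num.min (Num.min d 1) (e / (2 * G + 1)).
have G1 : 0 < 2 * G + 1 by rewrite ltr_wpDl // mulr_ge0.
have t0 : 0 < t by rewrite !lt_min d0 ltr01 divr_gt0.
have [td t1 te] : [/\ t <= d, t <= 1 & t <= e / (2 * G + 1)].
  by split; rewrite /t !ge_min lexx ?orbT.
pose tc : C := t%:C%C; have tcE : rnorm tc = t by rewrite rnorm_real // ltW.
have tc0 : tc != 0 by rewrite gt_eqF // ltcR.
have tm0 : (tc ^+ m : R[i]) != 0 by rewrite expf_neq0.
pose Sm := \sum_(i < m) (tc ^+ i : R[i]) *: mixed_exp phi psi i.
pose rest := exponential (phi + (tc : R[i]) *: psi) - (Sm + (tc ^+ m : R[i]) *: mixed_exp phi psi m).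
have restb : bnd rest n (2 * G * t ^+ m.+1).
  have d2' := top_dualZ tc d2.
  have s2 : 2 <= 2 / t by rewrite ler_pdivlMr // ler_piMr.
  have := HG phi _ (2 / t) m.+1 d1 d2' s2.
  have -> : \sum_(i < m.+1) mixed_exp phi ((tc : R[i]) *: psi) i =
      Sm + (tc ^+ m : R[i]) *: mixed_exp phi psi m.
    rewrite big_ord_recr /= (mixed_exp_scale hk hT _ _ d1 d2); congr (_ + _).
    by apply: eq_bigr => i _; rewrite (mixed_exp_scale hk hT _ _ d1 d2).
  move=> H; apply: (@bnd_le _ _ _ _ _ _ (2 * G * (2 / t) ^- m.+1)); last first.
    apply: H; rewrite lerD2l.
    have h := dual_norm_lin tc (@top_dual0 R E) d2; rewrite add0r tcE in h.
    have h0 : dual_norm (0 : E -> C) = 0.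
      rewrite /dual_norm (_ : [set _ | _ in _] = [set 0]) ?sup1 //.
      apply/seteqP; split=> [_ [x _ <-]|_ ->]; first by rewrite rnorm0.
      by exists 0; rewrite /= rnorm0.
    rewrite h0 add0r in h; apply: le_trans (ler_wpM2l _ h) _; first by rewrite divr_ge0 // ltW.
    by rewrite mulrA divfK // gt_eqF.
  rewrite ler_wpM2l ?mulr_ge0 // -exprVn invf_div lerXn2r ?nnegrE ?divr_ge0 ?(ltW t0) //.
  by rewrite ler_pdivrMr // ler_peMr ?(ltW t0) // ler1n.
exists ((tc ^+ m : R[i])^-1 *: (exponential (phi + (tc : R[i]) *: psi) - Sm)).
  apply: (cs_scale _ cM); apply: (cs_sub cM); first by apply: HM; rewrite tcE.
  by apply: (cs_sum _ cM) => i; apply: (cs_scale _ cM); apply: IH.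
apply: bnd_distC.
have -> : (tc ^+ m : R[i])^-1 *: (exponential (phi + (tc : R[i]) *: psi) - Sm) - mixed_exp phi psi m =
    (tc ^+ m : R[i])^-1 *: rest.
  rewrite /rest opprD addrA [RHS]scalerBr; congr (_ - _).
  by rewrite scalerA mulVf // scale1r.
apply: bnd_le (bndZ ((tc ^+ m : R[i])^-1) restb).
rewrite rnormV rnormX tcE exprSr [t ^+ m * t]mulrC.
rewrite (_ : (t ^+ m)^-1 * (2 * G * (t * t ^+ m)) = 2 * G * t); last first.
  by field; rewrite expf_neq0 // gt_eqF.
apply: (@le_trans _ _ (2 * G * (e / (2 * G + 1)))); first by rewrite ler_wpM2l // mulr_ge0.
by rewrite mulrCA ler_piMr ?(ltW e0) // ler_pdivrMr // mul1r lerDl.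
Qed.

Lemma cs_exponential M phi psi : closed_subspace M -> top_dual phi -> top_dual psi ->
  (forall m, M (mixed_exp phi psi m)) -> M (exponential (phi + psi)).
Proof.
move=> cM d1 d2 HM; apply: (cs_closed cM) => n e e0.
have b0 : 0 <= dual_norm phi + 2 * dual_norm psi.
  by apply: addr_ge0; [exact: dual_ge0|apply: mulr_ge0 => //; exact: dual_ge0].
have [G G0 HG] := exp_expand hk hT n b0.
have [m Hm] := half_expr_small (2 * G) e0.
exists (\sum_(i < m) mixed_exp phi psi i); first exact: cs_sum.
apply: bnd_le (HG phi psi 2 m d1 d2 (lexx 2) (lexx _)).
by rewrite -exprVn ltW // Hm.
Qed.

Definition Exp_hpoly (P : E -> C) j : X := Exp_of_coefs Theta k (fun i => if i == j then P else 0).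

Lemma taylor_Exp_hpoly P j i : S j P -> taylor (Exp_hpoly P j) 0 i = if i == j then P else 0.
Proof.
move=> SP; have Si i' : S i' (if i' == j then P else 0).
  by case: eqP => [->//|_]; exact: (bs_zero (B i')).
apply: (taylor_Exp_of_coefs hk _ Si) => rho rho0; exists (w j * N j P / rho ^+ j) => i'.
case: eqP => [->|_]; first by rewrite divfK // expf_neq0 // gt_eqF.
rewrite (bs_norm0 (B i')) mulr0 mulr_ge0 ?exprn_ge0 ?(ltW rho0) //.
by rewrite divr_ge0 ?exprn_ge0 ?(ltW rho0) // mulr_ge0 ?exp_weight_ge0 // (bs_norm_ge0 (B j)).
Qed.

Lemma bnd_Exp_hpoly P j n : S j P -> bnd (Exp_hpoly P j) n (w j * N j P / wrad R n ^+ j).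
Proof.
move=> SP i; rewrite taylor_Exp_hpoly //; case: eqP => [->|_].
  by rewrite divfK // expf_neq0 // gt_eqF ?wrad_gt0.
rewrite (bs_norm0 (B i)) mulr0 mulr_ge0 ?exprn_ge0 //.
by rewrite divr_ge0 ?exprn_ge0 // mulr_ge0 ?exp_weight_ge0 // (bs_norm_ge0 (B j)).
Qed.

(** At phi = 0 the element psi^m e^phi / m! is psi^m / m!, so M contains the
powers of functionals, hence the finite type polynomials, hence by density all
homogeneous polynomials of the type, hence the partial sums of every series. *)
Lemma cs_full M : closed_subspace M -> (forall phi, top_dual phi -> M (exponential phi)) ->
  forall f, M f.
Proof.
move=> cM HM.
have M1 phi j : top_dual phi -> M (Exp_hpoly (fun x => phi x ^+ j) j).
  move=> d1; have Sp : S j (fun x => phi x ^+ j).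
    have := power_in hT 1 j d1; congr (S j _).
    by apply/funext => x; rewrite mul1r.
  have -> : Exp_hpoly (fun x => phi x ^+ j) j = (j`!%:R : R[i]) *: mixed_exp 0 phi j.
    apply: Exp_ext => i; rewrite taylor_Exp_hpoly // taylor_ExpZ.
    rewrite (taylor_mixed_exp hk hT _ _ (@top_dual0 R E) d1).
    apply/funext => x; rewrite fctE /mixed_power.
    case: eqP => [->|/eqP ij].
      have f0 : (j`!%:R : R[i]) != 0 by rewrite pnatr_eq0 -lt0n fact_gt0.
      by rewrite binn subnn expr0 !mul1r -[_ *: _]/(_ * _) mulVKf.
    case: (ltnP i j) => [lt|le]; first by rewrite bin_small // !mul0r mulr0 scaler0.
    have ltij : (j < i)%N by rewrite ltn_neqAle eq_sym ij.
    have -> : (0 : E -> C) x ^+ (i - j) = 0 by rewrite (_ : (0 : E -> C) x = 0) // expr0n subn_eq0 leqNgt ltij.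
    by rewrite mulr0 mul0r mulr0 scaler0.
  apply: (cs_scale _ cM); apply: (cs_mixed_exp cM (@top_dual0 R E) d1 ltr01) => t _.
  by rewrite add0r; apply: HM; exact: top_dualZ.
have M2 P j : finite_type_poly j P -> M (Exp_hpoly P j).
  move=> fP; have SP := pi1_sub hT fP.
  case: fP => n [c [phi [dphi PE]]].
  have Sp i : S j (fun x => phi i x ^+ j).
    have := power_in hT 1 j (dphi i); congr (S j _).
    by apply/funext => x; rewrite mul1r.
  have -> : Exp_hpoly P j = \sum_(i < n) (c i : R[i]) *: Exp_hpoly (fun x => phi i x ^+ j) j.
    apply: Exp_ext => i; rewrite taylor_Exp_hpoly // taylor_Exp_sum.
    under eq_bigr do rewrite taylor_ExpZ taylor_Exp_hpoly //.
    case: eqP => _; last by rewrite big1 // => i' _; rewrite scaler0.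
    rewrite PE; apply/funext => x; rewrite fct_sumE.
    by apply: eq_bigr => i' _; rewrite fctE.
  by apply: (cs_sum _ cM) => i; apply: (cs_scale _ cM); exact: M1 (dphi i).
have M3 P j : S j P -> M (Exp_hpoly P j).
  move=> SP; apply: (cs_closed cM) => n e e0.
  have w1 : 0 < w j + 1 by rewrite ltr_wpDl // exp_weight_ge0.
  have r0 : 0 < wrad R n ^+ j by rewrite exprn_gt0 ?wrad_gt0.
  have er0 : 0 < e * wrad R n ^+ j / (w j + 1).
    by apply: divr_gt0 => //; apply: mulr_gt0.
  have [Q fQ NQ] := pi1_dense hT SP er0.
  have SQ := pi1_sub hT fQ.
  exists (Exp_hpoly Q j); first exact: M2.
  have -> : Exp_hpoly P j - Exp_hpoly Q j = Exp_hpoly (P - Q) j.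
    apply: Exp_ext => i; rewrite taylor_ExpB !taylor_Exp_hpoly //; last exact: (bs_sub (B j)).
    by case: eqP => // _; rewrite subr0.
  apply: bnd_le (bnd_Exp_hpoly n (bs_sub (B j) SP SQ)).
  rewrite ler_pdivrMr //; move/ltW: NQ; rewrite ler_pdivlMr // mulrC; apply: le_trans.
  by rewrite ler_wpM2r ?(bs_norm_ge0 (B j)) ?lerDl //; exact: (bs_sub (B j)).
move=> f; apply: (cs_closed cM) => n e e0.
have [c c0 Hc] := bnd_ex f n.+1; have [m Hm] := half_expr_small c e0.
exists (\sum_(j < m) Exp_hpoly (taylor f 0 j) j).
  by apply: (cs_sum _ cM) => i; exact: M3.
move=> j; rewrite taylor_ExpB taylor_Exp_sum.
under eq_bigr do rewrite taylor_Exp_hpoly //.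
case: (ltnP j m) => [jm|mj].
  rewrite (bigD1 (Ordinal jm)) //= eqxx big1 ?addr0 ?subrr => [|i ij]; last first.
    by rewrite ifN // eq_sym; move: ij; rewrite -val_eqE.
  by rewrite (bs_norm0 (B j)) mulr0 mulr_ge0 ?exprn_ge0 // ltW.
rewrite big1 ?subr0 => [|i _]; last by rewrite ifN // gtn_eqF // (leq_trans _ mj).
apply: le_trans (Hc j) _; rewrite /wrad exprS exprMn mulrA ler_wpM2r ?exprn_ge0 //.
by rewrite ltW // Hm.
Qed.

Lemma cs_full_at M phi0 : closed_subspace M -> top_dual phi0 ->
  (forall psi, top_dual psi -> exists2 d : R, 0 < d &
     forall t : C, rnorm t <= d -> M (exponential (phi0 + (t : R[i]) *: psi))) ->
  forall f, M f.
Proof.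
move=> cM d0 H; apply: (cs_full cM) => phi d1.
have d2 : top_dual (phi - phi0) by rewrite -scaleN1r; exact: (top_dual_lin (-1) d1 d0).
have [d dp Hd] := H _ d2.
have -> : phi = phi0 + (phi - phi0) by rewrite addrC subrK.
exact: (cs_exponential cM d0 d2 (cs_mixed_exp cM d0 d2 dp Hd)).
Qed.

End Density.

(** * Exponentials are eigenvectors *)

Section Eigen.
Variables (R : realType) (E : completeNormedModType R[i]) (Theta : holomorphy_type E).
Variable (k : \bar R).
Hypothesis hk : (1 < k)%E.
Hypothesis hT : pi1_holomorphy_type Theta.
Local Notation C := R[i]^o.
Local Notation S := (ht_space Theta).
Local Notation X := (Exp Theta k).
Local Notation exponential := (@exponential R E Theta k).
Local Notation mixed_exp := (@mixed_exp R E Theta k).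
Implicit Types (phi psi : E -> C).

Lemma cvgC_ext (u v : nat -> C) (l : C) : (forall n, u n = v n) -> u @ \oo --> l -> v @ \oo --> l.
Proof. by move=> uv; rewrite (_ : u = v) //; apply/funext. Qed.

(** Both sides are the coefficient of s^m in P ((t + s) a) = (t + s)^j P a. *)
Lemma taylor_ray j (P : E -> C) (t : C) a m : hpoly j P ->
  taylor P ((t : R[i]) *: a) m a = 'C(j, m)%:R * t ^+ (j - m) * P a.
Proof.
move=> hP; set x := (t : R[i]) *: a; apply/eqP; rewrite -subr_eq0; apply/eqP.
pose c i : C := taylor P x i a - 'C(j, i)%:R * t ^+ (j - i) * P a.
apply: (@pser_zero_real _ c 1 ltr01) => s _ _.
apply/cvgC_lt => e e0; exists j.+1 => n jn.
rewrite (big_ord_ltn_split (fun i => (s%:C%C : C) ^+ i * c i) jn).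
have -> : \sum_(j.+1 <= i < n) (s%:C%C : C) ^+ i * c i = 0.
  rewrite big_nat_cond big1 // => i /andP[/andP[ji _] _].
  rewrite /c (hpoly_taylor_gt _ hP ji) bin_small // !mul0r.
  by rewrite subr0 mulr0.
rewrite addr0 subr0.
suff -> : \sum_(i < j.+1) (s%:C%C : C) ^+ i * c i = 0 by rewrite rnorm0.
under eq_bigr do rewrite /c mulrBr.
rewrite sumrB; apply/eqP; rewrite subr_eq0; apply/eqP.
transitivity (P (((t + s%:C%C : C) : R[i]) *: a)).
  rewrite scalerDl (hpoly_taylor_sum _ _ hP); apply: eq_bigr => i _.
  have ef : hpoly i (taylor P x i) by have [] := hpoly_taylor_at x hP.
  by rewrite (hpoly_hom _ _ ef).
rewrite (hpoly_hom _ _ hP) exprDn mulr_suml; apply: eq_bigr => i _.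
rewrite -mulr_natl; ring.
Qed.

Lemma taylor_degree0 (f : E -> C) x : entire f -> taylor f x 0 0 = f x.
Proof.
move=> ef; have [d d0] := taylor_line x 0 ef.
by move=> /(_ 0); rewrite rnorm0 scaler0 addr0 => /(_ d0)/pser0.
Qed.

Lemma dhat1 (f : E -> C) x : dhat 1 f x = taylor f x 1.
Proof. exact: scale1r. Qed.

Lemma Exp_coef0 (f : X) a : taylor f 0 0 a = f 0.
Proof.
have : S 0 (taylor f 0 0) by exact: Exp_coef_in.
rewrite ht_space0 => -[z zE].
by rewrite -(taylor_degree0 0 (Exp_entire f)) zE.
Qed.

Variable L : {linear X -> X}.
Hypothesis hL : convolution_operator L.

(** Continuity at 0 with bound 1, and homogeneity. *)
Lemma conv_bnd n : exists m (G : R), 0 < G /\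
  forall f (c : R), 0 < c -> bnd f m c -> bnd (L f) n (G * c).
Proof.
have [cL _] := hL.
have [V [oV V0 HV]] := bnd_open (L 0) n (@ltr01 R).
have oW : open (L @^-1` V) by apply: open_comp => // x _; exact: cL.
have [m [c0 [c00 Hm]]] := open_bnd oW V0.
exists m, (c0^-1); split; first by rewrite invr_gt0.
move=> f c cp fb; pose a : C := (c0 / c)%:C%C.
have ac : 0 < c0 / c by exact: divr_gt0.
have aE : rnorm a = c0 / c by rewrite rnorm_real // ltW.
have a0 : (a : R[i]) != 0 by rewrite gt_eqF // ltcR.
have : bnd (L ((a : R[i]) *: f) - L 0) n 1.
  apply: HV; apply: Hm; rewrite subr0; have := bndZ a fb; rewrite aE.
  by rewrite divfK // gt_eqF.
rewrite linear0 subr0 linearZ /= => H.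
have -> : L f = ((a : R[i])^-1) *: (a *: L f) by rewrite scalerA mulVf // scale1r.
by have := bndZ ((a : R[i])^-1) H; rewrite rnormV aE invf_div mulr1 mulrC.
Qed.

Lemma iter_bnd p n : exists m (G : R), 0 < G /\
  forall f (c : R), 0 < c -> bnd f m c -> bnd (iter p L f) n (G * c).
Proof.
elim: p => [|p [m [G [G0 HG]]]].
  by exists n, 1; split=> // f c _; rewrite mul1r.
have [m' [G' [G'0 HG']]] := conv_bnd m.
exists m', (G * G'); split; first exact: mulr_gt0.
move=> f c c0 fb; rewrite iterSr -mulrA; apply: HG; first exact: mulr_gt0.
exact: HG'.
Qed.

(** The eigenvalue of L at e^phi; this is the Borel transform of the functional
f |-> L f 0. *)
Definition symbol phi : C := L (exponential phi) 0.

(** By the commutation rule, g = L (e^phi) has derivative phi(a) g in every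
direction a. Along the line t |-> t a the derivative is the termwise derivative
of the power series of g (by [Exp_series] and [taylor_ray]), so the coefficients
P_j of g satisfy (j + 1) P_(j+1)(a) = phi(a) P_j(a). *)
Lemma conv_exponential phi : top_dual phi -> L (exponential phi) = (symbol phi : R[i]) *: exponential phi.
Proof.
move=> d1; set g := L (exponential phi).
have dg x a : taylor g x 1 a = phi a * g x.
  have [_ /(_ a (exponential phi) ((phi a : R[i]) *: exponential phi))] := hL.
  have h : ((phi a : R[i]) *: exponential phi : X) = ddir (exponential phi) a :> (E -> C).
    apply/funext => z; rewrite /ddir dhat1.
    by rewrite (taylor_exponential1 hk hT _ _ d1).
  move=> /(_ h) /(congr1 (fun F : E -> C => F x)).
  by rewrite /ddir dhat1 linearZ.
have rec a j : (j.+1%:R : C) * taylor g 0 j.+1 a = phi a * taylor g 0 j a.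
  apply/eqP; rewrite -subr_eq0; apply/eqP.
  pose c i : C := (i.+1%:R : C) * taylor g 0 i.+1 a - phi a * taylor g 0 i a.
  apply: (@pser_zero_real _ c 1 ltr01) => s _ _.
  have [gx gt] := Exp_series hk g.
  pose t : C := s%:C%C; pose x : E := (t : R[i]) *: a.
  have h1 := gt x 1%N a; rewrite dg -(cvg_shiftS (fun n => \sum_(j < n) taylor (taylor g 0 j) x 1 a)) in h1.
  have h2 : (fun n => phi a * \sum_(j < n) taylor g 0 j x) @ \oo --> phi a * g x.
    by apply: cvgMr; exact: gx.
  apply: (@cvgC_ext (fun n => \sum_(j < n.+1) taylor (taylor g 0 j) x 1 a -
     phi a * \sum_(j < n) taylor g 0 j x)); last first.
    by rewrite -[X in _ --> X](subrr (phi a * g x)); apply: cvgB; [exact: h1|exact: h2].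
  move=> n; rewrite big_ord_recl.
  rewrite (taylor_ray _ _ _ (taylor_hpoly 0 0 (Exp_entire g))) bin0n /= !mul0r add0r.
  rewrite mulr_sumr -sumrB; apply: eq_bigr => i _.
  rewrite (taylor_ray _ _ _ (taylor_hpoly 0 _ (Exp_entire g))).
  rewrite (hpoly_hom _ _ (taylor_hpoly 0 i (Exp_entire g))) /bump /= add1n bin1 subn1 /= /c -/t.
  ring.
have cf a j : taylor g 0 j a = (j`!%:R)^-1 * phi a ^+ j * g 0.
  elim: j => [|j IH]; first by rewrite Exp_coef0 fact0 invr1 expr0 !mul1r.
  have j0 : (j.+1%:R : C) != 0 by rewrite pnatr_eq0.
  have f0 : (j`!%:R : C) != 0 by rewrite pnatr_eq0 -lt0n fact_gt0.
  apply: (mulfI j0); rewrite rec IH factS natrM exprS.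
  move: (j.+1%:R : C) (j`!%:R : C) j0 f0 => u v u0 v0.
  by field; rewrite u0 v0.
apply: Exp_ext => j; rewrite taylor_ExpZ (taylor_exponential hk hT _ d1).
by apply/funext => a; rewrite cf fctE -[_ *: _]/(_ * _) mulrC.
Qed.

Lemma symbol_line phi psi (t : C) : top_dual phi -> top_dual psi ->
  pser_cvg (fun m => L (mixed_exp phi psi m) 0) t (symbol (phi + (t : R[i]) *: psi)).
Proof.
move=> d1 d2; have [K K0 HK] := bnd_eval0 Theta hk.
have [m [G [G0 HG]]] := conv_bnd 0.
have dt := top_dualZ t d2.
have b0 : 0 <= dual_norm phi + 2 * dual_norm ((t : R[i]) *: psi).
  by apply: addr_ge0; [exact: dual_ge0|apply: mulr_ge0 => //; exact: dual_ge0].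
have [G1 G10 HG1] := exp_expand hk hT m b0.
apply: (@cvgC_zero_bound _ _ _ (K * (G * (2 * (G1 + 1))))) => n.
rewrite rnorm_distC.
have bd : bnd (exponential (phi + (t : R[i]) *: psi) - \sum_(i < n) mixed_exp phi ((t : R[i]) *: psi) i) m
    (2 * (G1 + 1) * 2^-1 ^+ n).
  apply: bnd_le (HG1 phi _ 2 n d1 dt (lexx 2) (lexx _)).
  by rewrite -exprVn ler_wpM2r ?exprn_ge0 // ler_wpM2l // lerDl.
have := HK _ _ _ (HG _ _ _ bd).
rewrite -!mulrA; set z := L _ 0.
have -> : z = symbol (phi + (t : R[i]) *: psi) - \sum_(i < n) t ^+ i * L (mixed_exp phi psi i) 0.
  rewrite /z raddfB raddf_sum.
  have -> : \sum_(i < n) L (mixed_exp phi ((t : R[i]) *: psi) i) = 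
     \sum_(i < n) (t ^+ i : R[i]) *: L (mixed_exp phi psi i).
    by apply: eq_bigr => i _; rewrite (mixed_exp_scale hk hT _ _ d1 d2) linearZ.
  rewrite -[LHS]/(exp_fun _ 0 - exp_fun _ 0); congr (_ - _).
  elim/big_rec2: _ => // i y1 y2 _ <-; by [].
apply; rewrite !mulr_gt0 ?exprn_gt0 // ltr_wpDl //.
Qed.

Local Opaque symbol.

Lemma bnd_zero (f : X) n : (forall e : R, 0 < e -> bnd f n e) -> f = 0.
Proof.
move=> H; apply: Exp_ext => j; rewrite taylor_Exp0.
have [w0 w00 Hw] := exp_weight_lower hk.
have wp : 0 < exp_weight k j :> R by exact: lt_le_trans (Hw j).
apply: (bs_norm_eq0 (ht_banach Theta j)); first exact: Exp_coef_in.
apply/eqP; rewrite eq_le Exp_norm_ge0 andbT -(ler_pM2l wp) mulr0.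
apply/ler_addgt0Pr => e e0; rewrite add0r.
have rn : 0 < wrad R n ^+ j by rewrite exprn_gt0 ?wrad_gt0.
have := H (e / wrad R n ^+ j) (divr_gt0 e0 rn) j.
by rewrite divfK // gt_eqF.
Qed.

(** If the symbol is constant, then L agrees with a multiple of the identity on the
exponentials, hence on the closed subspace that they span. *)
Lemma symbol_nonconst : nontrivial L -> exists phi psi,
  [/\ top_dual phi, top_dual psi & symbol phi != symbol psi].
Proof.
move=> nt; apply: contrapT => H; apply: nt.
pose c : C := symbol 0; exists c.
have sc phi : top_dual phi -> symbol phi = c.
  move=> d1; apply/eqP/negPn/negP => ne; apply: H; exists phi, 0.
  by split; [exact: d1|exact: top_dual0|].
pose M : set X := [set f | L f = (c : R[i]) *: f].
suff cM : closed_subspace M.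
  apply: (cs_full hk hT cM) => phi d1; by rewrite /M /= (conv_exponential d1) (sc _ d1).
split.
- by rewrite /M /= linear0 scaler0.
- move=> a f g; rewrite /M /= => fM gM.
  by rewrite linearP fM gM scalerDr !scalerA mulrC.
move=> f H1; rewrite /M /=; apply/eqP; rewrite -subr_eq0; apply/eqP.
apply: (@bnd_zero _ 0) => e e0.
have [m [G [G0 HG]]] := conv_bnd 0.
have r1 : 0 < G + (rnorm c + 1) by rewrite addr_gt0 // ltr_wpDl // rnorm_ge0.
have er : 0 < e / (G + (rnorm c + 1)) by exact: divr_gt0.
have [g gM gb] := H1 m _ er.
have -> : L f - (c : R[i]) *: f = L (f - g) + ((- c : C) : R[i]) *: (f - g).
  rewrite linearB /= (gM : L g = _) scaleNr scalerBr opprB.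
  by rewrite addrA subrK.
have h1 := HG _ _ er gb; have h2 := bndZ (- c) (bnd_mono (leq0n m) gb).
apply: bnd_le (bndD h1 h2); rewrite rnormN -mulrDl mulrCA ler_piMr ?(ltW e0) //.
by rewrite ler_pdivrMr // mul1r lerD2l lerDl.
Qed.

Lemma symbol_values : nontrivial L ->
  (exists2 phi, top_dual phi & rnorm (symbol phi) < 1) /\
  (exists2 phi, top_dual phi & 1 < rnorm (symbol phi)).
Proof.
move=> /symbol_nonconst[phi [psi [d1 d2 ne]]].
have d3 : top_dual (psi - phi) by rewrite -scaleN1r; exact: (top_dual_lin (-1) d2 d1).
pose h t := symbol (phi + (t : R[i]) *: (psi - phi)).
pose c m := L (mixed_exp phi (psi - phi) m) 0.
have H t : pser_cvg c t (h t) by exact: symbol_line.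
have cst : ~ (forall n, (0 < n)%N -> c n = 0).
  move=> cn; move/eqP: ne; apply.
  have ht t : h t = c 0%N.
    apply: (pser_unique (H t)); apply/cvgC_lt => e e0; exists 1%N => -[//|n] _.
    rewrite big_ord_recl expr0 mul1r big1 ?addr0 ?subrr ?rnorm0 // => i _.
    by rewrite cn ?mulr0.
  have e0 : phi + (0 : R[i]) *: (psi - phi) = phi by rewrite scale0r addr0.
  have e1 : phi + (1 : R[i]) *: (psi - phi) = psi by rewrite scale1r addrC subrK.
  have h0 : h 0 = symbol phi by exact: (congr1 symbol e0).
  have h1 : h 1 = symbol psi by exact: (congr1 symbol e1).
  exact: (etrans (esym h0) (etrans (ht 0) (etrans (esym (ht 1)) h1))).
have dh t : top_dual (phi + (t : R[i]) *: (psi - phi)) by exact: top_dual_lin.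
split; apply: contrapT => nex; apply: cst.
  apply: (liouville_bounded_below H) => t; rewrite leNgt; apply/negP => lt.
  by apply: nex; exists (phi + (t : R[i]) *: (psi - phi)); [exact: dh|exact: lt].
apply: (liouville_bounded H) => t; rewrite leNgt; apply/negP => lt.
by apply: nex; exists (phi + (t : R[i]) *: (psi - phi)); [exact: dh|exact: lt].
Qed.

Lemma symbol_cont phi psi (e : R) : top_dual phi -> top_dual psi -> 0 < e ->
  exists2 d : R, 0 < d & forall t : C, rnorm t <= d ->
    rnorm (symbol (phi + (t : R[i]) *: psi) - symbol phi) < e.
Proof.
move=> d1 d2 e0.
have [d d0 Hd] := pser_cont0 (h := fun t => symbol (phi + (t : R[i]) *: psi)) ltr01
  (fun t _ => @symbol_line phi psi t d1 d2) e0.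
have e1 : phi + (0 : R[i]) *: psi = phi by rewrite scale0r addr0.
exists d; [exact: d0|move=> t td; have := Hd t td; rewrite e1; exact].
Qed.

End Eigen.

(** * Separability *)

Section Separability.
Variables (R : realType).
Local Notation C := R[i]^o.

Definition gaussian (q r : rat) : C := (ratr q)%:C%C + 'i%C * (ratr r)%:C%C.

Lemma gaussian_dense (a : C) (e : R) : 0 < e -> exists q r, rnorm (a - gaussian q r) < e.
Proof.
move=> e0; have e2 : 0 < e / 2 by exact: divr_gt0.
have near (x : R) : exists q : rat, `|x - ratr q| < e / 2.
  have [q] : exists q, ratr q \in `](x - e / 2), (x + e / 2)[.
    by apply: rat_in_itvoo; lra.
  by rewrite in_itv /= => /andP[q1 q2]; exists q; rewrite ltr_norml; apply/andP; split; lra.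
have [q Hq] := near (complex.Re a); have [r Hr] := near (complex.Im a).
exists q, r; rewrite {1}(complexE a) /gaussian.
have ri : rnorm ('i%C : C) = 1.
  by apply: (@rnorm_root R 4 'i%C) => //; rewrite (exprM _ 2 2) sqr_i sqrrN expr1n.
have rr (x : R) : rnorm (x%:C%C : C) = `|x|.
  by rewrite /rnorm normc_def /= expr0n addr0 sqrtr_sqr.
have -> : (complex.Re a)%:C%C + 'i%C * (complex.Im a)%:C%C - ((ratr q)%:C%C + 'i%C * (ratr r)%:C%C) =
   (complex.Re a - ratr q)%:C%C + 'i%C * (complex.Im a - ratr r)%:C%C :> C.
  by rewrite !rmorphB; ring.
apply: le_lt_trans (rnormD _ _) _; rewrite rnormM ri mul1r !rr.
by rewrite [e]splitr ltrD.
Qed.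

Variables (E : completeNormedModType R[i]) (Theta : holomorphy_type E) (k : \bar R).
Hypothesis hk : (1 < k)%E.
Hypothesis hT : pi1_holomorphy_type Theta.
Local Notation X := (Exp Theta k).
Local Notation exponential := (@exponential R E Theta k).

Definition bnd_closure (A : set X) : set X :=
  [set f | forall n (e : R), 0 < e -> exists2 g, A g & bnd (f - g) n e].

Lemma sub_bnd_closure A : A `<=` bnd_closure A.
Proof. by move=> f Af n e e0; exists f => //; rewrite subrr; apply: bnd0; exact: ltW. Qed.

Lemma bnd_closureK A f : bnd_closure (bnd_closure A) f -> bnd_closure A f.
Proof.
move=> H n e e0; have e2 : 0 < e / 2 by exact: divr_gt0.
have [g clg fg] := H n _ e2; have [h Ah gh] := clg n _ e2.
exists h; first exact: Ah.
by rewrite [e]splitr; exact: bnd_tri fg gh.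
Qed.

Lemma bnd_closure_subspace A : A 0 ->
  (forall (a : C) f g, A f -> A g -> A ((a : R[i]) *: f + g)) -> closed_subspace (bnd_closure A).
Proof.
move=> A0 Alin; split; [exact: sub_bnd_closure| |exact: bnd_closureK].
move=> a f g fA gA n e e0.
have a1 : 0 < rnorm a + 1 by rewrite ltr_wpDl // rnorm_ge0.
have e1 : 0 < e / (rnorm a + 1) by exact: divr_gt0.
have [f' Af' ff'] := fA n _ e1; have [g' Ag' gg'] := gA n _ e1.
exists ((a : R[i]) *: f' + g'); first exact: Alin.
have -> : a *: f + g - (a *: f' + g') = (a : R[i]) *: (f - f') + (g - g').
  by rewrite scalerBr opprD addrACA.
apply: bnd_le (bnd_lin a ff' gg'); rewrite le_eqVlt; apply/orP; left; apply/eqP.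
by field; rewrite gt_eqF.
Qed.

Lemma separable_functionals : separable_dual E -> exists u : nat -> E -> C,
  (forall i, top_dual (u i)) /\
  forall phi, top_dual phi -> forall e : R, 0 < e -> exists i, dual_norm (phi - u i) < e.
Proof.
move=> [D [/countable_injP[f finj] Dsub Ddense]].
pose pick_prop i phi := D phi /\ f phi = i.
pose u i := xget 0 (pick_prop i).
exists u; split=> [i|phi dphi e e0].
  rewrite /u; case: xgetP => [phi _ [Dphi _]|_]; [exact: Dsub|exact: top_dual0].
have [psi Dpsi h] := Ddense phi dphi e e0; exists (f psi).
suff -> : u (f psi) = psi by [].
rewrite /u; case: xgetP => [phi' _ [D' f']|/(_ psi)]; last by case.
by apply: finj => //; rewrite inE.
Qed.

(** The combinations with Gaussian rational coefficients of the exponentials of a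
countable dense set of functionals are dense in those with complex
coefficients, which are dense because e^phi depends continuously on phi. *)
Lemma Exp_separable : separable_dual E ->
  exists y : nat -> X, forall f n (e : R), 0 < e -> exists i, bnd (y i - f) n e.
Proof.
move=> /separable_functionals[u [du udense]].
pose Z (s : seq (C * nat)) : X := \sum_(p <- s) (p.1 : R[i]) *: exponential (u p.2).
pose Y (s : seq (rat * rat * nat)) : X :=
  \sum_(p <- s) (gaussian p.1.1 p.1.2 : R[i]) *: exponential (u p.2).
have ZX f : bnd_closure (range Z) f.
  apply: (cs_full hk hT).
    apply: bnd_closure_subspace; first by exists [::] => //; rewrite /Z big_nil.
    move=> a _ _ [s _ <-] [t _ <-].
    exists ([seq ((a * p.1 : C), p.2) | p <- s] ++ t) => //.
    rewrite /Z big_cat big_map scaler_sumr; congr (_ + _).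
    by apply: eq_bigr => p _; rewrite scalerA.
  move=> phi dphi n e e0; have [d d0 Hd] := exponential_cont hk hT n dphi e0.
  have [i Hi] := udense phi dphi d d0.
  exists (exponential (u i)); first by exists [:: (1, i)] => //; rewrite /Z big_seq1 scale1r.
  have d1 : top_dual (u i - phi) by rewrite -scaleN1r; exact: (top_dual_lin (-1) (du i) dphi).
  have Hi' : dual_norm (u i - phi) < d.
    apply: le_lt_trans Hi; rewrite /dual_norm.
    rewrite (_ : [set rnorm ((u i - phi) x) | x in _] = [set rnorm ((phi - u i) x) | x in [set x : E | rnorm x <= 1]]) //.
    by apply/seteqP; split=> [_ [x x1 <-]|_ [x x1 <-]]; exists x => //; rewrite !fctE rnorm_distC.
  have := Hd _ d1 Hi'; rewrite [phi + _]addrC subrK => h.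
  exact: bnd_distC.
have YZ s : bnd_closure (range Y) (Z s).
  elim: s => [|[a i] s IH] n e e0.
    by exists 0; [exists [::] => //; rewrite /Y big_nil|rewrite /Z big_nil subrr; apply: bnd0; exact: ltW].
  have e2 : 0 < e / 2 by exact: divr_gt0.
  have [_ [t _ <-] st] := IH n _ e2.
  have [c c0 Hc] := bnd_ex (exponential (u i)) n.
  have [q [r Hqr]] := gaussian_dense a (divr_gt0 e2 c0).
  exists (Y ((q, r, i) :: t)); first by exists ((q, r, i) :: t).
  rewrite /Z /Y !big_cons /= -/(Z s) -/(Y t) opprD addrACA -scalerBl.
  rewrite [e]splitr; apply: bndD => //.
  by apply: bnd_le (bndZ (a - gaussian q r) Hc); rewrite -ler_pdivlMr // ltW.
exists (fun i => if unpickle i is Some s then Y s else 0) => f n e e0.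
have fY : bnd_closure (range Y) f.
  apply: bnd_closureK => m d d0; have [_ [s _ <-] h] := ZX f m d d0.
  by exists (Z s).
have [_ [s _ <-] h] := fY n e e0.
by exists (pickle s); rewrite pickleK; exact: bnd_distC.
Qed.

End Separability.

(** * Mixing and hypercyclicity *)

Section Dynamics.
Variables (R : realType) (E : completeNormedModType R[i]) (Theta : holomorphy_type E).
Variable (k : \bar R).
Hypothesis hk : (1 < k)%E.
Hypothesis hT : pi1_holomorphy_type Theta.
Local Notation C := R[i]^o.
Local Notation X := (Exp Theta k).
Local Notation exponential := (@exponential R E Theta k).
Variable L : {linear X -> X}.
Hypothesis hL : convolution_operator L.
Hypothesis hnt : nontrivial L.

Lemma rnorm_near_lt (z z0 : C) (r : R) : rnorm (z - z0) < r - rnorm z0 -> rnorm z < r.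
Proof.
rewrite ltrBrDr; apply: le_lt_trans.
by apply: le_trans (rnormD _ _); rewrite subrK.
Qed.

Lemma rnorm_near_gt (z z0 : C) (r : R) : rnorm (z - z0) < rnorm z0 - r -> r < rnorm z.
Proof.
rewrite rnorm_distC ltrBrDl -ltrBrDr => /lt_le_trans; apply.
by rewrite lerBlDl; apply: le_trans (rnormD _ _); rewrite subrK.
Qed.

Lemma iter_lin p (a : C) f g :
  iter p L ((a : R[i]) *: f + g) = (a : R[i]) *: iter p L f + iter p L g.
Proof. by elim: p => [//|p IH]; rewrite !iterS IH linearP. Qed.

Lemma iter_exponential p phi : top_dual phi ->
  iter p L (exponential phi) = (symbol L phi ^+ p : R[i]) *: exponential phi.
Proof.
move=> d1; elim: p => [|p IH]; first by rewrite scale1r.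
by rewrite iterS IH linearZ /= (conv_exponential hk hT hL d1) scalerA exprSr.
Qed.

Definition small (u : nat -> X) := forall n (e : R), 0 < e ->
  exists p0, forall p, (p0 <= p)%N -> bnd (u p) n e.

Lemma small_lin (a : C) u v : small u -> small v ->
  small (fun p => (a : R[i]) *: u p + v p).
Proof.
move=> su sv n e e0.
have a1 : 0 < rnorm a + 1 by rewrite ltr_wpDl // rnorm_ge0.
have e1 : 0 < e / (rnorm a + 1) by exact: divr_gt0.
have [p1 H1] := su n _ e1; have [p2 H2] := sv n _ e1.
exists (maxn p1 p2) => p; rewrite geq_max => /andP[/H1 h1 /H2 h2].
apply: bnd_le (bnd_lin a h1 h2); rewrite le_eqVlt; apply/orP; left; apply/eqP.
by field; rewrite gt_eqF.
Qed.

Lemma small_ext u v : (forall p, u p = v p) -> small u -> small v.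
Proof. by move=> uv; rewrite (_ : u = v) //; apply/funext. Qed.

Lemma small0 : small (fun=> 0).
Proof. by move=> n e e0; exists 0%N => p _; apply: bnd0; exact: ltW. Qed.

Lemma small_geo (a : C) f : rnorm a < 1 -> small (fun p => (a ^+ p : R[i]) *: f).
Proof.
move=> a1 n e e0; have [c c0 Hc] := bnd_ex f n.
have : (fun p => rnorm a ^+ p : R^o) @ \oo --> (0 : R^o).
  by apply: cvg_expr; rewrite ger0_norm ?rnorm_ge0.
move=> /cvgrPdist_lt/(_ _ (divr_gt0 e0 c0))[p0 _ H]; exists p0 => p /H /=.
rewrite sub0r normrN ger0_norm ?exprn_ge0 ?rnorm_ge0 // => h.
apply: bnd_le (bndZ (a ^+ p) Hc).
by rewrite rnormX -ler_pdivlMr // ltW.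
Qed.

(** The two subspaces of the Kitai criterion. An exponential whose symbol lies
inside the unit circle decays; one whose symbol z lies outside is reached from
the small vectors z^-p e^phi. *)
Definition decaying : set X := [set f | small (fun p => iter p L f)].
Definition backward : set X :=
  [set g | exists2 u : nat -> X, small u & forall p, iter p L (u p) = g].

Lemma decaying_eigen (z : C) f : rnorm z < 1 ->
  (forall p, iter p L f = (z ^+ p : R[i]) *: f) -> decaying f.
Proof. by move=> z1 H; apply: (small_ext (fun p => esym (H p))); exact: small_geo. Qed.

Lemma backward_eigen (z : C) f : 1 < rnorm z ->
  (forall p, iter p L f = (z ^+ p : R[i]) *: f) -> backward f.
Proof.
move=> z1 H.
have z0 : (z : R[i]) != 0.
  by apply/eqP => zE; move: z1; rewrite zE rnorm0 ltNge ler01.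
exists (fun p => ((z^-1 : C) ^+ p : R[i]) *: f).
  by apply: small_geo; rewrite rnormV invf_lt1 // (lt_trans ltr01).
move=> p; have := iter_lin p ((z^-1) ^+ p) f 0; rewrite addr0 => ->.
rewrite H (_ : iter p L 0 = 0) ?addr0; last first.
  by elim: p => //= p ->; rewrite linear0.
by rewrite scalerA -exprMn mulVf // expr1n scale1r.
Qed.

Lemma decaying_subspace : closed_subspace (bnd_closure decaying).
Proof.
apply: bnd_closure_subspace.
  apply: (small_ext _ small0) => p; elim: p => [//|p IH].
  by rewrite iterS -IH linear0.
move=> a g h gd hd; apply: (small_ext (fun p => esym (iter_lin p a g h))).
exact: small_lin.
Qed.

Lemma decaying_dense f : bnd_closure decaying f.
Proof.
have [[phi0 d0 s0] _] := symbol_values hk hT hL hnt.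
apply: (cs_full_at hk hT decaying_subspace d0).
move=> psi d1; have e0 : 0 < 1 - rnorm (symbol L phi0) by rewrite subr_gt0.
have [d dp Hd] := symbol_cont hk hT hL d0 d1 e0.
exists d; [exact: dp|move=> t /Hd h; apply: sub_bnd_closure].
have dt : top_dual (phi0 + (t : R[i]) *: psi) by exact: top_dual_lin.
exact: (decaying_eigen (rnorm_near_lt h) (fun p => iter_exponential p dt)).
Qed.

Lemma backward_dense f : bnd_closure backward f.
Proof.
have [_ [phi0 d0 s0]] := symbol_values hk hT hL hnt.
apply: (cs_full_at hk hT _ d0).
  apply: bnd_closure_subspace.
    by exists (fun=> 0); [exact: small0|elim=> //= p ->; rewrite linear0].
  move=> a g h [u su ug] [v sv vh].
  exists (fun p => (a : R[i]) *: u p + v p); first exact: small_lin.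
  by move=> p; rewrite iter_lin ug vh.
move=> psi d1; have e0 : 0 < rnorm (symbol L phi0) - 1 by rewrite subr_gt0.
have [d dp Hd] := symbol_cont hk hT hL d0 d1 e0.
exists d; [exact: dp|move=> t /Hd h; apply: sub_bnd_closure].
have dt : top_dual (phi0 + (t : R[i]) *: psi) by exact: top_dual_lin.
exact: (backward_eigen (rnorm_near_gt h) (fun p => iter_exponential p dt)).
Qed.

(** Take f' near f with L^p f' --> 0 and g' = L^p u_p near g with u_p --> 0; the
vector u_p + f' is near f, and L^p maps it to g' + L^p f', which is near g. *)
Lemma mixing_bnd f n (c : R) g n' (c' : R) : 0 < c -> 0 < c' ->
  exists p0, forall p, (p0 <= p)%N ->
    exists z, bnd (z - f) n c /\ bnd (iter p L z - g) n' c'.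
Proof.
move=> c0 c'0.
have c2 : 0 < c / 2 by exact: divr_gt0.
have c'2 : 0 < c' / 2 by exact: divr_gt0.
have [f' df ff'] := decaying_dense f n c2.
have [g' [u su ug] gg'] := backward_dense g n' c'2.
have [p1 H1] := su n _ c2; have [p2 H2] := df n' _ c'2.
exists (maxn p1 p2) => p; rewrite geq_max => /andP[/H1 h1 /H2 h2].
exists (u p + f'); split.
  by rewrite -addrA [c]splitr; apply: bndD => //; exact: bnd_distC.
have -> : iter p L (u p + f') - g = iter p L f' + (g' - g).
  have := iter_lin p 1 (u p) f'; rewrite !scale1r ug => ->.
  by rewrite addrAC addrC.
by rewrite [c']splitr; apply: bndD => //; exact: bnd_distC.
Qed.

Lemma conv_mixing : mixing L.
Proof.
move=> U V oU oV [f Uf] [g Vg].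
have [n [c [c0 HU]]] := open_bnd oU Uf; have [n' [c' [c'0 HV]]] := open_bnd oV Vg.
have [p0 H] := mixing_bnd f n g n' c0 c'0; exists p0 => p /H[z [zf zg]].
exists (iter p L z); split; last exact: HV.
by exists z => //; exact: HU.
Qed.

(** The balls are described by a centre, the index of a seminorm and a radius. The
s-th step shrinks the current ball so that some power of L maps the new one
close to y_i in the q-th seminorm, where (i, q) is the pair of code s. *)
Lemma conv_hypercyclic : separable_dual E -> hypercyclic L.
Proof.
move=> /(Exp_separable hk hT)[y ydense].
pose hits (st : X * nat * R) i q := exists p, forall z,
  bnd (z - st.1.1) st.1.2 (2 * st.2) -> bnd (iter p L z - y i) q (2 * wrad R q).
pose refines s (st st' : X * nat * R) := 0 < st.2 ->
  [/\ 0 < st'.2, st'.2 <= st.2 / 2, (st.1.2 <= st'.1.2)%N,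
      (s < st'.1.2)%N & st'.2 <= wrad R s.+1] /\
  bnd (st'.1.1 - st.1.1) st.1.2 (st.2 / 2) /\
  (forall i q, unpickle s = Some (i, q) -> hits st' i q).
have step (a : nat * (X * nat * R)) : exists st', refines a.1 a.2 st'.
  case: a => s [[x n] c]; rewrite /refines /=.
  have [c0|] := boolP (0 < c); last by exists (x, n, c).
  have c2 : 0 < c / 2 by exact: divr_gt0.
  (* (0, 0) is a dummy target when s is not the code of a pair *)
  pose iq : nat * nat := if unpickle s is Some iq then iq else (0%N, 0%N).
  have [p0 H] := mixing_bnd x n (y iq.1) iq.2 c2 (wrad_gt0 R iq.2).
  have [x' [xx' xy]] := H p0 (leqnn p0).
  have [m [G [G0 HG]]] := iter_bnd hL p0 iq.2.
  (* L^p0 multiplies radii by at most G, so it maps the double ball of radius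
     2 c' into a ball of radius 2 G c' <= wrad q around L^p0 x' *)
  pose c' := Num.min (Num.min (c / 2) (wrad R s.+1)) (wrad R iq.2 / (2 * G)).
  have G2 : 0 < 2 * G by exact: mulr_gt0.
  have c'0 : 0 < c' by rewrite !lt_min c2 wrad_gt0 divr_gt0 // wrad_gt0.
  have [h1 h2 h3] : [/\ c' <= c / 2, c' <= wrad R s.+1 & c' <= wrad R iq.2 / (2 * G)].
    by split; rewrite /c' !ge_min lexx ?orbT.
  exists (x', maxn (maxn m n) s.+1, c') => _; split=> /=; [|split; first exact: xx'].
    by split=> //; rewrite !leq_max ?leqnn ?orbT.
  move=> i q sE; exists p0 => z zx'.
  have [iE qE] : iq.1 = i /\ iq.2 = q by rewrite /iq sE.
  rewrite -iE -qE; have zm : bnd (z - x') m (2 * c').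
    by apply: bnd_mono zx'; rewrite !leq_max leqnn.
  have c'2 : 0 < 2 * c' by exact: mulr_gt0.
  have := HG _ _ c'2 zm.
  have -> : iter p0 L (z - x') = iter p0 L z - iter p0 L x'.
    have := iter_lin p0 (-1) x' z; rewrite !scaleN1r => h.
    by rewrite addrC h addrC.
  move=> hz; apply: bnd_le (bnd_tri hz xy).
  have : 2 * G * c' <= wrad R iq.2 by move: h3; rewrite ler_pdivlMr // mulrC.
  by rewrite mulrCA mulrA; move: (wrad R iq.2) => w; lra.
have [F HF] := @choice _ _ (fun a st' => refines a.1 a.2 st') step.
pose st := fix st s : X * nat * R := if s is s'.+1 then F (s', st s') else (0, 0%N, 1).
have stS s : refines s (st s) (st s.+1) by exact: (HF (s, st s)).
have c0 s : 0 < (st s).2.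
  by elim: s => [|s IH]; [exact: ltr01|have [[]] := stS s IH].
pose x s := (st s).1.1; pose n s := (st s).1.2; pose c s := (st s).2.
have ref s := (stS s (c0 s)).1; have refx s := (stS s (c0 s)).2.1.
have ns s : (s <= n s)%N by case: s => // s; have [_ _ _ h _] := ref s.
have cs s : c s <= wrad R s.
  by case: s => [|s]; [rewrite /wrad expr0|have [_ _ _ _ h] := ref s].
have xc s : bnd (x s.+1 - x s) s (wrad R s).
  have h := refx s; apply: bnd_mono (ns s) _; apply: bnd_le h.
  by apply: le_trans (cs s); rewrite ler_pdivrMr // ler_peMr ?ler1n // ltW // c0.
have [l Hl] := Exp_complete hk xc.
have xk k' s : bnd (x (s + k')%N - x s) (n s) (c s).
  elim: k' s => [|k' IH] s; first by rewrite addn0 subrr; apply: bnd0; exact: ltW (c0 s).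
  have [_ h1 h2 _ _] := ref s; have h3 := refx s.
  have h4 := bnd_mono h2 (bnd_le h1 (IH s.+1)).
  by rewrite addnS -addSn [c s]splitr; exact: bnd_tri h4 h3.
(* The limit stays only in the ball of twice the radius; this is why the
   condition hits is required on the double ball. *)
have lx s : bnd (l - x s) (n s) (2 * c s).
  have cp : 0 < c s / 2 by apply: divr_gt0 => //; exact: c0.
  have [t Ht] := wrad_small cp.
  pose k' := maxn t (n s).
  have h1 : bnd (l - x (s + k')%N) (n s) (c s).
    have nk : (n s <= s + k')%N by rewrite /k' (leq_trans (leq_maxr t (n s))) // leq_addl.
    apply: bnd_mono nk _; apply: bnd_le (Hl (s + k')%N).
    rewrite mulrC -ler_pdivlMr //; apply: le_trans Ht; apply: wrad_le.
    by rewrite /k' (leq_trans (leq_maxl t (n s))) // leq_addl.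
  by have := bnd_tri h1 (xk k' s); congr bnd; ring.
exists l => O [f Of] oO.
have [m [d [d0 HO]]] := open_bnd oO Of.
have d2 : 0 < d / 2 by exact: divr_gt0.
have [i Hi] := ydense f m _ d2.
have [q0 Hq0] := wrad_small (divr_gt0 d2 (@ltr0Sn R 1)).
pose q := maxn q0 m; pose s := pickle (i, q).
have [_ [_ /(_ i q)]] := stS s (c0 s).
rewrite pickleK => /(_ erefl)[p Hp]; have h := Hp l (lx s.+1).
exists (iter p L l); split; last by exists p.
apply: HO; rewrite [d]splitr.
apply: bnd_tri Hi; apply: bnd_mono (leq_maxr q0 m) _; apply: bnd_le h.
rewrite mulrC -ler_pdivlMr //; apply: le_trans Hq0; apply: wrad_le.
exact: leq_maxl.
Qed.

End Dynamics.

Theorem theorem4p1 (R : realType) (E : completeNormedModType R[i]) (k : \bar R)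
    (hk : (1 < k)%E) (hE : separable_dual E)
    (Theta : holomorphy_type E) (hTheta : pi1_holomorphy_type Theta)
    (L : {linear Exp Theta k -> Exp Theta k})
    (hL : convolution_operator L) (hnt : nontrivial L) :
  mixing L /\ hypercyclic L.
Proof.
split; first exact: (conv_mixing hk hTheta hL hnt).
exact: (conv_hypercyclic hk hTheta hL hnt hE).
Qed.
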